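(* Let $d\ge 2$. Every extreme point of the set $(S^*_d)$ is a Suffridge polynomial, i.e. if $f$ is an extreme point of $(S^*_d)$ then the curve $f(\mathbb T)$ has exactly $d-1$ cusps and $d-2$ double points.
   Context: $(S_d)$ is the set of polynomials $f(z)=z+a_2z^2+\dots+a_dz^d$ that are univalent in the unit disk $\mathbb D$, and $(S^*_d)=\{f\in(S_d): a_d=1/d\}$, regarded as a (compact) subset of the finite-dimensional real vector space of complex polynomials of degree $\le d$; an extreme point is a point not expressible as $\frac12(f_1+f_2)$ with $f_1\ne f_2$ in $(S^*_d)$. $\mathbb T$ is the unit circle. A cusp of $f(\mathbb T)$ is a point $f(\zeta)$ with $|\zeta|=1$, $f'(\zeta)=0$; a double point is a point $f(\zeta_1)=f(\zeta_2)$ with $|\zeta_1|=|\zeta_2|=1$, $\zeta_1\ne\zeta_2$. A Suffridge polynomial is an $f\in(S_d)$ for which $f(\mathbb T)$ has $d-1$ cusps and $d-2$ double points (the maximal possible numbers). *)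

(* Defs.v *)
From HB Require Import structures.
From mathcomp Require Import all_boot all_order all_algebra.
From mathcomp Require Import reals.
From mathcomp Require Import complex.
Set Implicit Arguments. Unset Strict Implicit. Unset Printing Implicit Defensive.
Import Order.TTheory GRing.Theory Num.Theory.
Local Open Scope ring_scope.
Local Open Scope complex_scope.

Section Defs.
Variable R : realType.
Notation C := (R[i]).

Definition univalent_disk (f : {poly C}) : Prop :=
  forall z w : C, `|z| < 1 -> `|w| < 1 -> f.[z] = f.[w] -> z = w.

Definition S_d (d : nat) (f : {poly C}) : Prop :=
  (size f <= d.+1)%N /\ f`_0 = 0 /\ f`_1 = 1 /\ univalent_disk f.

Definition Sstar_d (d : nat) (f : {poly C}) : Prop :=
  S_d d f /\ f`_d = (d%:R)^-1.

Definition extreme_point (K : {poly C} -> Prop) (f : {poly C}) : Prop :=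
  K f /\ forall f1 f2 : {poly C}, K f1 -> K f2 ->
    f = (2%:R)^-1 *: (f1 + f2) -> f1 = f2.

Definition has_card (A : C -> Prop) (n : nat) : Prop :=
  exists s : seq C, uniq s /\ size s = n /\ forall w, w \in s <-> A w.

Definition cusp (f : {poly C}) (w : C) : Prop :=
  exists zeta : C, `|zeta| = 1 /\ (f^`()).[zeta] = 0 /\ w = f.[zeta].

Definition double_point (f : {poly C}) (w : C) : Prop :=
  exists z1 z2 : C, `|z1| = 1 /\ `|z2| = 1 /\ z1 <> z2 /\
    w = f.[z1] /\ w = f.[z2].

Definition Suffridge (d : nat) (f : {poly C}) : Prop :=
  S_d d f /\ has_card (cusp f) (d.-1) /\ has_card (double_point f) (d.-2).

End Defs.

(* Main.v *)
Require Import Defs.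
From HB Require Import structures.
From mathcomp Require Import all_boot all_order all_algebra.
From mathcomp Require Import reals.
From mathcomp Require Import complex.
From mathcomp Require Import boolp classical_sets topology normedtype trigo.
From mathcomp Require Import ring lra zify.
Import Order.TTheory GRing.Theory Num.Theory.
Import numFieldNormedType.Exports.
Local Open Scope ring_scope.
Local Open Scope complex_scope.

(** Let [f] be in [(S*_d)]. Since [f'] has constant and leading coefficient [1] and no
    zero in the disk, all its zeros lie on the unit circle; univalence makes them simple
    and keeps the cusps apart, which gives [d - 1] cusps. Moreover [f'] is self-inversive,
    so the tangent of [f(T)] at [f(z)] has a direction depending on [z] only: the square of
    the outward normal [z f'(z)] is a positive multiple of [z ^ (d + 1)].

    At a double point [f(z) = f(w)] the normals are opposite, hence [z ^ (d + 1) =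
    w ^ (d + 1)]. The chords joining such pairs do not cross, and the points of the circle
    where some functional [Re (conj u f)] is maximal all lie on one side of each chord (a
    monodromy argument for [(f x - f y) / (x - y)] on a product of two chords). Measured in
    units of [2 pi / (d + 1)] the chords cut off arcs of integer length, so [N] chords use up
    at least [N] of the [d + 1] points of a generic coset of the roots of unity, and three
    further points of a suitable coset are left over: the support points for [u] and [- u],
    and a point close to the end of a chord. Hence [N <= d - 2].

    If [N < d - 2], the [N] linear conditions "the branches do not separate to first
    order" on the [(d - 2)]-dimensional real space of directions that preserve
    self-inversiveness have a nonzero solution [h]. As tangent directions are preserved,
    [f + e h] keeps the two branches on different sides of a common tangent line at each
    double point and stays univalent for small real [e], so [f] is not extreme. *)

(** No plane topology is used, neither the Jordan curve theorem nor winding numbers. Two things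
    replace it. Locally, a Newton estimate produces, for a direction [e], points of the disk near
    [zeta] with values [f.[zeta] + t e]; two distinct points with equal values cannot share such a
    direction. Globally, a nonvanishing Lipschitz function on a square has a continuous square root,
    and comparing its values at the four corners forces a cross ratio to be a positive real, which
    puts two points on the same side of a chord.

    First-order conditions suffice at a double point because [Re (z f''/f') = (d - 1) / 2] on the
    circle away from the cusps: the image is locally convex, so touching sheets are separated by
    their common tangent. The delicate place is a cusp, where [f'] vanishes: self-inversiveness
    keeps the perturbed critical point on the circle, and an expansion to third order about the
    moved point excludes two nearby preimages. Compactness of the closed bidisk makes the bounds
    uniform. *)

Local Notation Re := complex.Re.
Local Notation Im := complex.Im.
Local Notation "x ^*" := (conjc x) : ring_scope.

(** * Norm and inner product on the complex numbers *)

Section ComplexNorm.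
Set Implicit Arguments. Unset Strict Implicit. Unset Printing Implicit Defensive.
Variable R : realType.
Implicit Types (x y z u v : R[i]) (r s t : R).

Definition cnorm z : R := Num.sqrt (Re z ^+ 2 + Im z ^+ 2).

Definition dot u v : R := Re u * Re v + Im u * Im v.

Lemma cnormE z : `|z| = (cnorm z)%:C.
Proof. exact: normc_def. Qed.

Lemma ReD x y : Re (x + y) = Re x + Re y. Proof. by case: x; case: y. Qed.
Lemma ImD x y : Im (x + y) = Im x + Im y. Proof. by case: x; case: y. Qed.
Lemma ReN x : Re (- x) = - Re x. Proof. by case: x. Qed.
Lemma ImN x : Im (- x) = - Im x. Proof. by case: x. Qed.
Lemma ReM x y : Re (x * y) = Re x * Re y - Im x * Im y.
Proof. by case: x; case: y. Qed.
Lemma ImM x y : Im (x * y) = Re x * Im y + Im x * Re y.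
Proof. by case: x; case: y. Qed.
Lemma ReC r : Re r%:C = r. Proof. by []. Qed.
Lemma ImC r : Im r%:C = 0. Proof. by []. Qed.
Lemma ReJ x : Re x^* = Re x. Proof. by case: x. Qed.
Lemma ImJ x : Im x^* = - Im x. Proof. by case: x. Qed.
Lemma RecE r s : Re (r +i* s) = r. Proof. by []. Qed.
Lemma ImcE r s : Im (r +i* s) = s. Proof. by []. Qed.
Lemma Re1 : Re (1 : R[i]) = 1. Proof. by []. Qed.
Lemma Im1 : Im (1 : R[i]) = 0. Proof. by []. Qed.
Definition ReImE := (Re1, Im1, ReD, ImD, ReN, ImN, ReM, ImM, ReC, ImC, ReJ, ImJ).

Lemma complex_ext x y : Re x = Re y -> Im x = Im y -> x = y.
Proof. by case: x => a b; case: y => c d /= -> ->. Qed.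

Lemma cnorm_ge0 z : 0 <= cnorm z. Proof. exact: sqrtr_ge0. Qed.

Lemma cnorm_sqr z : cnorm z ^+ 2 = Re z ^+ 2 + Im z ^+ 2.
Proof. by rewrite sqr_sqrtr // addr_ge0 // sqr_ge0. Qed.

Lemma cnormM x y : cnorm (x * y) = cnorm x * cnorm y.
Proof. by apply: complexI; rewrite rmorphM /= -!cnormE normrM. Qed.

Lemma cnormV x : cnorm x^-1 = (cnorm x)^-1.
Proof. by apply: complexI; rewrite fmorphV /= -!cnormE normfV. Qed.

Lemma cnormX x n : cnorm (x ^+ n) = cnorm x ^+ n.
Proof. by apply: complexI; rewrite rmorphXn /= -!cnormE normrX. Qed.

Lemma cnormN x : cnorm (- x) = cnorm x.
Proof. by apply: complexI; rewrite -!cnormE normrN. Qed.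

Lemma cnormD x y : cnorm (x + y) <= cnorm x + cnorm y.
Proof. by rewrite -lecR rmorphD /= -!cnormE ler_normD. Qed.

Lemma cnormB x y : cnorm (x - y) <= cnorm x + cnorm y.
Proof. by rewrite -(cnormN y) cnormD. Qed.

Lemma cnormBC x y : cnorm (x - y) = cnorm (y - x).
Proof. by rewrite -cnormN opprB. Qed.

Lemma cnorm_eq0 z : (cnorm z == 0) = (z == 0).
Proof. by rewrite -[RHS]normr_eq0 cnormE (inj_eq (@complexI _)). Qed.

Lemma cnorm_gt0 z : (0 < cnorm z) = (z != 0).
Proof. by rewrite lt_neqAle cnorm_ge0 andbT eq_sym cnorm_eq0. Qed.

Lemma cnorm0 : cnorm 0 = 0. Proof. by apply/eqP; rewrite cnorm_eq0. Qed.

Lemma cnorm1 : cnorm 1 = 1.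
Proof. by apply: complexI; rewrite -cnormE normr1. Qed.

Lemma cnormC r : cnorm r%:C = `|r|.
Proof. by rewrite /cnorm /= expr0n addr0 sqrtr_sqr. Qed.

Lemma cnormJ z : cnorm z^* = cnorm z.
Proof. by case: z => a b; rewrite /cnorm /= sqrrN. Qed.

Lemma cnorm_prod (I : Type) (s : seq I) (F : I -> R[i]) :
  cnorm (\prod_(i <- s) F i) = \prod_(i <- s) cnorm (F i).
Proof.
by elim: s => [|a s IH]; rewrite ?big_nil ?cnorm1 // !big_cons cnormM IH.
Qed.

Lemma cnorm_lt1 z : (`|z| < 1) = (cnorm z < 1).
Proof. by rewrite cnormE -ltcR. Qed.

Lemma cnorm_norm1 z : (`|z| = 1) <-> (cnorm z = 1).
Proof. by rewrite cnormE; split => [[]//|->]. Qed.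

Lemma dotDr u x y : dot u (x + y) = dot u x + dot u y.
Proof. by rewrite /dot !ReImE; ring. Qed.

Lemma dotNr u x : dot u (- x) = - dot u x.
Proof. by rewrite /dot !ReImE; ring. Qed.

Lemma dotBr u x y : dot u (x - y) = dot u x - dot u y.
Proof. by rewrite dotDr dotNr. Qed.

Lemma dotZr u r x : dot u (r%:C * x) = r * dot u x.
Proof. by rewrite /dot !ReImE; ring. Qed.

Lemma dotNl x u : dot (- x) u = - dot x u.
Proof. by rewrite /dot !ReImE; ring. Qed.

Lemma dotZl u r x : dot (r%:C * u) x = r * dot u x.
Proof. by rewrite /dot !ReImE; ring. Qed.

Lemma dotC u v : dot u v = dot v u.
Proof. by rewrite /dot; ring. Qed.

Lemma dotM u x y : dot (u * x) (u * y) = cnorm u ^+ 2 * dot x y.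
Proof. by rewrite cnorm_sqr /dot !ReImE; ring. Qed.

Lemma dotxx z : dot z z = cnorm z ^+ 2.
Proof. by rewrite cnorm_sqr /dot !expr2. Qed.

Lemma dot1 z : dot 1 z = Re z.
Proof. by rewrite /dot /=; ring. Qed.

Lemma cnorm_sqrD x y : cnorm (x + y) ^+ 2 = cnorm x ^+ 2 + 2 * dot x y + cnorm y ^+ 2.
Proof. by rewrite !cnorm_sqr /dot !ReImE; ring. Qed.

Lemma dot_le u v : `|dot u v| <= cnorm u * cnorm v.
Proof.
rewrite -(@ler_pXn2r _ 2) ?nnegrE ?mulr_ge0 ?cnorm_ge0 // -normrX ger0_norm ?sqr_ge0 //.
rewrite exprMn !cnorm_sqr /dot.
have := sqr_ge0 (Re u * Im v - Im u * Re v); nra.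
Qed.

Lemma Re_le z : `|Re z| <= cnorm z.
Proof. by have := dot_le 1 z; rewrite dot1 cnorm1 mul1r. Qed.

Lemma Im_le z : `|Im z| <= cnorm z.
Proof.
rewrite -(@ler_pXn2r _ 2) ?nnegrE ?cnorm_ge0 // -normrX ger0_norm ?sqr_ge0 //.
by rewrite cnorm_sqr lerDr sqr_ge0.
Qed.

Lemma cnorm_le z : cnorm z <= `|Re z| + `|Im z|.
Proof.
rewrite -(@ler_pXn2r _ 2) ?nnegrE ?cnorm_ge0 ?addr_ge0 //.
rewrite cnorm_sqr -(real_normK (num_real (Re z))) -(real_normK (num_real (Im z))).
have := normr_ge0 (Re z); have := normr_ge0 (Im z); nra.
Qed.

Lemma mulJ z : z * z^* = (cnorm z ^+ 2)%:C.
Proof. by rewrite cnorm_sqr; apply: complex_ext; rewrite !ReImE; ring. Qed.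

Lemma unit_inv z : cnorm z = 1 -> z^-1 = z^*.
Proof.
move=> h; have z0 : z != 0 by rewrite -cnorm_gt0 h.
by apply: (mulfI z0); rewrite mulfV // mulJ h expr1n.
Qed.

Lemma inv_cnorm z : z^-1 = (cnorm z ^- 2)%:C * z^*.
Proof.
have [->|z0] := eqVneq z 0; first by rewrite invr0 rmorph0 mulr0.
apply: (mulfI z0); rewrite mulfV // mulrCA mulJ -rmorphM /= mulVf //.
by rewrite expf_neq0 // cnorm_eq0.
Qed.

End ComplexNorm.

(** * Compactness of the segment, the square, the disk and the bidisk *)

Section Cover.
Set Implicit Arguments. Unset Strict Implicit. Unset Printing Implicit Defensive.
Variable R : realType.

(** The parameter [e] is the size of a perturbation, or a margin; compactness serves to find one
    bound on [e] for the whole segment. The supremum of the right ends up to which a uniform bound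
    exists cannot lie below [b]. *)
Lemma cover_segment (P : R -> R -> Prop) (a b : R) :
  (forall t, a <= t <= b -> exists2 d : R, 0 < d &
     forall e s : R, `|e| < d -> `|s - t| < d -> P e s) ->
  exists2 d : R, 0 < d & forall e s : R, `|e| < d -> a <= s <= b -> P e s.
Proof.
move=> loc; have [ab|ba] := leP a b; last first.
  by exists 1 => // e s _ /andP[h1 h2]; move: (le_trans h1 h2); rewrite leNgt ba.
pose S : set R := [set x : R | a <= x <= b /\
   exists2 d : R, 0 < d & forall e s : R, `|e| < d -> a <= s <= x -> P e s]%classic.
have Sa : S a.
  split; first by rewrite lexx.
  have [|d d0 hd] := loc a; first by rewrite lexx.
  exists d => // e s he /andP[h1 h2]; apply: hd => //.
  by rewrite (le_anti (introT andP (conj h1 h2))) subrr normr0.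
have hS : has_sup S.
  split; first by exists a.
  by exists b => x [/andP[]].
have Sle x : S x -> x <= sup S by move=> ?; apply: sup_upper_bound.
have supS : a <= sup S <= b.
  rewrite Sle //=; apply: ge_sup; first by exists a.
  by move=> x [/andP[]].
have [d d0 hd] := loc _ supS.
have [y [/andP[ay yb] [d' d'0 hd']] hy] := sup_adherent d0 hS.
pose m := Num.min b (sup S + d / 2).
have Sm : S m.
  split.
    rewrite le_min ab ge_min lexx /= andbT.
    by apply: le_trans (_ : a <= sup S) _; [case/andP: supS | lra].
  exists (Num.min d d'); first by rewrite lt_min d0 d'0.
  move=> e s; rewrite lt_min => /andP[e1 e2] /andP[as_ ].
  rewrite le_min => /andP[sb sd].
  have [sy|ys] := leP s y; first by apply: hd' => //; rewrite as_ sy.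
  by apply: hd => //; rewrite ltr_norml; apply/andP; split; lra.
have mb : m = b.
  apply/eqP; rewrite eq_le ge_min lexx /= le_min lexx /=.
  have := Sle _ Sm; rewrite /m; case/andP: supS => _ hb.
  by rewrite ge_min; case/orP; lra.
by case: Sm => _ [dd dd0]; rewrite mb => h; exists dd.
Qed.

Lemma cover_square (P : R -> R -> R -> Prop) (a b : R) :
  (forall t t', a <= t <= b -> a <= t' <= b -> exists2 d : R, 0 < d &
     forall e s s' : R, `|e| < d -> `|s - t| < d -> `|s' - t'| < d -> P e s s') ->
  exists2 d : R, 0 < d & forall e s s' : R, `|e| < d ->
    a <= s <= b -> a <= s' <= b -> P e s s'.
Proof.
move=> loc.
have h0 : forall t, a <= t <= b -> exists2 d : R, 0 < d &
    forall s : R, `|s - t| < d -> forall e s' : R, `|e| < d -> a <= s' <= b -> P e s s'.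
  move=> t ht.
  (* [cover_segment] has room for one small parameter only, so [f] dominates both [e] and the
     distance from [s] to [t]. *)
  have [d d0 hd] : exists2 d : R, 0 < d & forall f s' : R, `|f| < d -> a <= s' <= b ->
      forall e s : R, `|e| <= `|f| -> `|s - t| <= `|f| -> P e s s'.
    apply: cover_segment => t' ht'; have [d d0 hd] := loc t t' ht ht'.
    exists d => // f s' hf hs' e s he hs.
    by apply: hd => //; apply: le_lt_trans hf.
  exists (d / 2); first by rewrite divr_gt0.
  move=> s hs e s' he hs'.
  have d2 : `|d / 2| = d / 2 by rewrite ger0_norm //; lra.
  by apply: (hd (d / 2)) => //; rewrite d2; lra.
have [d d0 hd] : exists2 d : R, 0 < d & forall f s : R, `|f| < d -> a <= s <= b ->
    forall e s' : R, `|e| <= `|f| -> a <= s' <= b -> P e s s'.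
  apply: cover_segment => t ht; have [d d0 hd] := h0 t ht.
  exists d => // f s hf hs e s' he hs'; apply: hd => //.
  exact: le_lt_trans hf.
exists (d / 2); first by rewrite divr_gt0.
move=> e s s' he hs hs'.
have d2 : `|d / 2| = d / 2 by rewrite ger0_norm //; lra.
by apply: (hd (d / 2)) => //; rewrite d2; lra.
Qed.

Lemma cover_disk (P : R -> R[i] -> Prop) :
  (forall z, cnorm z <= 1 -> exists2 d : R, 0 < d &
     forall (e : R) (x : R[i]), `|e| < d -> cnorm (x - z) < d -> cnorm x <= 1 -> P e x) ->
  exists2 d : R, 0 < d & forall (e : R) (x : R[i]), `|e| < d -> cnorm x <= 1 -> P e x.
Proof.
move=> loc.
have [d d0 hd] : exists2 d : R, 0 < d & forall e s s' : R, `|e| < d ->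
    -1 <= s <= 1 -> -1 <= s' <= 1 -> cnorm (s +i* s') <= 1 -> P e (s +i* s').
  apply: cover_square => t t' ht ht'.
  have small d s s' : 0 < d -> `|s - t| < d / 2 -> `|s' - t'| < d / 2 ->
      cnorm ((s +i* s') - (t +i* t')) < d.
    by move=> d0 h1 h2; apply: le_lt_trans (cnorm_le _) _; rewrite /=; lra.
  have [h1|h1] := leP (cnorm (t +i* t')) 1.
    have [d d0 hd] := loc _ h1; exists (d / 2); first by rewrite divr_gt0.
    by move=> e s s' he hs hs' hn; apply: hd => //; [lra | apply: small].
  (* A centre outside the disk: the neighbourhood is chosen to miss the disk, so that the claim is
     vacuous. *)
  exists ((cnorm (t +i* t') - 1) / 2); first by rewrite divr_gt0 // subr_gt0.
  move=> e s s' he hs hs' hn.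
  have h2 := small (cnorm (t +i* t') - 1) s s' _ hs hs'.
  have := h2 ltac:(by rewrite subr_gt0).
  have := cnormB (s +i* s') ((s +i* s') - (t +i* t')).
  by rewrite opprB addrC subrK; lra.
exists d => // e [s s'] he hx.
have b1 : -1 <= s <= 1 by rewrite -ler_norml; apply: le_trans (Re_le (s +i* s')) hx.
have b2 : -1 <= s' <= 1 by rewrite -ler_norml; apply: le_trans (Im_le (s +i* s')) hx.
exact: hd.
Qed.

Lemma cover_bidisk (P : R -> R[i] -> R[i] -> Prop) :
  (forall z z', cnorm z <= 1 -> cnorm z' <= 1 -> exists2 d : R, 0 < d &
     forall (e : R) (x x' : R[i]), `|e| < d -> cnorm (x - z) < d -> cnorm (x' - z') < d ->
       cnorm x <= 1 -> cnorm x' <= 1 -> P e x x') ->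
  exists2 d : R, 0 < d & forall (e : R) (x x' : R[i]), `|e| < d ->
    cnorm x <= 1 -> cnorm x' <= 1 -> P e x x'.
Proof.
move=> loc.
have h0 : forall z, cnorm z <= 1 -> exists2 d : R, 0 < d &
    forall x, cnorm (x - z) < d -> cnorm x <= 1 ->
    forall (e : R) (x' : R[i]), `|e| < d -> cnorm x' <= 1 -> P e x x'.
  move=> z hz.
  have [d d0 hd] : exists2 d : R, 0 < d & forall (f : R) (x' : R[i]), `|f| < d -> cnorm x' <= 1 ->
      forall (e : R) (x : R[i]), `|e| <= `|f| -> cnorm (x - z) <= `|f| -> cnorm x <= 1 -> P e x x'.
    apply: cover_disk => z' hz'; have [d d0 hd] := loc z z' hz hz'.
    exists d => // f x' hf hx' nx' e x he hx nx.
    by apply: hd => //; apply: le_lt_trans hf.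
  exists (d / 2); first by rewrite divr_gt0.
  move=> x hx nx e x' he nx'.
  have d2 : `|d / 2| = d / 2 by rewrite ger0_norm //; lra.
  by apply: (hd (d / 2)) => //; rewrite d2; lra.
have [d d0 hd] : exists2 d : R, 0 < d & forall (f : R) (x : R[i]), `|f| < d -> cnorm x <= 1 ->
    forall (e : R) (x' : R[i]), `|e| <= `|f| -> cnorm x' <= 1 -> P e x x'.
  apply: cover_disk => z hz; have [d d0 hd] := h0 z hz.
  exists d => // f x hf hx nx e x' he nx'; apply: hd => //.
  exact: le_lt_trans hf.
exists (d / 2); first by rewrite divr_gt0.
move=> e x x' he nx nx'.
have d2 : `|d / 2| = d / 2 by rewrite ger0_norm //; lra.
by apply: (hd (d / 2)) => //; rewrite d2; lra.
Qed.

End Cover.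

(** * Polynomials *)

Section Poly.
Set Implicit Arguments. Unset Strict Implicit. Unset Printing Implicit Defensive.
Variable R : realType.
Notation C := R[i].
Implicit Types (p f g : {poly C}) (x y z : C).

Lemma poly_bound p (M : R) :
  exists2 B : R, 0 <= B & forall x, cnorm x <= M -> cnorm p.[x] <= B.
Proof.
elim/poly_ind: p => [|p c [B B0 hB]].
  by exists 0 => // x _; rewrite horner0 cnorm0.
exists (B * Num.max M 0 + cnorm c).
  by rewrite addr_ge0 ?cnorm_ge0 // mulr_ge0 // le_max lexx orbT.
move=> x hx; rewrite !hornerE; apply: le_trans (cnormD _ _) _.
rewrite lerD2r cnormM ler_pM ?cnorm_ge0 ?hB //.
by rewrite le_max hx.
Qed.

Lemma poly_lip p (M : R) : exists2 L : R, 0 <= L &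
  forall x y, cnorm x <= M -> cnorm y <= M -> cnorm (p.[x] - p.[y]) <= L * cnorm (x - y).
Proof.
elim/poly_ind: p => [|p c [L L0 hL]].
  by exists 0 => // x y _ _; rewrite !horner0 subr0 cnorm0 mul0r.
have [B B0 hB] := poly_bound p M.
exists (L * Num.max M 0 + B).
  by rewrite addr_ge0 // mulr_ge0 // le_max lexx orbT.
move=> x y hx hy; rewrite !hornerE.
have -> : p.[x] * x + c - (p.[y] * y + c) = (p.[x] - p.[y]) * x + p.[y] * (x - y) by ring.
apply: le_trans (cnormD _ _) _; rewrite !cnormM mulrDl lerD //.
  rewrite mulrAC ler_pM ?cnorm_ge0 ?hL //; first by rewrite le_max hx.
by rewrite ler_wpM2r ?cnorm_ge0 ?hB.
Qed.

Lemma poly_near p z (e : R) : 0 < e ->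
  exists2 d : R, 0 < d & forall x, cnorm (x - z) < d -> cnorm (p.[x] - p.[z]) < e.
Proof.
move=> e0; have [L L0 hL] := poly_lip p (cnorm z + 1).
have L1 : 0 < L + 1 by lra.
exists (Num.min 1 (e / (L + 1))); first by rewrite lt_min ltr01 divr_gt0.
move=> x; rewrite lt_min ltr_pdivlMr // => /andP[h1 h2].
have hx : cnorm x <= cnorm z + 1.
  by have := cnormD z (x - z); rewrite addrC subrK; lra.
have := hL x z hx ltac:(by rewrite lerDl).
have := cnorm_ge0 (x - z); nra.
Qed.

Lemma prodXsub_logderiv (s : seq C) x : (\prod_(z <- s) ('X - z%:P)).[x] != 0 ->
  (\prod_(z <- s) ('X - z%:P))^`().[x] =
  (\prod_(z <- s) ('X - z%:P)).[x] * \sum_(z <- s) (x - z)^-1.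
Proof.
elim: s => [|a s IH]; first by rewrite !big_nil derivC horner0 mulr0.
rewrite !big_cons derivM derivXsubC mul1r !hornerE mulf_eq0 negb_or => /andP[h1 h2].
rewrite IH // mulrDr mulrAC mulfV // mul1r; ring.
Qed.

(** Since [p' / p] is the sum of the [1 / (x - r)] over the roots [r], the roots cannot all be far
    from [x] compared with [|p / p'|]. This quantitative root finder replaces the inverse function
    theorem. *)
Lemma newton_root p x : p^`().[x] != 0 -> exists2 r, root p r &
  cnorm (x - r) * cnorm p^`().[x] <= (size p)%:R * cnorm p.[x].
Proof.
move=> dp0; have [px0|px0] := eqVneq p.[x] 0.
  by exists x; [apply/rootP | rewrite subrr cnorm0 mul0r px0 cnorm0 mulr0].
have [s hs] := closed_field_poly_normal p.
have p0 : p != 0 by apply: contraNneq px0 => ->; rewrite horner0.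
have lc0 : lead_coef p != 0 by rewrite lead_coef_eq0.
have P0 : (\prod_(z <- s) ('X - z%:P)).[x] != 0.
  by apply: contraNneq px0 => h; rewrite hs hornerZ h mulr0.
have szs : size p = (size s).+1 by rewrite hs size_scale // size_prod_XsubC.
have hd : p^`().[x] = p.[x] * \sum_(z <- s) (x - z)^-1.
  by rewrite hs derivZ !hornerZ prodXsub_logderiv // mulrA.
apply: contrapT => /forall2NP noroot.
have ineq z : z \in s ->
    cnorm p.[x] * cnorm (x - z)^-1 * (size p)%:R <= cnorm p^`().[x].
  move=> zs; have rz : root p z by rewrite hs rootZ // root_prod_XsubC.
  have [/(_ rz) []|/negP] := noroot z; rewrite -ltNge => h.
  have xz : x - z != 0 by rewrite subr_eq0; apply: contraNneq px0 => ->; apply/eqP/rootP.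
  rewrite cnormV mulrAC ler_pdivrMr ?cnorm_gt0 //; lra.
have S0 : 0 < (size p)%:R :> R by rewrite ltr0n szs.
have tri (t : seq C) (h : {subset t <= s}) :
    cnorm p.[x] * cnorm (\sum_(z <- t) (x - z)^-1) * (size p)%:R <=
    (size t)%:R * cnorm p^`().[x].
  elim: t h => [|a t IH] h; first by rewrite big_nil cnorm0 mulr0 !mul0r.
  have h1 := IH (fun z zt => h z ltac:(by rewrite inE zt orbT)).
  have h2 := ineq a (h a (mem_head _ _)).
  have h3 := cnormD (x - a)^-1 (\sum_(z <- t) (x - z)^-1).
  rewrite big_cons /= -natr1 mulrDl mul1r.
  apply: le_trans (lerD h1 h2).
  rewrite -mulrDl ler_wpM2r ?(ltW S0) // -mulrDr ler_wpM2l ?cnorm_ge0 //.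
 by rewrite [leRHS]addrC.
(* [size p] exceeds the number of roots by one, and this makes the contradiction strict. *)
have := tri s (fun _ => id); rewrite -cnormM -hd szs -natr1.
have : 0 < cnorm p^`().[x] by rewrite cnorm_gt0.
by rewrite mulrC; nra.
Qed.

(** The quotient [(f x - f y) / (x - y)] by Horner's rule. Being polynomial in both variables it
    extends to the diagonal, where its value is [f'], and it is Lipschitz on bounded sets. *)
Fixpoint dqs (s : seq C) x y : C :=
  if s is c :: s' then dqs s' x y * x + horner_rec s' y else 0.
Definition dq f x y := dqs f x y.

Lemma dqP f x y : f.[x] - f.[y] = (x - y) * dq f x y.
Proof.
rewrite /dq /horner; elim: (polyseq f) => [|c s IH] /=; first by rewrite subrr mulr0.
rewrite mulrDr mulrA -IH; ring.
Qed.

Lemma horner_rec_Poly (s : seq C) x : horner_rec s x = (Poly s).[x].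
Proof. by elim: s => [|c s IH] /=; rewrite ?horner0 // horner_cons IH. Qed.

Lemma dq_diag f x : dq f x x = f^`().[x].
Proof.
rewrite -[f in RHS]polyseqK /dq; elim: (polyseq f) => [|c s IH] /=.
  by rewrite deriv0 horner0.
by rewrite cons_poly_def derivD derivC addr0 derivM derivX mulr1 !hornerE IH horner_rec_Poly.
Qed.

Lemma dqD f g x y : dq (f + g) x y = dq f x y + dq g x y.
Proof.
have [->|xy] := eqVneq x y; first by rewrite !dq_diag derivD hornerD.
apply: (@mulfI _ (x - y)); first by rewrite subr_eq0.
rewrite mulrDr -!dqP !hornerD; ring.
Qed.

Lemma dqZ (a : C) f x y : dq (a *: f) x y = a * dq f x y.
Proof.
have [->|xy] := eqVneq x y; first by rewrite !dq_diag derivZ hornerZ.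
apply: (@mulfI _ (x - y)); first by rewrite subr_eq0.
rewrite mulrCA -!dqP !hornerZ; ring.
Qed.

Lemma dq_lip f (M : R) : exists2 L : R, 0 <= L &
  forall x y x' y', cnorm x <= M -> cnorm y <= M -> cnorm x' <= M -> cnorm y' <= M ->
    cnorm (dq f x y - dq f x' y') <= L * (cnorm (x - x') + cnorm (y - y')).
Proof.
have [M0|M0] := leP 0 M; last first.
  by exists 0 => // x y x' y' hx; have := cnorm_ge0 x; lra.
suff [L L0 [B B0 hB]] : exists2 L : R, 0 <= L & exists2 B : R, 0 <= B &
  forall x y x' y', cnorm x <= M -> cnorm y <= M -> cnorm x' <= M -> cnorm y' <= M ->
    cnorm (dqs f x y) <= B /\
    cnorm (dqs f x y - dqs f x' y') <= L * (cnorm (x - x') + cnorm (y - y')).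
  by exists L => // x y x' y' h1 h2 h3 h4; case: (hB x y x' y').
elim: (polyseq f) => [|c s [L L0 [B B0 IH]]].
  exists 0 => //; exists 0 => // x y x' y' _ _ _ _ /=.
  by rewrite subr0 cnorm0 mul0r.
have [K K0 hK] := poly_lip (Poly s) M; have [D D0 hD] := poly_bound (Poly s) M.
exists (L * M + B + K); first by rewrite !addr_ge0 // mulr_ge0.
exists (B * M + D); first by rewrite !addr_ge0 // mulr_ge0.
move=> x y x' y' h1 h2 h3 h4 /=; rewrite !horner_rec_Poly; split.
  apply: le_trans (cnormD _ _) _; rewrite cnormM lerD ?hD // ler_pM ?cnorm_ge0 //.
  by case: (IH x y x' y').
have -> : dqs s x y * x + (Poly s).[y] - (dqs s x' y' * x' + (Poly s).[y']) =
  (dqs s x y - dqs s x' y') * x + dqs s x' y' * (x - x') +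
   ((Poly s).[y] - (Poly s).[y']) by ring.
apply: le_trans (cnormD _ _) _.
have := cnormD ((dqs s x y - dqs s x' y') * x) (dqs s x' y' * (x - x')).
rewrite !cnormM.
have [_ e1] := IH x y x' y' h1 h2 h3 h4.
have [e2 _] := IH x' y' x' y' h3 h4 h3 h4.
have e3 := hK y y' h2 h4.
have e4 : cnorm (dqs s x y - dqs s x' y') * cnorm x <=
    L * (cnorm (x - x') + cnorm (y - y')) * M by rewrite ler_pM ?cnorm_ge0.
have e5 : cnorm (dqs s x' y') * cnorm (x - x') <= B * cnorm (x - x').
  by rewrite ler_wpM2r ?cnorm_ge0.
have := cnorm_ge0 (x - x'); have := cnorm_ge0 (y - y').
have : 0 <= K * cnorm (x - x') by rewrite mulr_ge0 ?cnorm_ge0.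
have : 0 <= B * cnorm (y - y') by rewrite mulr_ge0 ?cnorm_ge0.
rewrite !mulrDl !mulrDr; lra.
Qed.

(** A Newton step from [x0 = zeta + s y]: the value to be killed is [O(s ^ (m + 2))] and the
    derivative at [x0] is at least of order [s ^ m], so a root lies at distance [O(s ^ 2)]. It
    stands in for a local inverse branch of order [m + 1]. *)
Lemma local_branch f (zeta : C) m G y : f = f.[zeta]%:P + ('X - zeta%:P) ^+ m.+1 * G ->
  G.[zeta] != 0 -> y != 0 -> exists2 K : R, 0 <= K & exists2 s0 : R, 0 < s0 &
  forall s : R, 0 < s < s0 -> exists2 z, cnorm (z - (zeta + s%:C * y)) <= K * s ^+ 2 &
    f.[z] = f.[zeta] + (s%:C * y) ^+ m.+1 * G.[zeta].
Proof.
move=> hf G0 y0.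
pose D := G *+ m.+1 + ('X - zeta%:P) * G^`().
have Dz : D.[zeta] = G.[zeta] *+ m.+1 by rewrite !(hornerE, hornerMn) subrr mul0r addr0.
have fD x : f^`().[x] = (x - zeta) ^+ m * D.[x].
  rewrite {1}hf /D derivD derivC add0r derivM deriv_exp derivXsubC mul1r.
  rewrite !(hornerE, hornerMn, horner_exp) /= exprS; ring.
set g := cnorm G.[zeta]; have g0 : 0 < g by rewrite cnorm_gt0.
have [L L0 hL] := poly_lip G (cnorm zeta + cnorm y).
have [d d0 hd] := @poly_near D zeta (g / 2) ltac:(by rewrite divr_gt0).
have ny : 0 < cnorm y by rewrite cnorm_gt0.
set N : R := (size f).+1%:R.
exists (2 * N * L * cnorm y ^+ 2 / g).
  by rewrite divr_ge0 ?(ltW g0) // !mulr_ge0 // ltW.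
exists (Num.min 1 (d / cnorm y)); first by rewrite lt_min ltr01 divr_gt0.
move=> s /andP[s0]; rewrite lt_min => /andP[s1]; rewrite ltr_pdivlMr // => sd.
have ns : cnorm (s%:C * y) = s * cnorm y by rewrite cnormM cnormC gtr0_norm.
set x0 := zeta + s%:C * y; have x0z : x0 - zeta = s%:C * y by rewrite /x0 addrC addKr.
have nx0 : cnorm x0 <= cnorm zeta + cnorm y.
  by apply: le_trans (cnormD _ _) _; rewrite ns lerD2l ler_piMl ?(ltW ny) ?(ltW s1).
pose q := f - (f.[zeta] + (s%:C * y) ^+ m.+1 * G.[zeta])%:P.
have dq0 : q^`() = f^`() by rewrite derivB derivC subr0.
have D1 : g / 2 <= cnorm D.[x0].
  have h1 : cnorm (D.[x0] - D.[zeta]) < g / 2 by apply: hd; rewrite x0z ns.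
  have h2 := cnormB D.[x0] (D.[x0] - D.[zeta]).
  have h3 : g <= cnorm D.[zeta].
    rewrite Dz -mulr_natl cnormM -/g ler_peMl ?(ltW g0) //.
    by rewrite -(rmorph_nat (real_complex R)) cnormC normr_nat ler1n.
  rewrite opprB addrC subrK in h2; lra.
have f'0 : cnorm f^`().[x0] = (s * cnorm y) ^+ m * cnorm D.[x0].
  by rewrite fD x0z cnormM cnormX ns.
have sy : 0 < s * cnorm y by rewrite mulr_gt0.
have f'p : 0 < cnorm f^`().[x0].
  by rewrite f'0 mulr_gt0 ?exprn_gt0 //; lra.
have [r rr hr] := @newton_root q x0 ltac:(by rewrite dq0 -cnorm_gt0).
exists r; last first.
  by move: rr; rewrite /root /q hornerD hornerN hornerC subr_eq0 => /eqP.
have q0 : cnorm q.[x0] <= (s * cnorm y) ^+ m.+1 * (L * (s * cnorm y)).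
  have -> : q.[x0] = (s%:C * y) ^+ m.+1 * (G.[x0] - G.[zeta]).
    rewrite /q hornerD hornerN hornerC {1}hf hornerD hornerC hornerM horner_exp.
    by rewrite hornerXsubC x0z; ring.
  rewrite cnormM cnormX ns ler_wpM2l ?exprn_ge0 ?(ltW sy) // -ns -x0z hL //.
  by rewrite lerDl ltW.
have szq : (size q)%:R <= N.
  rewrite ler_nat; apply: leq_trans (size_polyD _ _) _.
  rewrite size_polyN geq_max leqnSn /=; exact: leq_trans (size_polyC_leq1 _) _.
rewrite -cnormN opprB -/x0.
have e1 : cnorm (x0 - r) * ((s * cnorm y) ^+ m * (g / 2)) <=
    N * ((s * cnorm y) ^+ m * (s * cnorm y * (L * (s * cnorm y)))).
  apply: le_trans (_ : cnorm (x0 - r) * cnorm f^`().[x0] <= _).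
    by rewrite f'0 ler_wpM2l ?cnorm_ge0 // ler_wpM2l // exprn_ge0 ?(ltW sy).
  rewrite -dq0; apply: le_trans hr _; rewrite ler_pM ?cnorm_ge0 //.
  by apply: le_trans q0 _; rewrite exprSr -mulrA.
move: e1; rewrite mulrCA [N * _]mulrCA ler_pM2l ?exprn_gt0 // => e1.
have -> : 2 * N * L * cnorm y ^+ 2 / g * s ^+ 2 =
  N * (s * cnorm y * (L * (s * cnorm y))) / (g / 2) by field; rewrite lt0r_neq0.
by rewrite ler_pdivlMr // divr_gt0.
Qed.

(** When [y] points inwards, the linear term of [|zeta + s y| ^ 2 = 1 + 2 s (dot zeta y) + O(s ^ 2)]
    beats the quadratic error of the branch. *)
Lemma branch_disk f (zeta : C) m G y (d : R) :
  f = f.[zeta]%:P + ('X - zeta%:P) ^+ m.+1 * G -> G.[zeta] != 0 ->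
  cnorm zeta = 1 -> dot zeta y < 0 -> 0 < d ->
  exists2 s0 : R, 0 < s0 & forall s : R, 0 < s < s0 -> exists z,
    [/\ cnorm z < 1, cnorm (z - (zeta + s%:C * y)) <= d * s &
        f.[z] = f.[zeta] + (s%:C * y) ^+ m.+1 * G.[zeta]].
Proof.
move=> hf G0 z1 hy d0.
have y0 : y != 0 by apply: contraTneq hy => ->; rewrite /dot /= !mulr0 addr0 ltxx.
have [K K0 [s0 s00 h]] := local_branch hf G0 y0.
set A := 2 * K + (cnorm y + K) ^+ 2 + 1.
have A0 : 0 < A by rewrite /A ltr_wpDl // addr_ge0 ?sqr_ge0 // mulr_ge0.
exists (Num.min (Num.min 1 s0) (Num.min (d / (K + 1)) (- dot zeta y / A))).
  by rewrite !lt_min ltr01 s00 !divr_gt0 // ?oppr_gt0 //; lra.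
move=> s; rewrite !lt_min !ltr_pdivlMr //; last by lra.
move=> /andP[sp /andP[/andP[s1 ss0] /andP[s2 s3]]].
have [z hz fz] := h s ltac:(by rewrite sp).
exists z; split => //; last first.
  by apply: le_trans hz _; rewrite expr2 mulrA ler_wpM2r ?(ltW sp) //; move: s2; rewrite mulrDr mulr1; lra.
set err := z - (zeta + s%:C * y) in hz *.
have -> : z = zeta + (s%:C * y + err) by rewrite /err; ring.
rewrite -(@ltr_pXn2r _ 2) ?nnegrE ?cnorm_ge0 // expr1n cnorm_sqrD z1 expr1n dotDr dotZr.
have h1 := dot_le zeta err; rewrite z1 mul1r ler_norml in h1.
have h2 := cnormD (s%:C * y) err; rewrite cnormM cnormC gtr0_norm // in h2.
have h3 : cnorm (s%:C * y + err) <= s * (cnorm y + K).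
  by apply: le_trans h2 _; rewrite mulrDr lerD2l; apply: le_trans hz _;
    rewrite expr2 mulrA [s * K]mulrC ler_piMr ?(ltW s1) ?mulr_ge0 ?(ltW sp).
have h4 : cnorm (s%:C * y + err) ^+ 2 <= s ^+ 2 * (cnorm y + K) ^+ 2.
  by rewrite -exprMn ler_pXn2r ?nnegrE ?cnorm_ge0 // mulr_ge0 ?(ltW sp) // addr_ge0 ?cnorm_ge0.
have h5 : s * (s * A) < s * - dot zeta y by rewrite ltr_pM2l.
rewrite /A in h5; nra.
Qed.

End Poly.

(** * Local behaviour of univalent polynomials *)

Section Expi.
Set Implicit Arguments. Unset Strict Implicit. Unset Printing Implicit Defensive.
Variable R : realType.
Implicit Types (s t : R).

Definition expi t : R[i] := cos t +i* sin t.

Lemma expiD s t : expi (s + t) = expi s * expi t.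
Proof. by apply: complex_ext; rewrite !ReImE /= ?cosD ?sinD; ring. Qed.

Lemma expi0 : expi 0 = 1. Proof. by rewrite /expi cos0 sin0. Qed.

Lemma expiMn t n : expi (t *+ n) = expi t ^+ n.
Proof.
by elim: n => [|n IH]; rewrite ?mulr0n ?expi0 ?expr0 // mulrS exprS expiD IH.
Qed.

Lemma cnorm_expi t : cnorm (expi t) = 1.
Proof. by rewrite /cnorm /= cos2Dsin2 sqrtr1. Qed.

Lemma expiJ t : (expi t)^* = expi (- t).
Proof. by rewrite /expi cosN sinN. Qed.

Lemma expi_pi : expi pi = -1.
Proof. by apply: complex_ext; rewrite !ReImE /= ?cospi ?sinpi ?oppr0. Qed.

End Expi.

Section Dot.
Set Implicit Arguments. Unset Strict Implicit. Unset Printing Implicit Defensive.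
Variable R : realType.
Implicit Types (u v x : R[i]).

Lemma dot_lt_or u v : u != 0 -> v != 0 ->
  dot u v < cnorm u * cnorm v \/ exists2 r : R, 0 < r & v = r%:C * u.
Proof.
rewrite -!cnorm_gt0 => u0 v0.
have := ler_norm (dot u v); have := dot_le u v => h1 h2.
have := le_trans h2 h1; rewrite le_eqVlt => /orP[/eqP e|]; [right | by left].
exists (dot u v / cnorm u ^+ 2); first by rewrite e divr_gt0 ?mulr_gt0 // exprn_gt0.
have u2 : Re u ^+ 2 + Im u ^+ 2 != 0 by rewrite -cnorm_sqr expf_neq0 // lt0r_neq0.
have cr : Re u * Im v = Im u * Re v.
  apply/eqP; rewrite -subr_eq0 -sqrf_eq0; apply/eqP.
  have : dot u v ^+ 2 = cnorm u ^+ 2 * cnorm v ^+ 2 by rewrite e exprMn.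
  by rewrite !cnorm_sqr /dot => h; lra.
apply: complex_ext; rewrite !ReImE mul0r ?subr0 ?addr0 cnorm_sqr /dot.
  rewrite mulrAC; apply: (canRL (mulfK u2)).
  have := congr1 (fun x : R => x * Im u) cr; lra.
rewrite mulrAC; apply: (canRL (mulfK u2)).
have := congr1 (fun x : R => x * Re u) cr; lra.
Qed.

(** Minus the sum of the two normalised vectors works by the strict Cauchy-Schwarz inequality, which
    fails only for opposite vectors. *)
Lemma dot_sep u v : u != 0 -> v != 0 -> (forall r : R, 0 < r -> v <> (- r)%:C * u) ->
  exists2 e, dot u e < 0 & dot v e < 0.
Proof.
move=> u0 v0 h.
have nv0 : - v != 0 by rewrite oppr_eq0.
have [|[r r0 hr]] := dot_lt_or u0 nv0.
  have nu : 0 < cnorm u by rewrite cnorm_gt0.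
  have nv : 0 < cnorm v by rewrite cnorm_gt0.
  rewrite dotNr cnormN => h1.
  exists (- ((cnorm u)^-1%:C * u + (cnorm v)^-1%:C * v)).
    rewrite dotNr dotDr !dotZr dotxx oppr_lt0 expr2 mulrA mulVf ?lt0r_neq0 // mul1r.
    rewrite -(pmulr_lgt0 _ nv) mulrDl mulrAC mulVf ?lt0r_neq0 //; lra.
  rewrite dotNr dotDr !dotZr dotxx oppr_lt0 expr2 mulrA mulVf ?lt0r_neq0 // mul1r.
  rewrite -(pmulr_lgt0 _ nu) mulrDl mulrAC mulVf ?lt0r_neq0 // dotC; lra.
by case: (h r r0); rewrite rmorphN mulNr -hr opprK.
Qed.

End Dot.

Section Univalent.
Set Implicit Arguments. Unset Strict Implicit. Unset Printing Implicit Defensive.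
Variable R : realType.
Notation C := R[i].
Variable f : {poly C}.
Hypothesis f_uni : univalent_disk f.
Implicit Types (z u zeta e y : C).

Lemma univ z w : cnorm z < 1 -> cnorm w < 1 -> f.[z] = f.[w] -> z = w.
Proof. by rewrite -!cnorm_lt1; apply: f_uni. Qed.

Lemma univalent_factor zeta : exists m, exists2 G : {poly C},
  f = f.[zeta]%:P + ('X - zeta%:P) ^+ m.+1 * G & G.[zeta] != 0.
Proof.
have f0 : f - f.[zeta]%:P != 0.
  apply/eqP => h; have h1 (x : C) : f.[x] = f.[zeta].
    by apply/eqP; rewrite -subr_eq0 -[f.[zeta] in X in _ - X](hornerC _ x) -hornerN -hornerD h horner0.
  have /complexI/eqP : (0 : R)%:C = (2^-1 : R)%:C.
    apply: univ; rewrite ?h1 // cnormC ger0_norm ?invr_ge0 ?ltr01 //.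
    by rewrite invf_lt1 // ltr1n.
  by rewrite eq_sym invr_eq0 pnatr_eq0.
have [m [G Gz hG]] := multiplicity_XsubC (f - f.[zeta]%:P) zeta.
rewrite f0 /= in Gz; case: m hG => [|m] hG.
  have : root (f - f.[zeta]%:P) zeta by rewrite /root hornerD hornerN hornerC subrr.
  by rewrite hG expr0 mulr1 (negbTE Gz).
by exists m, G => //; rewrite mulrC -hG addrC subrK.
Qed.

Lemma factor_deriv zeta m (G : {poly C}) :
  f = f.[zeta]%:P + ('X - zeta%:P) ^+ m.+1 * G ->
  f^`().[zeta] = if m is 0 then G.[zeta] else 0.
Proof.
move=> ->; rewrite derivD derivC add0r derivM deriv_exp derivXsubC mul1r.
rewrite !(hornerE, hornerMn, horner_exp) /= subrr.
by case: m => [|m]; rewrite /= ?expr0 ?exprS; ring.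
Qed.

Lemma factor_deriv2 zeta (G : {poly C}) :
  f = f.[zeta]%:P + ('X - zeta%:P) ^+ 2 * G ->
  f^`()^`().[zeta] = 2 * G.[zeta].
Proof.
move=> ->; rewrite derivD derivC add0r derivM deriv_exp derivXsubC mul1r expr1.
rewrite !(derivXsubC, derivM, deriv_exp, derivMn, derivD).
rewrite !(hornerE, hornerMn, horner_exp) /= subrr.
by ring.
Qed.

(** At a zero of order [m + 2] of the difference with the value at [z], the directions [a] and
    [conj a] with [a ^ (m + 2) = -1] lead to the same value, hence to two preimages that separate at
    first order in [s]. *)
Lemma deriv_in z : cnorm z < 1 -> f^`().[z] != 0.
Proof.
move=> z1; have [m [G hf G0]] := univalent_factor z.
case: m hf => [|m] hf; first by rewrite (factor_deriv hf).
pose a := expi (pi / m.+2%:R : R).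
have an : a ^+ m.+2 = -1.
  by rewrite -expiMn -[_ *+ _]mulr_natr divfK ?expi_pi // pnatr_eq0.
have an' : (a^*) ^+ m.+2 = -1 by rewrite -rmorphXn /= an rmorphN rmorph1.
have pia : 0 < (pi / m.+2%:R : R) < pi.
  rewrite divr_gt0 ?pi_gt0 ?ltr0n //= ltr_pdivrMr ?ltr0n // ltr_pMr ?pi_gt0 //.
  by rewrite ltr1n.
have ia : 0 < Im a by apply: sin_gt0_pi.
have a0 : a != 0 by rewrite -cnorm_gt0 cnorm_expi.
have a'0 : a^* != 0 by rewrite -cnorm_gt0 cnormJ cnorm_expi.
have [K K0 [s0 s00 hs]] := local_branch hf G0 a0.
have [K' K'0 [s0' s00' hs']] := local_branch hf G0 a'0.
have z0 : 0 < 1 - cnorm z by lra.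
have [s sp [h1 h2 h3 h4 h5]] : exists2 s : R, 0 < s &
    [/\ s < s0, s < s0', s * (K + K' + 1) < 2 * Im a,
        s < 1 & s * (K + K' + 1) < 1 - cnorm z].
  have A0 : 0 < K + K' + 1 by lra.
  pose s := Num.min (Num.min s0 s0')
    (Num.min (2 * Im a / (K + K' + 1)) (Num.min 1 ((1 - cnorm z) / (K + K' + 1)))).
  have sp : 0 < s by rewrite !lt_min s00 s00' ltr01 !divr_gt0 // mulr_gt0.
  exists (s / 2); first by rewrite divr_gt0.
  have : s / 2 < s by lra.
  by rewrite /s !lt_min !ltr_pdivlMr // => /andP[/andP[-> ->] /and3P[-> -> ->]].
have [x1 e1 f1] := hs s ltac:(by rewrite sp).
have [x2 e2 f2] := hs' s ltac:(by rewrite sp).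
have ne (x : C) k : cnorm (x - (z + s%:C * k)) <= Num.max K K' * s ^+ 2 ->
    cnorm k = 1 -> cnorm x < 1.
  move=> hx k1.
  have -> : x = z + (s%:C * k + (x - (z + s%:C * k))) by ring.
  apply: le_lt_trans (cnormD _ _) _.
  have := cnormD (s%:C * k) (x - (z + s%:C * k)); rewrite cnormM cnormC k1 gtr0_norm //.
  have : Num.max K K' <= K + K' by rewrite ge_max lerDl lerDr K0 K'0.
  have : 0 <= K + K' by rewrite addr_ge0.
  move=> ? ? ?; have : Num.max K K' * s ^+ 2 <= (K + K') * s.
    by rewrite ler_pM ?sqr_ge0 ?le_max ?K0 // expr2 ler_piMr ?ltW.
  rewrite !mulrDr mulr1 in h5; lra.
have n1 : cnorm x1 < 1.
  apply: ne (cnorm_expi _); apply: le_trans e1 _.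
  by rewrite ler_wpM2r ?sqr_ge0 // le_max lexx.
have n2 : cnorm x2 < 1.
  apply: (@ne _ a^*); last by rewrite cnormJ cnorm_expi.
  by apply: le_trans e2 _; rewrite ler_wpM2r ?sqr_ge0 // le_max lexx orbT.
have x12 : x1 = x2 by apply: univ => //; rewrite f1 f2 !exprMn an an'.
have e3 : cnorm (s%:C * (a - a^*)) <= (K + K') * s ^+ 2.
  have -> : s%:C * (a - a^*) = (x2 - (z + s%:C * a^*)) - (x1 - (z + s%:C * a)).
    by rewrite x12; ring.
  by apply: le_trans (cnormB _ _) _; rewrite mulrDl addrC lerD.
have := Im_le (a - a^*); rewrite !ReImE opprK ger0_norm; last by lra.
move: e3; rewrite cnormM cnormC gtr0_norm // expr2 mulrCA ler_pM2l // => e3.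
rewrite !mulrDr mulr1 in h3; lra.
Qed.

(** From order 3 on, the angle [pi / (m + 3)] is less than a right angle, so both [- zeta a] and
    [- zeta (conj a)] point into the disk and the argument for interior points works at the
    boundary. *)
Lemma deriv2_bd zeta : cnorm zeta = 1 -> f^`().[zeta] = 0 -> f^`()^`().[zeta] != 0.
Proof.
move=> z1 d0; have [m [G hf G0]] := univalent_factor zeta.
case: m hf => [|[|m]] hf.
- by rewrite (factor_deriv hf) in d0; rewrite d0 eqxx in G0.
- by rewrite (factor_deriv2 hf) mulf_neq0 // pnatr_eq0.
pose a := expi (pi / m.+3%:R : R).
have an : a ^+ m.+3 = -1.
  by rewrite -expiMn -[_ *+ _]mulr_natr divfK ?expi_pi // pnatr_eq0.
have an' : (a^*) ^+ m.+3 = -1 by rewrite -rmorphXn /= an rmorphN rmorph1.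
have pi0 : 0 < pi :> R := pi_gt0 R.
have /andP[pa1 pa2] : 0 < (pi / m.+3%:R : R) < pi / 2.
  rewrite divr_gt0 ?pi_gt0 ?ltr0n //= ltr_pM2l // ltf_pV2 ?posrE ?ltr0n //.
  by rewrite ltr_nat.
have ia : 0 < Im a by apply: sin_gt0_pi; rewrite pa1 (lt_trans pa2) //; lra.
have ra : 0 < Re a by apply: cos_gt0_pihalf; rewrite pa2 andbT (lt_trans _ pa1) //; lra.
have dz (k : C) : dot zeta (- zeta * k) = - Re k.
  by rewrite mulNr -[zeta in dot zeta _]mulr1 dotNr dotM z1 expr1n mul1r dot1.
have Ia0 : 0 < Im a / 2 by lra.
have [|s0 s00 hs] := @branch_disk _ _ _ _ _ (- zeta * a) _ hf G0 z1 _ Ia0.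
  by rewrite dz oppr_lt0.
have [|s0' s00' hs'] := @branch_disk _ _ _ _ _ (- zeta * a^*) _ hf G0 z1 _ Ia0.
  by rewrite dz oppr_lt0 ReJ.
pose s := Num.min s0 s0' / 2.
have sm : 0 < Num.min s0 s0' by rewrite lt_min s00.
have sp : 0 < s by rewrite divr_gt0.
have : s < Num.min s0 s0' by rewrite /s; lra.
rewrite lt_min => /andP[h1 h2].
have [x1 [n1 e1 f1]] := hs s ltac:(by rewrite sp).
have [x2 [n2 e2 f2]] := hs' s ltac:(by rewrite sp).
have x12 : x1 = x2 by apply: univ => //; rewrite f1 f2 !exprMn an an'.
have e3 : cnorm (s%:C * (- zeta) * (a - a^*)) <= Im a * s.
  have -> : s%:C * (- zeta) * (a - a^*) =
     (x2 - (zeta + s%:C * (- zeta * a^*))) - (x1 - (zeta + s%:C * (- zeta * a))).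
    by rewrite x12; ring.
  apply: le_trans (cnormB _ _) _; lra.
have := Im_le (a - a^*); rewrite !ReImE opprK ger0_norm; last by lra.
move: e3; rewrite !cnormM cnormC cnormN z1 gtr0_norm // mulr1 mulrC ler_pM2r //; lra.
Qed.

(** The image of the disk near [zeta] contains an initial piece of the ray from [f.[zeta]] in
    direction [e]. The preimages are required close to [zeta], so that those belonging to two
    different points are different. *)
Definition covers zeta e := forall d : R, 0 < d -> exists2 t0 : R, 0 < t0 &
  forall t : R, 0 < t < t0 -> exists z,
    [/\ cnorm z < 1, cnorm (z - zeta) < d & f.[z] = f.[zeta] + t%:C * e].

(** The direction [e] pulls back to [e / f'(zeta)], which points inwards exactly when [e] makes an
    obtuse angle with the outward normal. *)
Lemma covers_reg zeta e : cnorm zeta = 1 -> f^`().[zeta] != 0 ->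
  dot (zeta * f^`().[zeta]) e < 0 -> covers zeta e.
Proof.
move=> z1 d0 he d dp; have [m [G hf G0]] := univalent_factor zeta.
have hd := factor_deriv hf; case: m hf hd => [|m] hf hd; last by rewrite hd eqxx in d0.
have e1 : e / G.[zeta] * G.[zeta] = e by rewrite divfK.
have hy : dot zeta (e / G.[zeta]) < 0.
  rewrite -(@pmulr_rlt0 _ (cnorm G.[zeta] ^+ 2)) ?exprn_gt0 ?cnorm_gt0 //.
  by rewrite -dotM ![G.[_] * _]mulrC e1 -hd.
have n0 : 0 < cnorm (e / G.[zeta]) + 1 by rewrite ltr_wpDl ?cnorm_ge0.
have [s0 s00 hs] := branch_disk hf G0 z1 hy ltr01.
exists (Num.min s0 (d / (cnorm (e / G.[zeta]) + 1))).
  by rewrite lt_min s00 divr_gt0.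
move=> t; rewrite lt_min ltr_pdivlMr // => /andP[t0 /andP[ts td]].
have [z [nz ez fz]] := hs t ltac:(by rewrite t0).
exists z; split => //; last by rewrite fz expr1 -mulrA e1.
apply: le_lt_trans td.
have -> : z - zeta = (z - (zeta + t%:C * (e / G.[zeta]))) + t%:C * (e / G.[zeta]) by ring.
apply: le_trans (cnormD _ _) _; rewrite cnormM cnormC gtr0_norm // mulrDr mulr1; lra.
Qed.

(* Near a cusp the image leaves out at most one direction, [e0]. *)
Lemma covers_cusp zeta : cnorm zeta = 1 -> f^`().[zeta] = 0 -> exists2 e0, e0 != 0 &
  forall e, e != 0 -> (forall r : R, 0 < r -> e <> r%:C * e0) -> covers zeta e.
Proof.
move=> z1 d0; have [m [G hf G0]] := univalent_factor zeta.
case: m hf => [|[|m]] hf.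
- by rewrite (factor_deriv hf) in d0; rewrite d0 eqxx in G0.
- have zn0 : zeta != 0 by rewrite -cnorm_gt0 z1.
  (* A tangential [y], that is [zeta] times [t] times the imaginary unit, gives
     [y ^ 2 G(zeta) = - t ^ 2 zeta ^ 2 G(zeta)]; for every other [y], one of [y] and [- y] points
     inwards. *)
  exists (- (zeta ^+ 2 * G.[zeta])).
    by rewrite oppr_eq0 mulf_neq0 // expf_neq0.
  suff main y : dot zeta y < 0 -> covers zeta (y ^+ 2 * G.[zeta]).
    move=> e en0 he; pose y := sqrtC (e / G.[zeta]).
    have ey : e = y ^+ 2 * G.[zeta] by rewrite sqrtCK divfK.
    have [h|h|h] := ltgtP (dot zeta y) 0.
    + by rewrite ey; apply: main.
    + by rewrite ey -sqrrN; apply: main; rewrite dotNr oppr_lt0.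
    have yE : y = zeta * (zeta^* * y) by rewrite mulrA mulJ z1 expr1n mul1r.
    have ry : Re (zeta^* * y) = 0 by rewrite -h /dot !ReImE; ring.
    case: (he (Im (zeta^* * y) ^+ 2)).
      rewrite lt_neqAle sqr_ge0 andbT eq_sym sqrf_eq0; apply: contraNneq en0 => iy.
      by rewrite ey yE (_ : zeta^* * y = 0) ?mulr0 ?expr0n ?mul0r //; apply: complex_ext.
    rewrite ey {1}yE exprMn.
    have -> : (zeta^* * y) ^+ 2 = - (Im (zeta^* * y) ^+ 2)%:C.
      case: (zeta^* * y) ry => a b /= ->.
      by apply: complex_ext; rewrite !(expr2, ReImE) /= !(mul0r, mulr0) ?sub0r ?addr0 ?oppr0.
    ring.
  move=> hy d dp.
  have n0 : 0 < cnorm y + 1 by rewrite ltr_wpDl ?cnorm_ge0.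
  have [s0 s00 hs] := branch_disk hf G0 z1 hy ltr01.
  pose s1 := Num.min s0 (d / (cnorm y + 1)).
  have s10 : 0 < s1 by rewrite lt_min s00 divr_gt0.
  exists (s1 ^+ 2); first by rewrite exprn_gt0.
  move=> t /andP[t0 t1]; pose s := Num.sqrt t.
  have sp : 0 < s by rewrite sqrtr_gt0.
  have s2 : s ^+ 2 = t by rewrite sqr_sqrtr // ltW.
  have : s < s1 by rewrite -(@ltr_pXn2r _ 2) ?nnegrE ?ltW // s2.
  rewrite lt_min ltr_pdivlMr // => /andP[ss sd].
  have [z [nz ez fz]] := hs s ltac:(by rewrite sp).
  exists z; split => //; last by rewrite fz exprMn -mulrA -rmorphXn /= s2.
  apply: le_lt_trans sd.
  have -> : z - zeta = (z - (zeta + s%:C * y)) + s%:C * y by ring.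
  apply: le_trans (cnormD _ _) _; rewrite cnormM cnormC gtr0_norm // mulrDr mulr1; lra.
have := deriv2_bd z1 d0.
rewrite (@factor_deriv2 zeta (('X - zeta%:P) ^+ m.+1 * G)); last first.
  by rewrite mulrA -exprD add2n.
by rewrite hornerM horner_exp hornerXsubC subrr expr0n mul0r mulr0 eqxx.
Qed.

Lemma covers_in zeta e : cnorm zeta < 1 -> covers zeta e.
Proof.
move=> z1 d dp; have [m [G hf G0]] := univalent_factor zeta.
have hd := factor_deriv hf; case: m hf hd => [|m] hf hd; last first.
  by have := deriv_in z1; rewrite hd eqxx.
have [->|e0] := eqVneq e 0.
  by exists 1 => // t _; exists zeta; rewrite subrr cnorm0 mulr0 addr0.
have e1 : e / G.[zeta] * G.[zeta] = e by rewrite divfK.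
have y0 : e / G.[zeta] != 0 by rewrite mulf_neq0 // invr_neq0.
have [K K0 [s0 s00 hs]] := local_branch hf G0 y0.
set y := e / _ in e1 y0 hs.
have n0 : 0 < cnorm y + K + 1 by rewrite ltr_wpDl // addr_ge0 ?cnorm_ge0.
pose d1 := Num.min d (1 - cnorm zeta).
have d10 : 0 < d1 by rewrite lt_min dp subr_gt0.
exists (Num.min (Num.min 1 s0) (d1 / (cnorm y + K + 1))).
  by rewrite !lt_min s00 ltr01 divr_gt0.
move=> t; rewrite !lt_min ltr_pdivlMr // => /andP[t0 /andP[/andP[t1 ts] td]].
have [z ez fz] := hs t ltac:(by rewrite t0).
have zz : cnorm (z - zeta) < d1.
  apply: le_lt_trans td.
  have -> : z - zeta = (z - (zeta + t%:C * y)) + t%:C * y by ring.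
  apply: le_trans (cnormD _ _) _; rewrite cnormM cnormC gtr0_norm // !mulrDr mulr1.
  have : K * t ^+ 2 <= t * K by rewrite expr2 mulrA [t * K]mulrC ler_piMr ?(ltW t1) ?mulr_ge0 ?(ltW t0).
  lra.
move: zz; rewrite lt_min => /andP[z2 z3].
exists z; split => //; last by rewrite fz expr1 -mulrA e1.
have -> : z = zeta + (z - zeta) by ring.
by apply: le_lt_trans (cnormD _ _) _; lra.
Qed.

Lemma covers_disjoint z w e : z != w -> f.[z] = f.[w] -> covers z e -> ~ covers w e.
Proof.
move=> zw fzw cz cw; pose d := cnorm (z - w) / 2.
have d0 : 0 < d by rewrite divr_gt0 // cnorm_gt0 subr_eq0.
have [t t0 ht] := cz d d0; have [t' t0' ht'] := cw d d0.
pose s := Num.min t t' / 2.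
have sm : 0 < Num.min t t' by rewrite lt_min t0.
have sp : 0 < s by rewrite divr_gt0.
have : s < Num.min t t' by rewrite /s; lra.
rewrite lt_min => /andP[h1 h2].
have [x1 [n1 e1 f1]] := ht s ltac:(by rewrite sp).
have [x2 [n2 e2 f2]] := ht' s ltac:(by rewrite sp).
have x12 : x1 = x2 by apply: univ => //; rewrite f1 f2 fzw.
have := cnormD (z - x1) (x2 - w); rewrite x12 addrA subrK (cnormBC z) -x12.
by rewrite {2}x12; move: e1 e2; rewrite /d; lra.
Qed.

End Univalent.

(** * Boundary points *)

Section Boundary.
Set Implicit Arguments. Unset Strict Implicit. Unset Printing Implicit Defensive.
Variable R : realType.
Notation C := R[i].
Variable f : {poly C}.
Hypothesis f_uni : univalent_disk f.
Implicit Types (z w u zeta e y : C).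

Notation nu z := (z * f^`().[z]).

(** The vectors [- u] and [- u * (1 +i* 1)] lie in the open half plane and on different rays, so the
    one direction left out at the cusp is that of at most one of them. *)
Lemma cusp_cone zeta u : cnorm zeta = 1 -> f^`().[zeta] = 0 -> u != 0 ->
  exists2 e, dot u e < 0 & covers f zeta e.
Proof.
move=> z1 d0 u0; have [e0 e00 h] := covers_cusp f_uni z1 d0.
have pu : 0 < cnorm u ^+ 2 by rewrite exprn_gt0 // cnorm_gt0.
have u1 : dot u (- u) < 0 by rewrite dotNr dotxx oppr_lt0.
have u2 : dot u (- u * (1 +i* 1)) < 0.
  by move: pu; rewrite cnorm_sqr /dot !(ReImE, RecE, ImcE) !mulr1; nra.
have nz e : dot u e < 0 -> e != 0.
  by apply: contraTneq => ->; rewrite /dot /= !mulr0 addr0 ltxx.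
have [[r [r0 e1]]|n1] := pselect (exists r : R, 0 < r /\ - u = r%:C * e0); last first.
  exists (- u) => //; apply: h; first exact: nz.
  by move=> r r0 e; apply: n1; exists r.
exists (- u * (1 +i* 1)) => //; apply: h; first exact: nz.
move=> s s0; rewrite e1 mulrAC => /(mulIf e00)/(congr1 (@complex.Im R)).
by rewrite !(ReD, ImD, ReM, ImM, ReC, ImC, RecE, ImcE) mulr1 mul0r addr0 => rs; rewrite rs ltxx in r0.
Qed.

(** The condition [dot e0 e < 0] avoids the ray of [e0]; of two candidates on different rays in that
    half plane, one avoids the ray of [e1]. *)
Lemma cusp_cusp zeta w : cnorm zeta = 1 -> f^`().[zeta] = 0 ->
  cnorm w = 1 -> f^`().[w] = 0 -> exists2 e, covers f zeta e & covers f w e.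
Proof.
move=> z1 d0 w1 dw; have [e0 e00 h0] := covers_cusp f_uni z1 d0.
have [e1 e10 h1] := covers_cusp f_uni w1 dw.
have [e he h] : exists2 e, dot e0 e < 0 & e != 0 /\ forall r : R, 0 < r -> e <> r%:C * e1.
  have p0 : 0 < cnorm e0 ^+ 2 by rewrite exprn_gt0 // cnorm_gt0.
  have u1 : dot e0 (- e0) < 0 by rewrite dotNr dotxx oppr_lt0.
  have u2 : dot e0 (- e0 * (1 +i* 1)) < 0.
    by move: p0; rewrite cnorm_sqr /dot !(ReImE, RecE, ImcE) !mulr1; nra.
  have nz e : dot e0 e < 0 -> e != 0.
    by apply: contraTneq => ->; rewrite /dot /= !mulr0 addr0 ltxx.
  have [[r [r0 er]]|n1] := pselect (exists r : R, 0 < r /\ - e0 = r%:C * e1); last first.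
    exists (- e0) => //; split; first exact: nz.
    by move=> r r0 e; apply: n1; exists r.
  exists (- e0 * (1 +i* 1)) => //; split; first exact: nz.
  move=> s s0; rewrite er mulrAC => /(mulIf e10)/(congr1 (@complex.Im R)).
  by rewrite !(ReD, ImD, ReM, ImM, ReC, ImC, RecE, ImcE) mulr1 mul0r addr0 => rs; rewrite rs ltxx in r0.
case: h => e_0 he1; exists e; last exact: h1.
apply: h0 => // r r0 er; move: he; rewrite er dotZr dotxx.
by rewrite pmulr_rlt0 // ltNge sqr_ge0.
Qed.

Lemma nu_neq0 z : cnorm z = 1 -> f^`().[z] != 0 -> nu z != 0.
Proof. by move=> z1 dz; rewrite mulf_neq0 // -cnorm_gt0 z1. Qed.

Lemma covers_some zeta : cnorm zeta = 1 -> exists e, covers f zeta e.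
Proof.
move=> z1; have [d0|d0] := eqVneq f^`().[zeta] 0.
  have [e _ he] := cusp_cone z1 d0 (oner_neq0 _).
  by exists e.
exists (- nu zeta); apply: covers_reg => //.
by rewrite dotNr dotxx oppr_lt0 exprn_gt0 // cnorm_gt0 nu_neq0.
Qed.

Lemma interior_neq_boundary z zeta : cnorm z < 1 -> cnorm zeta = 1 -> f.[z] <> f.[zeta].
Proof.
move=> z1 zt fe; have [e he] := covers_some zt.
have ne : z != zeta by apply: contraTneq z1 => ->; rewrite zt ltxx.
exact: (covers_disjoint f_uni ne fe (covers_in f_uni e z1) he).
Qed.

(** The image near a cusp omits at most one direction, so it would meet the image near any other
    boundary point with the same value. *)
Lemma double_regular z w : cnorm z = 1 -> cnorm w = 1 -> z != w -> f.[z] = f.[w] ->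
  f^`().[z] != 0.
Proof.
move=> z1 w1 zw fe; apply/eqP => dz.
have [dw|dw] := eqVneq f^`().[w] 0.
  have [e cz cw] := cusp_cusp z1 dz w1 dw.
  exact: (covers_disjoint f_uni zw fe cz cw).
have [e he cz] := cusp_cone z1 dz (nu_neq0 w1 dw).
exact: (covers_disjoint f_uni zw fe cz (covers_reg f_uni w1 dw he)).
Qed.

(* The images of the disk near [z] and [w] are disjoint and each nearly fills a
   half plane, so the two outward normals are opposite. *)
Lemma double_normals z w : cnorm z = 1 -> cnorm w = 1 -> z != w -> f.[z] = f.[w] ->
  exists2 r : R, 0 < r & nu w = (- r)%:C * nu z.
Proof.
move=> z1 w1 zw fe; apply: contrapT => /forall2NP h.
have dz := double_regular z1 w1 zw fe.
have dw : f^`().[w] != 0 by apply: (@double_regular w z); rewrite // eq_sym.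
have [|e e1 e2] := dot_sep (nu_neq0 z1 dz) (nu_neq0 w1 dw).
  by move=> r r0; case: (h r).
exact: (covers_disjoint f_uni zw fe (covers_reg f_uni z1 dz e1) (covers_reg f_uni w1 dw e2)).
Qed.

(** Three normals cannot be pairwise opposite. *)
Lemma no_triple x y z : cnorm x = 1 -> cnorm y = 1 -> cnorm z = 1 ->
  x != y -> y != z -> x != z -> f.[x] = f.[y] -> f.[y] = f.[z] -> False.
Proof.
move=> x1 y1 z1 xy yz xz e1 e2.
have [r r0 hr] := double_normals x1 y1 xy e1.
have [s s0 hs] := double_normals y1 z1 yz e2.
have [t t0 ht] := double_normals x1 z1 xz (etrans e1 e2).
have dx := double_regular x1 y1 xy e1.
move: ht; rewrite hs hr mulrA => /(mulIf (nu_neq0 x1 dx)).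
rewrite -rmorphM => /complexI; nra.
Qed.

Definition support u zeta := cnorm zeta = 1 /\
  forall z, cnorm z <= 1 -> dot u f.[z] <= dot u f.[zeta].

Lemma support_covers u zeta e : support u zeta -> covers f zeta e -> dot u e <= 0.
Proof.
move=> [z1 h] /(_ 1 ltr01) [t0 t00 ht].
have [|z [nz _ fz]] := ht (t0 / 2); first by apply/andP; split; lra.
have := h z (ltW nz); rewrite fz dotDr dotZr gerDl pmulr_rle0 //; lra.
Qed.

(** If the normal were not a positive multiple of [u], some direction [e] with [dot u e > 0] would
    be covered; at a cusp there always is one. *)
Lemma support_normal u zeta : u != 0 -> support u zeta ->
  f^`().[zeta] != 0 /\ exists2 r : R, 0 < r & nu zeta = r%:C * u.
Proof.
move=> u0 h; have z1 := h.1.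
have dz : f^`().[zeta] != 0.
  apply/eqP => d0; have [|e he ce] := cusp_cone z1 d0 (_ : - u != 0).
    by rewrite oppr_eq0.
  by have := support_covers h ce; rewrite dotNl in he; lra.
split=> //; apply: contrapT => /forall2NP hn.
have nu0 : - u != 0 by rewrite oppr_eq0.
have [|e e1 e2] := dot_sep nu0 (nu_neq0 z1 dz).
  by move=> r r0; case: (hn r) => // hne; rewrite rmorphN mulrNN.
have := support_covers h (covers_reg f_uni z1 dz e2).
by rewrite dotNl in e1; lra.
Qed.

Lemma support_exists u : u != 0 -> exists zeta, support u zeta.
Proof.
move=> u0; pose S : set R := [set dot u f.[z] | z in [set z | cnorm z <= 1]]%classic.
have n0 : cnorm (0 : C) <= 1 by rewrite cnorm0.
have [B B0 hB] := poly_bound f 1.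
have hS : has_sup S.
  split; first by exists (dot u f.[0]), 0.
  exists (cnorm u * B) => _ [z /= hz <-].
  apply: le_trans (ler_norm _) _; apply: le_trans (dot_le _ _) _.
  by rewrite ler_wpM2l ?cnorm_ge0 ?hB.
have ub z : cnorm z <= 1 -> dot u f.[z] <= sup S.
  by move=> hz; apply: sup_upper_bound => //; exists z.
have [z hz mz] : exists2 z, cnorm z <= 1 & dot u f.[z] = sup S.
  apply: contrapT => /forall2NP nomax.
  have nu1 : 0 < cnorm u by rewrite cnorm_gt0.
  (* The parameter of [cover_disk] is here the margin below the supremum; a uniform margin
     contradicts its being the least upper bound. *)
  have [d d0 hd] : exists2 d : R, 0 < d & forall (e : R) x, `|e| < d ->
      cnorm x <= 1 -> dot u f.[x] <= sup S - e.
    apply: cover_disk => z hz.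
    have : dot u f.[z] < sup S.
      by rewrite lt_neqAle ub // andbT; apply/eqP; case: (nomax z).
    rewrite -subr_gt0; set g := sup S - _ => g0.
    have [|d d0 hd] := @poly_near _ f z (g / 2 / cnorm u); first by rewrite !divr_gt0.
    exists (Num.min d (g / 2)); first by rewrite lt_min d0 divr_gt0.
    move=> e x; rewrite !lt_min => /andP[_ he] /andP[hx _] _.
    have := hd x hx; rewrite ltr_pdivlMr // mulrC => h1.
    have := dot_le u (f.[x] - f.[z]); rewrite dotBr => h2.
    have := ler_norm (dot u f.[x] - dot u f.[z]).
    have := ler_norm e; rewrite /g in he h1; lra.
  have h : ubound S (sup S - d / 2).
    by move=> _ [z /= hz <-]; apply: hd => //; rewrite ger0_norm; lra.
  by have := ge_sup hS.1 h; lra.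
exists z; split; last by rewrite mz.
apply/eqP; rewrite eq_le hz /= leNgt; apply/negP => z1.
have [t0 t00 ht] := covers_in f_uni u z1 ltr01.
have [|x [nx _ fx]] := ht (t0 / 2); first by apply/andP; split; lra.
have := ub x (ltW nx); rewrite fx dotDr dotZr mz dotxx gerDl.
by apply/negP; rewrite -ltNge mulr_gt0 ?exprn_gt0 ?cnorm_gt0 //; lra.
Qed.

Lemma support_not_double u z w : u != 0 -> support u z -> cnorm w = 1 -> z != w ->
  f.[z] != f.[w].
Proof.
move=> u0 h w1 zw; apply/eqP => fe; have z1 := h.1.
have h' : support u w by split=> // x hx; rewrite -fe h.2.
have [dz [r r0 hr]] := support_normal u0 h.
have [_ [s s0 hs]] := support_normal u0 h'.
have [t t0 ht] := double_normals z1 w1 zw fe.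
move: ht; rewrite hr hs mulrA => /(mulIf u0); rewrite -rmorphM => /complexI; nra.
Qed.

(** The sheet at [w] lies beyond the tangent at [z]: for some interior [x], the vector [f.[x] -
    f.[z]] has positive scalar product with the normal at [z]. This persists when [z] moves a
    little, and it fails at support points. *)
Lemma no_support_near_double z w : cnorm z = 1 -> cnorm w = 1 -> z != w -> f.[z] = f.[w] ->
  exists2 d : R, 0 < d & forall u x, u != 0 -> cnorm (x - z) < d -> ~ support u x.
Proof.
move=> z1 w1 zw fe; have [r r0 hr] := double_normals z1 w1 zw fe.
have dz := double_regular z1 w1 zw fe.
have dw : f^`().[w] != 0 by apply: (@double_regular w z); rewrite // eq_sym.
have nz := nu_neq0 z1 dz; pose n := nu z.
have n2 : 0 < cnorm n ^+ 2 by rewrite exprn_gt0 // cnorm_gt0.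
have cw : covers f w n.
  by apply: covers_reg; rewrite // hr dotZl dotxx mulNr oppr_lt0 mulr_gt0.
have [t0 t00 ht] := cw 1 ltr01.
have [|x [nx _ fx]] := ht (t0 / 2); first by apply/andP; split; lra.
pose g (y : C) := dot (nu y) (f.[x] - f.[y]).
have gz : 0 < g z by rewrite /g fx fe addrAC subrr add0r dotZr dotxx mulr_gt0 // divr_gt0.
pose G : {poly C} := 'X * f^`().
have GE y : G.[y] = nu y by rewrite /G hornerM hornerX.
have [B B0 hB] := poly_bound G 2; have [D D0 hD] := poly_bound f 2.
have [M M0 [hM1 hM2]] : exists2 M : R, 0 < M &
    (forall y, cnorm y <= 2 -> cnorm G.[y] <= M) /\
    (forall y, cnorm y <= 2 -> cnorm f.[y] <= M).
  exists (B + D + 1); first by rewrite ltr_wpDl // addr_ge0.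
  split=> y hy; first by have := hB y hy; lra.
  by have := hD y hy; lra.
have [d1 d10 hd1] := @poly_near _ G z (g z / (4 * M)) ltac:(by rewrite divr_gt0 // mulr_gt0).
have [d2 d20 hd2] := @poly_near _ f z (g z / (4 * M)) ltac:(by rewrite divr_gt0 // mulr_gt0).
exists (Num.min 1 (Num.min d1 d2)); first by rewrite !lt_min ltr01 d10.
move=> u y u0; rewrite !lt_min => /and3P[y1 hy1 hy2] hs.
have [dy [s s0 hsu]] := support_normal u0 hs.
have : dot (nu y) (f.[x] - f.[y]) <= 0.
  by rewrite hsu dotZl dotBr pmulr_rle0 // subr_le0 hs.2 // ltW.
apply/negP; rewrite -ltNge -/(g y).
have -> : g y = g z + dot (G.[y] - G.[z]) (f.[x] - f.[y]) - dot G.[z] (f.[y] - f.[z]).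
  by rewrite /g -!GE /dot !ReImE; ring.
have := hd1 y hy1; have := hd2 y hy2.
have Mn : 0 < 4 * M by rewrite mulr_gt0.
rewrite !ltr_pdivlMr // => b2 b1.
have n2z : cnorm y <= 2.
  by rewrite hs.1; lra.
have a1 := dot_le (G.[y] - G.[z]) (f.[x] - f.[y]).
have a2 := dot_le G.[z] (f.[y] - f.[z]).
have a3 := cnormB f.[x] f.[y].
have a4 := hM2 x ltac:(lra); have a5 := hM2 y n2z; have a6 := hM1 z ltac:(rewrite z1; lra).
have c1 : cnorm (G.[y] - G.[z]) * cnorm (f.[x] - f.[y]) <= cnorm (G.[y] - G.[z]) * (2 * M).
  by rewrite ler_wpM2l ?cnorm_ge0 //; lra.
have c2 : cnorm G.[z] * cnorm (f.[y] - f.[z]) <= M * cnorm (f.[y] - f.[z]).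
  by rewrite ler_wpM2r ?cnorm_ge0.
rewrite !ler_norml in a1 a2; lra.
Qed.

End Boundary.

(** * Monodromy on a square *)

Section Sqrt.
Set Implicit Arguments. Unset Strict Implicit. Unset Printing Implicit Defensive.
Variable R : realType.
Notation C := R[i].
Implicit Types (x y s t : C).

(* The values of the principal square root on the right half plane. *)
Definition sector s := `|Im s| <= Re s.

Lemma sqrtc_sector x : 0 <= Re x -> sector (sqrtc x).
Proof.
move=> hx; have h : 0 <= Re (sqrtc x) by case: x {hx} => a b; rewrite /sqrtc /= sqrtr_ge0.
move: hx; rewrite -{1}(sqr_sqrtc x) expr2 ReM subr_ge0 -!expr2 /sector => hx.
by rewrite -(@ler_pXn2r _ 2) ?nnegrE // real_normK ?num_real.
Qed.

Lemma sector_dot s t : sector s -> sector t -> 0 <= dot s t.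
Proof.
rewrite /sector /dot !ler_norml => /andP[h1 h2] /andP[h3 h4].
have [h|h] := leP 0 (Im s); have [k|k] := leP 0 (Im t); nra.
Qed.

Lemma sector_inj s t : sector s -> sector t -> s ^+ 2 = t ^+ 2 -> s = t.
Proof.
move=> hs ht /eqP; rewrite eqf_sqr => /orP[/eqP//|/eqP st].
have := sector_dot hs ht; rewrite st dotNl dotxx oppr_ge0 => h.
have : cnorm t ^+ 2 == 0 by rewrite eq_le h sqr_ge0.
by rewrite sqrf_eq0 cnorm_eq0 => /eqP ->; rewrite oppr0.
Qed.

(** Two roots [s], [t] in the sector satisfy [|s - t| <= |s + t|], and the product of both sides is
    [|x - y|]. *)
Lemma sqrtc_holder x y : 0 <= Re x -> 0 <= Re y ->
  cnorm (sqrtc x - sqrtc y) ^+ 2 <= cnorm (x - y).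
Proof.
move=> /sqrtc_sector hx /sqrtc_sector hy; have h := sector_dot hx hy.
rewrite -{2}(sqr_sqrtc x) -{2}(sqr_sqrtc y) subr_sqr cnormM expr2.
rewrite ler_wpM2l ?cnorm_ge0 // -(@ler_pXn2r _ 2) ?nnegrE ?cnorm_ge0 //.
by rewrite !cnorm_sqrD dotNr cnormN; lra.
Qed.

Lemma sqrtcJ x : 0 <= Re x -> sqrtc x^* = (sqrtc x)^*.
Proof.
move=> hx; apply: sector_inj; first by apply: sqrtc_sector; rewrite ReJ.
  by have := sqrtc_sector hx; rewrite /sector ReJ ImJ normrN.
by rewrite -rmorphXn /= !sqr_sqrtc.
Qed.

End Sqrt.

Section Continuity.
Set Implicit Arguments. Unset Strict Implicit. Unset Printing Implicit Defensive.
Variable R : realType.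
Notation C := R[i].
Implicit Types (a b : R -> C) (s t e d : R).

Definition cont01 a := forall t, 0 <= t <= 1 -> forall e : R, 0 < e ->
  exists2 d : R, 0 < d & forall s, 0 <= s <= 1 -> `|s - t| < d -> cnorm (a s - a t) < e.

Lemma cont01_ext a b : (forall t, 0 <= t <= 1 -> a t = b t) -> cont01 a -> cont01 b.
Proof.
move=> ab ca t ht e e0; have [d d0 hd] := ca t ht e e0.
by exists d => // s hs; rewrite -!ab //; apply: hd.
Qed.

Lemma cont01_lip a (L : R) : (forall s t, 0 <= s <= 1 -> 0 <= t <= 1 ->
  cnorm (a s - a t) <= L * `|s - t|) -> cont01 a.
Proof.
move=> h t ht e e0; have L1 : 0 < `|L| + 1 by rewrite ltr_wpDl.
exists (e / (`|L| + 1)); first by rewrite divr_gt0.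
move=> s hs; rewrite ltr_pdivlMr // => hst; apply: le_lt_trans (h s t hs ht) _.
by have := normr_ge0 (s - t); have := ler_norm L; nra.
Qed.

Lemma cont01_cst (k : C) : cont01 (fun=> k).
Proof. by apply: (@cont01_lip _ 0) => s t _ _; rewrite subrr cnorm0 mul0r. Qed.

Lemma cont01M a b : cont01 a -> cont01 b -> cont01 (fun t => a t * b t).
Proof.
move=> ca cb t ht e e0.
set M := cnorm (a t) + cnorm (b t) + 1.
have M0 : 0 < M by rewrite ltr_wpDl // addr_ge0 ?cnorm_ge0.
pose e' := Num.min 1 (e / (2 * M)).
have e'0 : 0 < e' by rewrite lt_min ltr01 divr_gt0 // mulr_gt0.
have [d d0 hd] := ca t ht e' e'0; have [d' d'0 hd'] := cb t ht e' e'0.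
exists (Num.min d d'); first by rewrite lt_min d0.
move=> s hs; rewrite lt_min => /andP[h1 h2].
have := hd s hs h1; have := hd' s hs h2.
rewrite !lt_min !ltr_pdivlMr ?mulr_gt0 // => /andP[b1 b2] /andP[a1 a2].
have -> : a s * b s - a t * b t = (a s - a t) * (b s - b t) + (a s - a t) * b t +
   a t * (b s - b t) by ring.
apply: le_lt_trans (cnormD _ _) _.
have := cnormD ((a s - a t) * (b s - b t)) ((a s - a t) * b t); rewrite !cnormM => h3.
have := cnorm_ge0 (a s - a t); have := cnorm_ge0 (b s - b t).
have := cnorm_ge0 (a t); have := cnorm_ge0 (b t).
rewrite /M in a2 b2; nra.
Qed.

Lemma cont01V a : (forall t, 0 <= t <= 1 -> a t != 0) -> cont01 a ->
  cont01 (fun t => (a t)^-1).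
Proof.
move=> a0 ca t ht e e0; have n0 : 0 < cnorm (a t) by rewrite cnorm_gt0 a0.
have p0 : 0 < cnorm (a t) ^+ 2 / 2 by rewrite divr_gt0 ?exprn_gt0.
pose e' := Num.min (cnorm (a t) / 2) (e * (cnorm (a t) ^+ 2 / 2)).
have e'0 : 0 < e' by rewrite lt_min divr_gt0 //= mulr_gt0.
have [d d0 hd] := ca t ht e' e'0.
exists d => // s hs hst; have := hd s hs hst; rewrite lt_min => /andP[h1 h2].
have n1 : 0 < cnorm (a s) by rewrite cnorm_gt0 a0.
have -> : (a s)^-1 - (a t)^-1 = - (a s - a t) / (a s * a t).
  by field; rewrite !a0.
rewrite cnormM cnormV cnormN cnormM ltr_pdivrMr ?mulr_gt0 //.
have := cnormB (a s) (a s - a t); rewrite opprB addrC subrK => h3.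
apply: lt_le_trans h2 _; rewrite ler_pM2l // expr2; nra.
Qed.

Lemma cont01_sqrtc a : (forall t, 0 <= t <= 1 -> 0 <= Re (a t)) -> cont01 a ->
  cont01 (fun t => sqrtc (a t)).
Proof.
move=> a0 ca t ht e e0; have e2 : 0 < e ^+ 2 by rewrite exprn_gt0.
have [d d0 hd] := ca t ht _ e2; exists d => // s hs hst.
rewrite -(@ltr_pXn2r _ 2) ?nnegrE ?cnorm_ge0 ?(ltW e0) //.
by apply: le_lt_trans (sqrtc_holder (a0 s hs) (a0 t ht)) _; apply: hd.
Qed.

Lemma cont01_prod n (F : nat -> R -> C) : (forall k, cont01 (F k)) ->
  cont01 (fun t => \prod_(k < n) F k t).
Proof.
move=> h; elim: n => [|n IH].
  by apply: (@cont01_ext (fun=> 1)) (cont01_cst _) => t _; rewrite big_ord0.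
by apply: cont01_ext (cont01M IH (h n)) => t _; rewrite big_ord_recr.
Qed.

(** The possible values are at distance 2, so [a] is locally constant; a uniform step length then
    leads from [0] to [1] in finitely many steps. *)
Lemma cont01_sign a : cont01 a -> (forall t, 0 <= t <= 1 -> a t ^+ 2 = 1) -> a 0 = a 1.
Proof.
move=> ca a2.
have near1 (x y : C) : x ^+ 2 = 1 -> y ^+ 2 = 1 -> cnorm (x - y) < 1 -> x = y.
  move=> /eqP; rewrite sqrf_eq1 => hx /eqP; rewrite sqrf_eq1 => hy.
  have [//|h] := eqVneq x y.
  suff -> : cnorm (x - y) = 2 by rewrite ltNge ler1n.
  have n2 : cnorm (2 : C) = 2 by rewrite -(rmorph_nat (real_complex R)) cnormC normr_nat.
  case/orP: hx h => /eqP ->; case/orP: hy => /eqP ->; rewrite ?eqxx // => _.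
    by rewrite opprK -[1 + 1]/(2 : C).
  by rewrite -opprD cnormN -[1 + 1]/(2 : C).
have loc t : 0 <= t <= 1 -> exists2 d : R, 0 < d & forall s, 0 <= s <= 1 ->
    `|s - t| < d -> a s = a t.
  move=> ht; have [d d0 hd] := ca t ht 1 ltr01.
  by exists d => // s hs hst; apply: near1; rewrite ?a2 //; apply: hd.
have [d d0 hd] : exists2 d : R, 0 < d & forall e s : R, `|e| < d -> 0 <= s <= 1 ->
    forall s', 0 <= s' <= 1 -> `|s' - s| <= `|e| -> a s' = a s.
  pose P e s := 0 <= s <= 1 -> forall s', 0 <= s' <= 1 -> `|s' - s| <= `|e| -> a s' = a s.
  have [|d d0 hd] := @cover_segment R P 0 1.
    move=> t ht; have [d d0 hd] := loc t ht; exists (d / 2); first by rewrite divr_gt0.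
    move=> e s he hst hs s' hs' h; rewrite (hd s) //; last by lra.
    apply: hd => //; have := ler_normD (s' - s) (s - t).
    by rewrite addrA subrK; lra.
  by exists d => // e s he hs; apply: hd.
pose c n := Num.min 1 (d / 2 *+ n).
have c01 n : 0 <= c n <= 1 by rewrite le_min ler01 ge_min lexx mulrn_wge0 // ltW // divr_gt0.
have step n : a (c n) = a 0.
  elim: n => [|n IH]; first by rewrite /c mulr0n; congr a; apply/min_idPr.
  rewrite -IH; apply: (hd (d / 2)) => //; first by rewrite ger0_norm; lra.
  have d2 : 0 <= d / 2 by lra.
  rewrite (ger0_norm d2) /c mulrS; move: (d / 2 *+ n) => x.
  have [h1|h1] := leP 1 x; have [h2|h2] := leP 1 (d / 2 + x); rewrite ler_norml; lra.
have [n hn] : exists n, 1 <= d / 2 *+ n.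
  exists (Num.bound (2 / d)); have := archi_boundP (_ : 0 <= 2 / d).
  rewrite divr_ge0 ?(ltW d0) // => /(_ isT) /ltW.
  by rewrite ler_pdivrMr // -[_ *+ _]mulr_natr => h; lra.
by rewrite -(step n) /c; move: hn => /min_idPl ->.
Qed.

End Continuity.

Section Monodromy.
Set Implicit Arguments. Unset Strict Implicit. Unset Printing Implicit Defensive.
Variable R : realType.
Notation C := R[i].
Implicit Types (s t e d : R).
Variables (F : R -> R -> C) (L : R).
Hypothesis F_lip : forall s t s' t', 0 <= s <= 1 -> 0 <= t <= 1 -> 0 <= s' <= 1 ->
  0 <= t' <= 1 -> cnorm (F s t - F s' t') <= L * (`|s - s'| + `|t - t'|).
Hypothesis F_neq0 : forall s t, 0 <= s <= 1 -> 0 <= t <= 1 -> F s t != 0.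

Lemma square_lower_bound : exists2 m : R, 0 < m &
  forall s t, 0 <= s <= 1 -> 0 <= t <= 1 -> m <= cnorm (F s t).
Proof.
pose P e s t := 0 <= s <= 1 -> 0 <= t <= 1 -> e <= cnorm (F s t).
have [|d d0 hd] := @cover_square R P 0 1; last first.
  by exists (d / 2); [rewrite divr_gt0 | move=> s t hs ht; apply: hd; rewrite ?ger0_norm //; lra].
move=> s t hs ht; have n0 : 0 < cnorm (F s t) by rewrite cnorm_gt0 F_neq0.
have L0 : 0 < `|L| + 1 by rewrite ltr_wpDl.
exists (Num.min (cnorm (F s t) / 2) (cnorm (F s t) / 4 / (`|L| + 1))).
  by rewrite lt_min !divr_gt0.
move=> e s' t'; rewrite !lt_min !ltr_pdivlMr // => /andP[h1 _] /andP[_ h2] /andP[_ h3] hs' ht'.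
have := F_lip hs' ht' hs ht.
have := cnormB (F s' t') (F s' t' - F s t); rewrite opprB addrC subrK.
have := normr_ge0 (s' - s); have := normr_ge0 (t' - t).
have := ler_norm e; have := ler_norm L; nra.
Qed.

(** The square is contracted to its corner in [n] steps. For [n >= 2 |L| / m] each step changes [F]
    by at most its lower bound [m], so the quotient [rho] of successive values has nonnegative real
    part and a continuous principal root; [F / F 0 0] is the telescoping product of these
    quotients. *)
Lemma square_sqrt : exists2 S : R -> R -> C,
  forall s t, 0 <= s <= 1 -> 0 <= t <= 1 -> S s t ^+ 2 = F s t / F 0 0 &
  forall c, 0 <= c <= 1 -> cont01 (S c) /\ cont01 (S^~ c).
Proof.
have [m m0 hm] := square_lower_bound.
have L0 : 0 <= 2 * `|L| / m by rewrite divr_ge0 ?mulr_ge0 ?(ltW m0).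
pose n := (Num.bound (2 * `|L| / m)).+1.
have nL : 2 * `|L| <= n%:R * m.
  rewrite -ler_pdivrMr //; apply: le_trans (ltW (archi_boundP L0)) _.
  by rewrite ler_nat leqnSn.
have n0 : 0 < n%:R :> R by rewrite ltr0n.
pose r (k : nat) : R := k%:R / n%:R.
have rS k : r k.+1 = r k + n%:R^-1 by rewrite /r -natr1 mulrDl mul1r.
have r01 (k : nat) : (k <= n)%N -> 0 <= r k <= 1.
  by move=> kn; rewrite divr_ge0 //= ler_pdivrMr // mul1r ler_nat.
have scale (x c : R) : 0 <= x <= 1 -> 0 <= c <= 1 -> 0 <= c * x <= 1.
  by move=> /andP[x0 x1] /andP[c0 c1]; rewrite mulr_ge0 //= mulr_ile1.
pose rho (k : nat) s t := F (r k.+1 * s) (r k.+1 * t) / F (r k * s) (r k * t).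
have rho_re (k : nat) s t : (k < n)%N -> 0 <= s <= 1 -> 0 <= t <= 1 -> 0 <= Re (rho k s t).
  move=> kn hs ht; have hk := r01 k (ltnW kn); have hk' := r01 _ kn.
  have Fk := F_neq0 (scale _ _ hs hk) (scale _ _ ht hk).
  have h1 : cnorm (rho k s t - 1) <= 1.
    have -> : rho k s t - 1 = (F (r k.+1 * s) (r k.+1 * t) - F (r k * s) (r k * t)) /
        F (r k * s) (r k * t) by rewrite mulrBl mulfV.
    rewrite cnormM cnormV ler_pdivrMr ?cnorm_gt0 // mul1r.
    apply: le_trans (F_lip (scale _ _ hs hk') (scale _ _ ht hk') (scale _ _ hs hk)
      (scale _ _ ht hk)) _.
    apply: le_trans _ (hm _ _ (scale _ _ hs hk) (scale _ _ ht hk)).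
    have rd x : r k.+1 * x - r k * x = n%:R^-1 * x by rewrite rS; ring.
    rewrite !rd !normrM ger0_norm ?invr_ge0 ?ler0n // -mulrDr.
    have sn : `|s| <= 1 by rewrite ger0_norm; lra.
    have tn : `|t| <= 1 by rewrite ger0_norm; lra.
    rewrite mulrCA -ler_pdivlMl ?invr_gt0 // invrK.
    have := ler_norm L; have := normr_ge0 L; have := normr_ge0 s; have := normr_ge0 t; nra.
  have := Re_le (rho k s t - 1); rewrite !ReImE ler_norml.
  lra.
pose S s t := \prod_(k < n) sqrtc (rho k s t).
exists S.
  move=> s t hs ht; rewrite /S -prodrXl.
  under eq_bigr => k _ do rewrite sqr_sqrtc.
  have tel k : (k <= n)%N -> \prod_(j < k) rho j s t = F (r k * s) (r k * t) / F 0 0.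
    elim: k => [|k IH] kn.
      by rewrite big_ord0 /r !mul0r divff // F_neq0 ?lexx ?ler01.
    rewrite big_ord_recr /= IH 1?ltnW // /rho mulrC mulrA divfK //.
    by apply: F_neq0; apply: scale => //; apply: r01; apply: ltnW.
  by rewrite tel // /r divff ?lt0r_neq0 // !mul1r.
have lipr (k : nat) c : (k <= n)%N -> 0 <= c <= 1 ->
    cont01 (fun t => F (r k * c) (r k * t)) /\ cont01 (fun t => F (r k * t) (r k * c)).
  move=> kn hc; have hk := r01 k kn.
  have h s t : L * `|r k * s - r k * t| <= `|L| * `|s - t|.
    rewrite -mulrBr normrM (ger0_norm (proj1 (andP hk))) mulrA ler_wpM2r //.
    have := ler_norm L; have := normr_ge0 L; nra.
  have hkc := scale _ _ hc hk.
  split; apply: (@cont01_lip _ _ `|L|) => s t hs ht;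
    have hks := scale _ _ hs hk; have hkt := scale _ _ ht hk; apply: le_trans (h s t).
    by apply: le_trans (F_lip hkc hks hkc hkt) _; rewrite subrr normr0 add0r.
  by apply: le_trans (F_lip hks hkc hkt hkc) _; rewrite subrr normr0 addr0.
move=> c hc; split.
  pose G k := if (k < n)%N then fun t => sqrtc (rho k c t) else fun=> 1.
  apply: (@cont01_ext _ (fun t => \prod_(k < n) G k t)).
    by move=> t _; apply: eq_bigr => k _; rewrite /G ltn_ord.
  apply: (@cont01_prod R n G) => k; rewrite /G; case: ifP => kn; last exact: cont01_cst.
  apply: cont01_sqrtc => [t ht|]; first exact: rho_re.
  apply: cont01M; first exact: (lipr _ _ kn hc).1.
  apply: cont01V => [t ht|]; last exact: (lipr _ _ (ltnW kn) hc).1.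
  by apply: F_neq0; apply: scale => //; apply: r01; apply: ltnW.
pose G k := if (k < n)%N then fun t => sqrtc (rho k t c) else fun=> 1.
  apply: (@cont01_ext _ (fun t => \prod_(k < n) G k t)).
  by move=> t _; apply: eq_bigr => k _; rewrite /G ltn_ord.
apply: (@cont01_prod R n G) => k; rewrite /G; case: ifP => kn; last exact: cont01_cst.
apply: cont01_sqrtc => [t ht|]; first exact: rho_re.
apply: cont01M; first exact: (lipr _ _ kn hc).2.
apply: cont01V => [t ht|]; last exact: (lipr _ _ (ltnW kn) hc).2.
by apply: F_neq0; apply: scale => //; apply: r01; apply: ltnW.
Qed.

(** With [S] the square root just found, [S 1 t / (S 0 t * a t)] and [S s 1 / (S s 0 * b s)] have
    constant square, hence constant sign. Comparing the corners, both quotients equal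
    [S 1 1 * S 0 0 / (S 0 1 * S 1 0)]. *)
Lemma square_monodromy (a b : R -> C) : cont01 a -> cont01 b ->
  (forall t, 0 <= t <= 1 -> a t != 0) -> (forall t, 0 <= t <= 1 -> b t != 0) ->
  (forall t, 0 <= t <= 1 -> F 1 t = F 0 t * a t ^+ 2) ->
  (forall s, 0 <= s <= 1 -> F s 1 = F s 0 * b s ^+ 2) ->
  a 1 / a 0 = b 1 / b 0.
Proof.
move=> ca cb a0 b0 Fa Fb; have [S S2 cS] := square_sqrt.
have i0 : 0 <= (0 : R) <= 1 by rewrite lexx ler01.
have i1 : 0 <= (1 : R) <= 1 by rewrite lexx ler01.
have S0 s t : 0 <= s <= 1 -> 0 <= t <= 1 -> S s t != 0.
  by move=> hs ht; rewrite -sqrf_eq0 S2 //; apply: mulf_neq0; rewrite ?invr_eq0; apply: F_neq0.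
have h1 : S 1 0 / (S 0 0 * a 0) = S 1 1 / (S 0 1 * a 1).
  apply: (@cont01_sign R (fun t => S 1 t / (S 0 t * a t))).
    apply: cont01M; first exact: (cS 1 i1).1.
    apply: cont01V => [t ht|]; first by rewrite mulf_neq0 ?S0 ?a0.
    by apply: cont01M => //; exact: (cS 0 i0).1.
  move=> t ht; rewrite expr_div_n exprMn !S2 // Fa //.
  by field; rewrite a0 // !F_neq0.
have h2 : S 0 1 / (S 0 0 * b 0) = S 1 1 / (S 1 0 * b 1).
  apply: (@cont01_sign R (fun t => S t 1 / (S t 0 * b t))).
    apply: cont01M; first exact: (cS 1 i1).2.
    apply: cont01V => [t ht|]; first by rewrite mulf_neq0 ?S0 ?b0.
    by apply: cont01M => //; exact: (cS 0 i0).2.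
  move=> t ht; rewrite expr_div_n exprMn !S2 // Fb //.
  by field; rewrite b0 // !F_neq0.
have e1 : a 1 / a 0 = S 1 1 * S 0 0 / (S 0 1 * S 1 0).
  rewrite [X in _ = X](_ : _ = S 1 1 / (S 0 1 * a 1) * a 1 * (S 0 0 / S 1 0)).
    by rewrite -h1; field; rewrite !a0 // !S0.
  by field; rewrite a0 // !S0.
have e2 : b 1 / b 0 = S 1 1 * S 0 0 / (S 0 1 * S 1 0).
  rewrite [X in _ = X](_ : _ = S 1 1 / (S 1 0 * b 1) * b 1 * (S 0 0 / S 0 1)).
    by rewrite -h2; field; rewrite !b0 // !S0.
  by field; rewrite b0 // !S0.
by rewrite e1 e2.
Qed.

End Monodromy.

(** * Chords *)

Section Chord.
Set Implicit Arguments. Unset Strict Implicit. Unset Printing Implicit Defensive.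
Variable R : realType.
Notation C := R[i].
Implicit Types (z w P Q : C) (s t : R).

Definition chord z w s : C := z + s%:C * (w - z).

Lemma chord0 z w : chord z w 0 = z. Proof. by rewrite /chord mul0r addr0. Qed.
Lemma chord1 z w : chord z w 1 = w. Proof. by rewrite /chord mul1r addrC subrK. Qed.

Lemma chord_sqr z w s : cnorm z = 1 -> cnorm w = 1 ->
  cnorm (chord z w s) ^+ 2 = 1 - s * (1 - s) * cnorm (z - w) ^+ 2.
Proof.
move=> hz hw.
have ez : Re z ^+ 2 + Im z ^+ 2 = 1 by rewrite -cnorm_sqr hz expr1n.
have ew : Re w ^+ 2 + Im w ^+ 2 = 1 by rewrite -cnorm_sqr hw expr1n.
rewrite !cnorm_sqr /chord !ReImE.
set r := Re w in ew *; set i := Im w in ew *; set a := Re z in ez *; set b := Im z in ez *.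
transitivity ((1 - s) ^+ 2 * (a ^+ 2 + b ^+ 2) + s ^+ 2 * (r ^+ 2 + i ^+ 2)
  + 2 * s * (1 - s) * (a * r + b * i)); first by ring.
transitivity (1 - s * (1 - s) * ((a ^+ 2 + b ^+ 2) + (r ^+ 2 + i ^+ 2) - 2 * (a * r + b * i)));
  last by ring.
by rewrite ez ew; ring.
Qed.

Lemma chord_le z w s : cnorm z = 1 -> cnorm w = 1 -> 0 <= s <= 1 -> cnorm (chord z w s) <= 1.
Proof.
move=> hz hw /andP[s0 s1].
rewrite -(@ler_pXn2r _ 2) ?nnegrE ?cnorm_ge0 // expr1n chord_sqr // gerBl.
by rewrite mulr_ge0 ?sqr_ge0 // mulr_ge0 // subr_ge0.
Qed.

Lemma chord_lt z w s : cnorm z = 1 -> cnorm w = 1 -> z != w -> 0 < s < 1 ->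
  cnorm (chord z w s) < 1.
Proof.
move=> hz hw zw /andP[s0 s1].
rewrite -(@ltr_pXn2r _ 2) ?nnegrE ?cnorm_ge0 // expr1n chord_sqr // gtrBl.
rewrite mulr_gt0 ?exprn_gt0 ?cnorm_gt0 ?subr_eq0 //.
by rewrite mulr_gt0 // subr_gt0.
Qed.

Variant chord_spec z w s : C -> Prop :=
  | ChordL : chord_spec z w s z
  | ChordR : chord_spec z w s w
  | ChordI x of cnorm x < 1 : chord_spec z w s x.

Lemma chordP z w s : cnorm z = 1 -> cnorm w = 1 -> z != w -> 0 <= s <= 1 ->
  chord_spec z w s (chord z w s).
Proof.
move=> hz hw zw /andP[]; rewrite le_eqVlt => /orP[/eqP <- _|s0].
  by rewrite chord0; constructor.
rewrite le_eqVlt => /orP[/eqP ->|s1]; first by rewrite chord1; constructor.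
by constructor; apply: chord_lt => //; rewrite s0.
Qed.

Lemma chord_lip z w s t : cnorm (chord z w s - chord z w t) = `|s - t| * cnorm (w - z).
Proof.
have -> : chord z w s - chord z w t = (s - t)%:C * (w - z).
  by rewrite /chord rmorphB /=; ring.
by rewrite cnormM cnormC.
Qed.

(** For [w] in the closed disk the second factor has nonnegative real part, so its principal root
    yields a continuous square root of [z - w] up to a constant. *)
Lemma unit_sub z w : cnorm z = 1 -> z - w = z * (1 - w * z^*).
Proof. by move=> hz; rewrite mulrBr mulr1 mulrCA mulJ hz expr1n mulr1. Qed.

Lemma Re_unit_sub z w : cnorm z = 1 -> cnorm w <= 1 -> 0 <= Re (1 - w * z^*).
Proof.
move=> hz hw; have := Re_le (w * z^*); rewrite cnormM cnormJ hz mulr1 ler_norml.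
by rewrite ReD ReN Re1; lra.
Qed.

Lemma unit_sub_neq0 z w : cnorm z = 1 -> w != z -> 1 - w * z^* != 0.
Proof.
move=> hz; apply: contraNneq => h; rewrite -subr_eq0 -oppr_eq0 opprB unit_sub //.
by rewrite h mulr0.
Qed.

Variable f : {poly C}.
Hypothesis f_uni : univalent_disk f.

(** A positive cross ratio means that [P] and [Q] lie on the same side of the chord from [z1] to
    [z2]. For the difference quotient [F s t] at points of the two chords, the equality of the
    values at [z1] and [z2] gives the ratio of [F] on the sides [s = 0, 1], and [B] gives that on
    the sides [t = 0, 1]. Monodromy then equates a square root of the cross ratio with its own
    conjugate. *)
Lemma chord_side z1 z2 P Q (B : R -> C) :
  cnorm z1 = 1 -> cnorm z2 = 1 -> cnorm P = 1 -> cnorm Q = 1 ->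
  z1 != z2 -> P != Q -> f.[z1] = f.[z2] -> f.[P] != f.[z1] -> f.[Q] != f.[z1] ->
  cont01 B -> (forall s, 0 <= s <= 1 -> B s != 0) -> B 0 = B 1 ->
  (forall s, 0 <= s <= 1 ->
     f.[chord z1 z2 s] - f.[Q] = (f.[chord z1 z2 s] - f.[P]) * B s ^+ 2) ->
  exists2 r : R, 0 < r & (z1 - Q) * (z2 - P) = r%:C * ((z2 - Q) * (z1 - P)).
Proof.
move=> n1 n2 nP nQ z12 PQ fz fP fQ cB B0 B01 hB.
have i0 : 0 <= (0 : R) <= 1 by rewrite lexx ler01.
have i1 : 0 <= (1 : R) <= 1 by rewrite lexx ler01.
have P1 : P != z1 by apply: contraNneq fP => ->.
have Q1 : Q != z1 by apply: contraNneq fQ => ->.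
have P2 : P != z2 by apply: contraNneq fP => ->; rewrite fz.
have Q2 : Q != z2 by apply: contraNneq fQ => ->; rewrite fz.
pose F s t := dq f (chord z1 z2 s) (chord P Q t).
have [L L0 hL] := dq_lip f 1.
have ne z t : cnorm z = 1 -> P != z -> Q != z -> 0 <= t <= 1 -> chord P Q t != z.
  move=> nz Pz Qz ht; case: (chordP nP nQ PQ ht) => // x hx.
  by apply: contraTneq hx => ->; rewrite nz ltxx.
have ne' z s : cnorm z = 1 -> z1 != z -> z2 != z -> 0 <= s <= 1 -> chord z1 z2 s != z.
  move=> nz Pz Qz hs; case: (chordP n1 n2 z12 hs) => // x hx.
  by apply: contraTneq hx => ->; rewrite nz ltxx.
have F_lip s t s' t' : 0 <= s <= 1 -> 0 <= t <= 1 -> 0 <= s' <= 1 -> 0 <= t' <= 1 ->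
    cnorm (F s t - F s' t') <= L * (cnorm (z2 - z1) + cnorm (Q - P)) * (`|s - s'| + `|t - t'|).
  move=> hs ht hs' ht'; apply: le_trans (hL _ _ _ _ _ _ _ _) _; try exact: chord_le.
  rewrite !chord_lip -mulrA ler_wpM2l //.
  have := normr_ge0 (s - s'); have := normr_ge0 (t - t').
  have := cnorm_ge0 (z2 - z1); have := cnorm_ge0 (Q - P); nra.
(* The chords have no common end, so they meet only inside the disk, where [f'] does not vanish; at
   distinct points the values of [f] differ. *)
have F_neq0 s t : 0 <= s <= 1 -> 0 <= t <= 1 -> F s t != 0.
  move=> hs ht; have [e|ne0] := eqVneq (chord z1 z2 s) (chord P Q t).
    rewrite /F e dq_diag; apply: (deriv_in f_uni).
    case: (chordP nP nQ PQ ht) e => [h|h|x hx _]; last exact: hx.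
      by have := ne' P s nP; rewrite h eqxx ![_ == P]eq_sym P1 P2 => /(_ isT isT hs).
    by have := ne' Q s nQ; rewrite h eqxx ![_ == Q]eq_sym Q1 Q2 => /(_ isT isT hs).
  suff : f.[chord z1 z2 s] - f.[chord P Q t] != 0.
    by rewrite dqP mulf_eq0 negb_or => /andP[].
  rewrite subr_eq0; move: ne0.
  case: (chordP n1 n2 z12 hs) => [||x hx]; case: (chordP nP nQ PQ ht) => [||y hy] xy.
  - by rewrite eq_sym.
  - by rewrite eq_sym.
  - by rewrite eq_sym; apply/eqP; apply: (interior_neq_boundary f_uni).
  - by rewrite eq_sym -fz.
  - by rewrite eq_sym -fz.
  - by rewrite eq_sym; apply/eqP; apply: (interior_neq_boundary f_uni).
  - by apply/eqP; apply: (interior_neq_boundary f_uni).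
  - by apply/eqP; apply: (interior_neq_boundary f_uni).
  by apply: contraNneq xy => /(univ f_uni hx hy) ->.
pose q z w := sqrtc (1 - w * z^*).
have q2 z w : q z w ^+ 2 = 1 - w * z^* by rewrite sqr_sqrtc.
have q0 z w : cnorm z = 1 -> w != z -> q z w != 0.
  by move=> nz wz; rewrite -sqrf_eq0 q2 unit_sub_neq0.
have cq z x y : cnorm z = 1 -> cnorm x = 1 -> cnorm y = 1 ->
    cont01 (fun t => q z (chord x y t)).
  move=> nz nx ny; apply: cont01_sqrtc => [t ht|].
    by apply: Re_unit_sub => //; apply: chord_le.
  apply: (@cont01_lip _ _ (cnorm (y - x))) => s t hs ht.
  have -> : 1 - chord x y s * z^* - (1 - chord x y t * z^*) =
      - ((chord x y s - chord x y t) * z^*) by ring.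
  by rewrite cnormN cnormM cnormJ nz mulr1 chord_lip mulrC.
(* Explicit continuous square roots of [F 1 t / F 0 t = (z1 - y) / (z2 - y)] at [y = chord P Q t],
   and of [F s 1 / F s 0 = B s ^ 2 (P - x) / (Q - x)] at [x = chord z1 z2 s]. *)
pose a t := sqrtc (z1 / z2) * (q z1 (chord P Q t) / q z2 (chord P Q t)).
pose b s := sqrtc (P / Q) * (q P (chord z1 z2 s) / q Q (chord z1 z2 s)) * B s.
have u0 (z : C) : cnorm z = 1 -> z != 0 by rewrite -cnorm_gt0 => ->.
have sq0 (z w : C) : cnorm z = 1 -> cnorm w = 1 -> sqrtc (z / w) != 0.
  by move=> nz nw; rewrite sqrtc_eq0 mulf_neq0 ?invr_neq0 ?u0.
have nq1 t : 0 <= t <= 1 -> q z1 (chord P Q t) != 0 by move=> ht; apply: q0 => //; apply: ne.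
have nq2 t : 0 <= t <= 1 -> q z2 (chord P Q t) != 0 by move=> ht; apply: q0 => //; apply: ne.
have nqP s : 0 <= s <= 1 -> q P (chord z1 z2 s) != 0.
  by move=> hs; apply: q0 => //; apply: ne' => //; rewrite eq_sym.
have nqQ s : 0 <= s <= 1 -> q Q (chord z1 z2 s) != 0.
  by move=> hs; apply: q0 => //; apply: ne' => //; rewrite eq_sym.
have ca : cont01 a.
  apply: cont01M; first exact: cont01_cst.
  by apply: cont01M; [apply: cq | apply: cont01V => //; apply: cq].
have cb : cont01 b.
  apply: cont01M => //; apply: cont01M; first exact: cont01_cst.
  by apply: cont01M; [apply: cq | apply: cont01V => //; apply: cq].
have na t : 0 <= t <= 1 -> a t != 0.
  by move=> ht; rewrite !mulf_neq0 ?invr_neq0 ?sq0 ?nq1 ?nq2.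
have nb s : 0 <= s <= 1 -> b s != 0.
  by move=> hs; rewrite !mulf_neq0 ?invr_neq0 ?sq0 ?nqP ?nqQ ?B0.
have Fa t : 0 <= t <= 1 -> F 1 t = F 0 t * a t ^+ 2.
  move=> ht; rewrite /F chord1 chord0 /a exprMn expr_div_n sqr_sqrtc !q2.
  set z := chord P Q t; have h1 := dqP f z1 z; have h2 := dqP f z2 z.
  have k1 : 1 - z * z1^* != 0 by rewrite -q2 expf_neq0 ?nq1.
  have k2 : 1 - z * z2^* != 0 by rewrite -q2 expf_neq0 ?nq2.
  have k3 : z2 - z != 0 by rewrite unit_sub // mulf_neq0 // u0.
  apply: (mulfI k3); rewrite -h2 -fz h1 (unit_sub _ n1) (unit_sub _ n2).
  by field; rewrite k2 u0.
have Fb s : 0 <= s <= 1 -> F s 1 = F s 0 * b s ^+ 2.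
  move=> hs; rewrite /F chord1 chord0 /b !exprMn exprVn sqr_sqrtc !q2.
  have := hB s hs; set z := chord z1 z2 s => hz.
  have k1 : 1 - z * P^* != 0 by rewrite -q2 expf_neq0 ?nqP.
  have k2 : 1 - z * Q^* != 0 by rewrite -q2 expf_neq0 ?nqQ.
  have k3 : Q - z != 0 by rewrite unit_sub // mulf_neq0 // u0.
  apply: (mulfI k3); rewrite -[Q - z]opprB mulNr -dqP hz dqP.
  rewrite -[z - P]opprB (unit_sub _ nP) -[z - Q]opprB (unit_sub _ nQ).
  by field; rewrite k2 u0.
have := square_monodromy F_lip F_neq0 ca cb na nb Fa Fb.
rewrite /a /b !chord0 !chord1 -B01.
(* Exchanging two points of the circle conjugates [q], so [b 1 / b 0] is the conjugate of
   [a 1 / a 0]; the factor [B] cancels because [B 0 = B 1]. *)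
have qJ z w : cnorm z = 1 -> cnorm w = 1 -> q z w = (q w z)^*.
  move=> nz nw; rewrite /q -sqrtcJ; last by apply: Re_unit_sub; rewrite // nz.
  by rewrite rmorphB rmorph1 rmorphM /= conjcK mulrC.
rewrite (qJ P z2) // (qJ Q z2) // (qJ P z1) // (qJ Q z1) //.
have := q2 z1 Q; have := q2 z2 P; have := q2 z2 Q; have := q2 z1 P.
have : q z1 P != 0 by apply: q0.
have : q z1 Q != 0 by apply: q0.
have : q z2 P != 0 by apply: q0.
have : q z2 Q != 0 by apply: q0.
move: (q z1 P) (q z1 Q) (q z2 P) (q z2 Q) (sqrtc (z1 / z2)) (sqrtc (P / Q)) (sq0 _ _ n1 n2)
  (sq0 _ _ nP nQ) (B0 0 i0) => x y u v k k' k0 k'0 b0 v0 u_0 y0 x0 ex ev eu ey e.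
have xr : (y * u / (v * x))^* = y * u / (v * x).
  have J0 (c : C) : c != 0 -> c^* != 0 by rewrite fmorph_eq0.
  transitivity (k * (y / v) / (k * (x / u))); last by field; rewrite k0 x0 v0 u_0.
  by rewrite e !(rmorphM, fmorphV) /=; field; rewrite k'0 b0 !J0.
have X0 : y * u / (v * x) != 0 by rewrite !mulf_neq0 // invr_eq0 mulf_neq0.
have XR : y * u / (v * x) = (Re (y * u / (v * x)))%:C.
  by move: xr; case: (_ / _) => c d /= [] h; congr (_ +i* _); lra.
exists (Re (y * u / (v * x)) ^+ 2).
  rewrite exprn_even_gt0 //=; apply: contraNneq X0 => h; rewrite XR h //.
rewrite rmorphXn /= -XR (unit_sub Q n1) (unit_sub P n2) (unit_sub Q n2) (unit_sub P n1) -ey -eu -ev -ex.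
by field; rewrite x0 v0.
Qed.

End Chord.

(** * Laminar families of intervals *)

Section Laminar.
Set Implicit Arguments. Unset Strict Implicit. Unset Printing Implicit Defensive.
Variable R : realType.
Implicit Types (p q : R * R) (l : seq (R * R)).

Definition laminar2 p q :=
  [|| p.2 < q.1, q.2 < p.1, (p.1 < q.1) && (q.2 < p.2) | (q.1 < p.1) && (p.2 < q.2)].

Lemma seq_argmin (T : eqType) (F : T -> R) (r : seq T) : r != [::] ->
  exists2 x, x \in r & forall y, y \in r -> F x <= F y.
Proof.
elim: r => // a r IH _; have [->|r0] := eqVneq r [::].
  by exists a; [rewrite mem_head | move=> y; rewrite inE => /eqP ->].
have [x xr hx] := IH r0; have [h|h] := leP (F a) (F x).
  exists a; first by rewrite mem_head.
  by move=> y; rewrite inE => /orP[/eqP ->//|/hx]; apply: le_trans.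
exists x; first by rewrite inE xr orbT.
by move=> y; rewrite inE => /orP[/eqP ->|/hx//]; apply: ltW.
Qed.

(* Induction by cutting out a shortest interval and closing the gap: it contains
   no other endpoint, and all other lengths stay positive integers. *)
Lemma laminar_points l : uniq l ->
  (forall p, p \in l -> exists2 m : nat, (0 < m)%N & p.2 = p.1 + m%:R) ->
  (forall p (k : int), p \in l -> p.1 != k%:~R) ->
  (forall p q, p \in l -> q \in l -> p != q -> laminar2 p q) ->
  exists s : seq int, [/\ uniq s, size s = size l &
    forall k, k \in s -> exists2 p, p \in l & p.1 < k%:~R < p.2].
Proof.
move: {2}(size l) (erefl (size l)) => n; elim: n l => [|n IH] l szl ul len nint lam.
  by exists [::]; rewrite szl.
have [|p pl hp] := @seq_argmin _ (fun p => p.2 - p.1) l; first by rewrite -size_eq0 szl.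
have [m m0 pm] := len p pl; have mR : 0 < m%:R :> R by rewrite ltr0n.
have other q : q \in rem p l -> q \in l /\ q != p.
  by rewrite mem_rem_uniq // inE => /andP[].
have lenq q : q \in l -> q.1 < q.2.
  by move=> /len [k k0 ->]; rewrite ltrDl ltr0n.
have pos q : q \in rem p l ->
    [\/ q.2 < p.1, p.2 < q.1 | q.1 < p.1 /\ p.2 < q.2].
  move=> /other [ql qp]; have := lam q p ql pl qp.
  case/or4P => [h|h|/andP[h1 h2]|/andP[h1 h2]]; first by constructor 1.
  - by constructor 2.
  - by constructor 3.
  by have := hp q ql; lra.
pose c x := if x < p.1 then x else x - m%:R.
have cl x : x < p.1 -> c x = x by rewrite /c => ->.
have cr x : p.2 < x -> c x = x - m%:R.
  by rewrite /c => h; case: ltP => // ?; lra.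
have out q : q \in rem p l -> (q.1 < p.1 \/ p.2 < q.1) /\ (q.2 < p.1 \/ p.2 < q.2).
  move=> hq; have := lenq q (other q hq).1.
  by case: (pos q hq) => [h|h|[h1 h2]] h0; split; (try by left; lra); (try by right; lra).
have cmono x y : (x < p.1 \/ p.2 < x) -> (y < p.1 \/ p.2 < y) -> x < y -> c x < c y.
  by move=> [hx|hx] [hy|hy] xy; rewrite ?(cl _ hx) ?(cr _ hx) ?(cl _ hy) ?(cr _ hy); lra.
pose l' := [seq (c q.1, c q.2) | q <- rem p l].
have lam' q r : q \in rem p l -> r \in rem p l -> q != r ->
    laminar2 (c q.1, c q.2) (c r.1, c r.2).
  move=> hq hr qr; have [hq1 hq2] := out q hq; have [hr1 hr2] := out r hr.
  rewrite /laminar2 /=; have := lam q r (other q hq).1 (other r hr).1 qr.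
  case/or4P => [h|h|/andP[h1 h2]|/andP[h1 h2]]; apply/or4P.
  - by constructor 1; apply: cmono.
  - by constructor 2; apply: cmono.
  - by constructor 3; apply/andP; split; apply: cmono.
  - by constructor 4; apply/andP; split; apply: cmono.
have c_lt q : q \in rem p l -> c q.1 < c q.2.
  by move=> hq; have [h1 h2] := out q hq; apply: cmono => //; apply: lenq; apply: (other q hq).1.
have [| | | | |s' [us' szs' hs']] := IH l'.
- by rewrite size_map size_rem // szl.
- rewrite map_inj_in_uniq ?rem_uniq // => q r hq hr e.
  apply/eqP; apply: contraT => /(lam' q r hq hr); rewrite e /laminar2 /=.
  by have h := c_lt r hr; case/or4P => [h1|h1|/andP[h1 _]|/andP[h1 _]];
    rewrite ?ltxx in h1 => //; by have := lt_trans h h1; rewrite ltxx.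
- move=> _ /mapP[q hq ->] /=; have [ql _] := other q hq.
  have [k k0 qk] := len q ql; case: (pos q hq) => [h|h|[h1 h2]].
  + by exists k => //; rewrite !cl //; have := lenq q ql; lra.
  + by exists k => //; rewrite !cr //; have := lenq q ql; lra.
  have mk : (m < k)%N by rewrite -(ltr_nat R); lra.
  exists (k - m)%N; first by rewrite subn_gt0.
  by rewrite (cl _ h1) (cr _ h2) natrB ?(ltnW mk) //; lra.
- move=> _ k /mapP[q hq ->] /=; have [ql _] := other q hq.
  case: (out q hq).1 => h; first by rewrite cl // nint.
  rewrite cr // subr_eq -[m%:R]/((m : int)%:~R) -intrD; exact: nint.
- move=> _ _ /mapP[q hq ->] /mapP[r hr ->] ne; apply: lam' => //.
  by apply: contraNneq ne => ->.
(* [g] reopens the gap on integers. Its values stay outside [p], so the integer [k0] chosen inside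
   [p] is new. *)
pose g (k : int) := if k%:~R < p.1 then k else k + m.
have gE (k : int) : (k%:~R < p.1 /\ (g k)%:~R = k%:~R :> R) \/
    (p.1 < k%:~R /\ (g k)%:~R = k%:~R + m%:R :> R).
  rewrite /g; case: ltP => h; first by left.
  by right; split; [rewrite lt_neqAle h nint | rewrite intrD].
pose k0 : int := Num.floor p.1 + 1.
have k01 : p.1 < k0%:~R by rewrite /k0; apply: floorD1_gt.
have k02 : k0%:~R < p.2.
  have m1 : 1 <= m%:R :> R by rewrite ler1n.
  have := nint p (Num.floor p.1) pl; have := Num.Theory.floor_le p.1.
  rewrite /k0 intrD le_eqVlt eq_sym => /orP[->//|h] _; rewrite pm; lra.
exists (k0 :: map g s'); split.
- rewrite /= map_inj_in_uniq ?us' ?andbT.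
    apply/negP => /mapP[k _ e]; have := congr1 (fun x : int => x%:~R : R) e.
    case: (gE k) => -[h ->] e'; have : (0 : R) < 0 by lra.
      by rewrite ltxx.
    by rewrite ltxx.
  move=> j k _ _ e; have := congr1 (fun x : int => x%:~R : R) e.
  case: (gE j) => -[h1 ->]; case: (gE k) => -[h2 ->].
  + by move/intr_inj.
  + move=> e'; have : (0 : R) < 0 by lra.
    by rewrite ltxx.
  + move=> e'; have : (0 : R) < 0 by lra.
    by rewrite ltxx.
  by move/addIr/intr_inj.
- by rewrite /= size_map szs' size_map size_rem // szl.
move=> k; rewrite inE => /orP[/eqP ->|/mapP[j js ->]].
  by exists p; rewrite ?k01.
have [_ /mapP[q hq ->] /= /andP[h1 h2]] := hs' j js.
exists q; first exact: (other q hq).1.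
have [ql _] := other q hq; have := lenq q ql.
case: (pos q hq) h1 h2 => [h|h|[h3 h4]] h1 h2 h0.
- move: h1 h2; rewrite !cl; try lra; move=> h1 h2.
  by case: (gE j) => -[h3 ->]; apply/andP; split; lra.
- move: h1 h2; rewrite !cr; try lra; move=> h1 h2.
  by case: (gE j) => -[h3 ->]; apply/andP; split; lra.
move: h1 h2; rewrite (cl _ h3) (cr _ h4) => h1 h2.
by case: (gE j) => -[h5 ->]; apply/andP; split; lra.
Qed.

Lemma size_int_window (x : R) (n : nat) (s : seq int) : uniq s ->
  (forall k, k \in s -> 0 <= x + k%:~R < n%:R) -> (size s <= n)%N.
Proof.
move=> us h; have [f1 f2] := (Num.Theory.floor_le x, floorD1_gt x); rewrite intrD in f2.
have fk k : k \in s -> (0 <= k + Num.floor x) /\ (k + Num.floor x < n%:Z).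
  move=> /h /andP[h1 h2]; split.
    by rewrite -ltzD1 -(ltr_int R) !intrD; lra.
  by rewrite -(ltr_int R) intrD -[n%:~R]/(n%:R : R); lra.
rewrite -(size_iota 0 n) -(size_map (fun k : int => absz (k + Num.floor x)) s).
apply: uniq_leq_size.
  rewrite map_inj_in_uniq // => j k /fk[j0 _] /fk[k0 _] /(congr1 Posz).
  by rewrite !gez0_abs // => /addIr.
by move=> _ /mapP[k /fk[k0 k1] ->]; rewrite mem_iota /= add0n -ltz_nat gez0_abs.
Qed.

Lemma shift_not_int (T : eqType) (F : T -> R) (r : seq T) : exists2 d : R, 0 < d &
  forall e, 0 < e < d -> forall y (k : int), y \in r -> F y + e != k%:~R.
Proof.
elim: r => [|a r [d d0 hd]]; first by exists 1.
have [f1 f2] := (Num.Theory.floor_le (F a), floorD1_gt (F a)).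
exists (Num.min d ((Num.floor (F a) + 1)%:~R - F a)); first by rewrite lt_min d0 subr_gt0.
move=> e; rewrite lt_min => /andP[e0 /andP[e1 e2]] y k.
rewrite inE => /orP[/eqP ->|yr]; last by apply: hd; rewrite ?e0.
apply/eqP => h.
have : ((Num.floor (F a))%:~R : R) < k%:~R by lra.
have : (k%:~R : R) < (Num.floor (F a) + 1)%:~R by lra.
rewrite !ltr_int; lia.
Qed.

End Laminar.

(** * The derivative of a polynomial in S*_d *)

Section Structure.
Set Implicit Arguments. Unset Strict Implicit. Unset Printing Implicit Defensive.
Variable R : realType.
Notation C := R[i].
Implicit Types (p f : {poly C}) (z w r : C).

(** For a polynomial of degree at most [n] this says that the coefficients at [k] and [n - k] are
    conjugate. At [|z| = 1] it reads [p(z) = z ^ n conj (p(z))], which fixes a real line through [0]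
    that carries [p(z)]. *)
Definition self_inversive (n : nat) p :=
  forall z, z != 0 -> p.[z] = z ^+ n * (p.[(z^*)^-1])^*.

Lemma self_inversive_sqr n p z : self_inversive n p -> cnorm z = 1 ->
  p.[z] ^+ 2 = z ^+ n * (cnorm p.[z] ^+ 2)%:C.
Proof.
move=> sp z1; have z0 : z != 0 by rewrite -cnorm_gt0 z1.
have zz : (z^*)^-1 = z by rewrite unit_inv ?cnormJ // conjcK.
by rewrite expr2 {1}(sp z z0) -mulJ zz -mulrA [_^* * _]mulrC.
Qed.

Lemma self_inversive_root n p z : self_inversive n p -> z != 0 ->
  p.[z] = 0 -> p.[(z^*)^-1] = 0.
Proof.
move=> sp z0 pz; have := sp z z0; rewrite pz => /esym/eqP.
by rewrite mulf_eq0 expf_eq0 (negbTE z0) andbF /= fmorph_eq0 => /eqP.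
Qed.

Lemma self_inversiveD n p (q : {poly C}) :
  self_inversive n p -> self_inversive n q -> self_inversive n (p + q).
Proof.
by move=> sp sq z z0; rewrite !hornerD rmorphD /= mulrDr -sp // -sq.
Qed.

Lemma conjcZ (t : R) z : (t%:C * z)^* = t%:C * z^*.
Proof. by apply: complex_ext; rewrite !ReImE; ring. Qed.

Lemma self_inversiveZ n p (t : R) : self_inversive n p -> self_inversive n (t%:C *: p).
Proof.
by move=> sp z z0; rewrite !hornerZ conjcZ mulrCA -sp.
Qed.

Lemma prod_ge1_eq1 (s : seq C) : (forall r, r \in s -> 1 <= cnorm r) ->
  \prod_(r <- s) cnorm r = 1 -> forall r, r \in s -> cnorm r = 1.
Proof.
elim: s => // a s IH h; rewrite big_cons => e.
have ha := h a (mem_head _ _).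
have hs r : r \in s -> 1 <= cnorm r by move=> rs; apply: h; rewrite inE rs orbT.
have ps : 1 <= \prod_(r <- s) cnorm r.
  elim: s hs {IH h e} => [|b s IH] hs; first by rewrite big_nil.
  rewrite big_cons; have h1 := hs b (mem_head _ _).
  have := IH (fun r rs => hs r ltac:(by rewrite inE rs orbT)); nra.
have a1 : cnorm a = 1 by apply/eqP; rewrite eq_le ha andbT; nra.
move=> r; rewrite inE => /orP[/eqP ->//|]; apply: IH => //.
by rewrite a1 mul1r in e.
Qed.

(** Reflecting a factor whose zero [r] is on the circle reproduces it up to the constant [- conj r],
    and these constants multiply to [1]. *)
Lemma prod_self_inversive (s : seq C) : (forall r, r \in s -> cnorm r = 1) ->
  \prod_(r <- s) (- r) = 1 -> self_inversive (size s) (\prod_(r <- s) ('X - r%:P)).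
Proof.
move=> h e z z0.
have gen (t : seq C) : {subset t <= s} ->
    z ^+ size t * ((\prod_(r <- t) ('X - r%:P)).[(z^*)^-1])^* =
    (\prod_(r <- t) (- r))^* * (\prod_(r <- t) ('X - r%:P)).[z].
  elim: t => [|a t IH] ts; first by rewrite !big_nil !hornerE ?rmorph1 ?mulr1.
  have at1 : cnorm a = 1 by apply: h; apply: ts; rewrite mem_head.
  rewrite !big_cons !hornerM !hornerXsubC !rmorphM /= exprS.
  rewrite mulrACA IH; last by move=> x xt; apply: ts; rewrite inE xt orbT.
  rewrite rmorphB /= fmorphV /= conjcK rmorphN /=.
  have -> : z * (z^-1 - a^*) = - a^* * (z - a).
    rewrite mulrBr mulfV // mulrBr !mulNr opprK [a^* * a]mulrC mulJ at1 expr1n.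
    by rewrite mulrC addrC.
  ring.
by rewrite gen // e rmorph1 mul1r.
Qed.

Lemma Re_unit_quot z r : cnorm z = 1 -> cnorm r = 1 -> z != r -> Re (z / (z - r)) = 2^-1.
Proof.
move=> z1 r1 zr; rewrite inv_cnorm !mulrA [z * _]mulrC -mulrA ReM ReC ImC mul0r subr0.
have n0 : cnorm (z - r) ^+ 2 != 0 by rewrite expf_neq0 // cnorm_eq0 subr_eq0.
apply: (mulfI n0); rewrite mulVKf // cnorm_sqrD cnormN z1 r1 dotNr.
have : Re z ^+ 2 + Im z ^+ 2 = 1 by rewrite -cnorm_sqr z1 expr1n.
by rewrite /dot !ReImE expr1n => e; lra.
Qed.

Variables (d : nat) (f : {poly C}).
Hypotheses (d2 : (2 <= d)%N) (f_S : Sstar_d d f).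

Lemma Sstar_univalent : univalent_disk f.
Proof. by case: f_S => -[_ [_ [_]]]. Qed.

Lemma Sstar_deriv : exists rs : seq C, [/\ size rs = d.-1, uniq rs,
  f^`() = \prod_(r <- rs) ('X - r%:P), \prod_(r <- rs) (- r) = 1 &
  forall r, r \in rs -> cnorm r = 1].
Proof.
have d0 : (0 < d)%N by apply: ltnW.
case: f_S => -[szf [f0 [f1 fu]]] fd.
have dR : (d%:R : C) != 0 by rewrite pnatr_eq0 -lt0n.
have df : (f^`())`_d.-1 = 1.
  by rewrite coef_deriv prednK // fd -[_^-1 *+ _]mulr_natr mulVf.
have szf' : size f^`() = d.
  apply/eqP; rewrite eqn_leq; apply/andP; split.
    by apply/leq_sizeP => j dj; rewrite coef_deriv (leq_sizeP _ _ szf) ?mul0rn.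
  rewrite leqNgt; apply/negP => h.
  have : (f^`())`_d.-1 = 0 by apply: (leq_sizeP _ d.-1) => //; rewrite -ltnS prednK.
  by rewrite df => /eqP; rewrite oner_eq0.
have [rs hrs] := closed_field_poly_normal f^`().
have lc : lead_coef f^`() = 1 by rewrite lead_coefE szf' df.
rewrite lc scale1r in hrs.
have szrs : size rs = d.-1.
  by have := congr1 (fun p : {poly C} => size p) hrs; rewrite size_prod_XsubC szf' => ->.
have P0 : \prod_(r <- rs) (- r) = 1.
  have : f^`().[0] = 1 by rewrite horner_coef0 coef_deriv f1.
  by rewrite hrs horner_prod; under eq_bigr => r _ do rewrite hornerXsubC sub0r.
have rsroot r : r \in rs -> f^`().[r] = 0.
  by move=> rrs; apply/eqP; rewrite -/(root _ _) hrs root_prod_XsubC.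
have rs1 r : r \in rs -> cnorm r = 1.
  apply: prod_ge1_eq1 => [x xrs|].
    rewrite leNgt; apply/negP => /(deriv_in Sstar_univalent).
    by rewrite rsroot ?eqxx.
  have := congr1 (fun x : C => cnorm x) P0; rewrite cnorm1 cnorm_prod.
  by under eq_bigr => x _ do rewrite cnormN.
exists rs; split => //.
apply: count_mem_uniq => x; have [xrs|/count_memPn//] := boolP (x \in rs).
have hx : \prod_(r <- rs) ('X - r%:P) = \prod_(r <- x :: rem x rs) ('X - r%:P) :> {poly C}.
  by apply: perm_big; apply: perm_to_rem.
have := deriv2_bd Sstar_univalent (rs1 _ xrs) (rsroot _ xrs).
rewrite hrs hx big_cons derivM derivXsubC mul1r hornerD hornerM hornerXsubC subrr mul0r addr0.
have hc : count_mem x (rem x rs) = (count_mem x rs - 1)%N by rewrite count_rem xrs /= eqxx.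
move=> h; have : x \notin rem x rs.
  apply: contraNN h => xr; rewrite -/(root _ _) root_prod_XsubC //.
by move/count_memPn; rewrite hc; have := xrs; rewrite -has_pred1 has_count; lia.
Qed.

Lemma Sstar_self_inversive : self_inversive d.-1 f^`().
Proof.
by have [rs [szrs _ -> P0 rs1]] := Sstar_deriv; rewrite -szrs; apply: prod_self_inversive.
Qed.

(* The real part is [(d - 2) / 2]: each other zero of [f'] contributes [1 / 2]. *)
Lemma Sstar_cusp zeta : cnorm zeta = 1 -> f^`().[zeta] = 0 -> exists K : {poly C},
  [/\ f^`() = ('X - zeta%:P) * K, K.[zeta] != 0 & 0 <= Re (zeta * K^`().[zeta] / K.[zeta])].
Proof.
have [rs [_ urs hrs _ rs1]] := Sstar_deriv => z1 fz.
have zrs : zeta \in rs by rewrite -root_prod_XsubC -hrs; apply/eqP.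
have hx : \prod_(r <- rs) ('X - r%:P) = \prod_(r <- zeta :: rem zeta rs) ('X - r%:P) :> {poly C}.
  by apply: perm_big; apply: perm_to_rem.
have znot : ~~ root (\prod_(r <- rem zeta rs) ('X - r%:P)) zeta.
  by rewrite root_prod_XsubC mem_rem_uniqF.
exists (\prod_(r <- rem zeta rs) ('X - r%:P)); split=> //; first by rewrite hrs hx big_cons.
rewrite prodXsub_logderiv // mulrCA mulrAC mulfV // mul1r mulr_sumr.
have : {subset rem zeta rs <= [pred r | (r \in rs) && (r != zeta)]}.
  by move=> r; rewrite mem_rem_uniq // !inE andbC.
elim: (rem zeta rs) => [|r s IH] h; first by rewrite big_nil.
have /andP[rrs rz] := h r (mem_head _ _).
rewrite big_cons ReD Re_unit_quot ?(rs1 r) // 1?eq_sym //.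
by rewrite addr_ge0 ?invr_ge0 // IH // => x xs; apply: h; rewrite inE xs orbT.
Qed.

(** Each of the [d - 1] zeros of [f'] contributes [1 / 2] to the real part. This is what makes the
    image locally convex at a regular boundary point. *)
Lemma Sstar_convex zeta : cnorm zeta = 1 -> f^`().[zeta] != 0 ->
  0 <= Re (zeta * f^`()^`().[zeta] / f^`().[zeta]).
Proof.
have [rs [_ urs hrs _ rs1]] := Sstar_deriv => z1 fz.
have fz' : (\prod_(r <- rs) ('X - r%:P)).[zeta] != 0 by rewrite -hrs.
rewrite hrs prodXsub_logderiv // mulrCA mulrAC mulfV // mul1r mulr_sumr.
have : {subset rs <= [pred r | (r \in rs) && (r != zeta)]}.
  move=> r rrs; rewrite inE rrs; apply: contraNneq fz => rz.
  by rewrite -rz -/(root _ _) hrs root_prod_XsubC.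
elim: {1 3}rs => [|r s IH] h; first by rewrite big_nil.
have /andP[rrs rz] := h r (mem_head _ _).
rewrite big_cons ReD Re_unit_quot ?(rs1 r) // 1?eq_sym //.
by rewrite addr_ge0 ?invr_ge0 // IH // => x xs; apply: h; rewrite inE xs orbT.
Qed.

Lemma Sstar_normal_sqr zeta : cnorm zeta = 1 ->
  (zeta * f^`().[zeta]) ^+ 2 = zeta ^+ d.+1 * (cnorm f^`().[zeta] ^+ 2)%:C.
Proof.
move=> z1; rewrite exprMn (self_inversive_sqr Sstar_self_inversive) // mulrA -exprD.
by congr (_ ^+ _ * _); lia.
Qed.

Lemma Sstar_cusps : has_card (cusp f) d.-1.
Proof.
have [rs [szrs urs hrs _ rs1]] := Sstar_deriv.
have rsP z : (z \in rs) = (f^`().[z] == 0) by rewrite hrs -/(root _ _) root_prod_XsubC.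
exists [seq f.[z] | z <- rs]; split; [|split].
- rewrite map_inj_in_uniq // => z w zrs wrs e; apply/eqP; apply: contraT => zw.
  have := double_regular Sstar_univalent (rs1 _ zrs) (rs1 _ wrs) zw e.
  by rewrite -rsP zrs.
- by rewrite size_map.
move=> w; split.
  move=> /mapP[z zrs ->]; exists z; rewrite cnorm_norm1 rs1 //; split=> //; split=> //.
  by apply/eqP; rewrite -rsP.
move=> [z [_ [/eqP dz ->]]]; apply: map_f; by rewrite rsP.
Qed.

End Structure.

(** * Positions on the circle *)

Section Positions.
Set Implicit Arguments. Unset Strict Implicit. Unset Printing Implicit Defensive.
Variable R : realType.
Notation C := R[i].
Implicit Types (s t x y : R) (z : C).

Lemma expi_surj z : cnorm z = 1 -> exists2 t : R, 0 <= t < 2 * pi & z = expi t.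
Proof.
move=> z1; have z2 : Re z ^+ 2 + Im z ^+ 2 = 1 by rewrite -cnorm_sqr z1 expr1n.
have pi0 : 0 < pi :> R := pi_gt0 R.
have /andP[h1 h2] : -1 <= Re z <= 1 by rewrite -ler_norml; have := Re_le z; rewrite z1.
have hz : -1 <= Re z <= 1 by rewrite h1.
have sE : sin (acos (Re z)) = `|Im z|.
  by rewrite sin_acos // (_ : 1 - Re z ^+ 2 = Im z ^+ 2) ?sqrtr_sqr //; lra.
have a0 := acos_ge0 hz; have ap := acos_lepi hz.
have cE : cos (acos (Re z)) = Re z by rewrite acosK // in_itv.
have [i0|i0] := leP 0 (Im z).
  exists (acos (Re z)); first by rewrite a0; lra.
  by apply: complex_ext; rewrite /= ?cE // sE ger0_norm.
exists (2 * pi - acos (Re z)).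
  have : acos (Re z) != 0.
    apply/eqP => h; move: sE; rewrite h sin0 => /esym/eqP; rewrite normr_eq0 => /eqP.
    by move=> h0; rewrite h0 ltxx in i0.
  by rewrite neq_lt ltNge a0 /= => ?; apply/andP; split; lra.
have -> : 2 * pi - acos (Re z) = - acos (Re z) + pi *+ 2 by rewrite -mulr_natl; ring.
apply: complex_ext; rewrite /= ?cosD2pi ?sinD2pi ?cosN ?sinN ?cE // sE ltr0_norm //.
by rewrite opprK.
Qed.

Lemma expi_sub s t : expi s - expi t =
  expi ((s + t) / 2) * (0 +i* (2 * sin ((s - t) / 2))).
Proof.
have -> : expi s = expi ((s + t) / 2) * expi ((s - t) / 2).
  by rewrite -expiD; congr expi; field.
have -> : expi t = expi ((s + t) / 2) * expi (- ((s - t) / 2)).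
  by rewrite -expiD; congr expi; field.
rewrite -mulrBr -expiJ; congr (_ * _).
by apply: complex_ext; rewrite !(ReD, ImD, ReN, ImN, ReJ, ImJ) /=; ring.
Qed.

Lemma expi_eq1 t : expi (2 * pi * t) = 1 -> exists k : int, t = k%:~R.
Proof.
move=> h; exists (Num.floor t).
have e1 : expi (2 * pi * (t - (Num.floor t)%:~R)) = 1.
  have int1 (k : int) : expi (2 * pi * k%:~R : R) = 1.
    have nat1 (n : nat) : expi (2 * pi * n%:R : R) = 1.
      rewrite mulr_natr expiMn (_ : 2 * pi = pi *+ 2) ?mulr_natl //.
      by rewrite expiMn expi_pi sqrrN expr1n expr1n.
    case: k => n; first exact: nat1.
    rewrite NegzE rmorphN /= mulrN -expiJ -[n.+1%:~R]/(n.+1%:R) nat1.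
    exact: conjc1.
  by rewrite mulrBr expiD -mulrN -rmorphN /= h int1 mulr1.
have f1 := Num.Theory.floor_le t; have f2 := floorD1_gt t.
rewrite intrD in f2.
set r := t - _ in e1; have [r0|r0] := eqVneq r 0; first by apply/eqP; rewrite -subr_eq0 -/r r0.
have pi0 : 0 < pi :> R := pi_gt0 R.
have r1 : 0 < r by rewrite lt_neqAle eq_sym r0 /r subr_ge0.
have sp : 0 < sin (pi * r).
  by apply: sin_gt0_pi; rewrite mulr_gt0 //= gtr_pMr // /r; lra.
have := congr1 (@complex.Re R) e1; rewrite Re1 /=.
have -> : 2 * pi * r = (pi * r) *+ 2 by rewrite -mulr_natl; ring.
rewrite cos_mulr2n => h1.
have := cos2Dsin2 (pi * r); have : 0 < sin (pi * r) ^+ 2 by rewrite exprn_gt0.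
move: h1; rewrite -mulr_natl; lra.
Qed.

Variables (n : nat) (b : C).
Hypotheses (n0 : (0 < n)%N) (b1 : cnorm b = 1).

Let nR : 0 < n%:R :> R. Proof. by rewrite ltr0n. Qed.
Let npi : 0 < pi :> R. Proof. exact: pi_gt0. Qed.
Let b0 : b != 0. Proof. by rewrite -cnorm_gt0 b1. Qed.

(** Positions on the circle, counted from [b] in units of [2 pi / n]. Points with the same [n]-th
    power have positions that differ by an integer, and the range [[0, n)] cuts the circle at
    [b]. *)
Definition pos x : C := b * expi (2 * pi * x / n%:R).

Lemma cnorm_pos x : cnorm (pos x) = 1.
Proof. by rewrite cnormM b1 cnorm_expi mulr1. Qed.

Lemma pos0 : pos 0 = b.
Proof. by rewrite /pos mulr0 mul0r expi0 mulr1. Qed.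

Lemma pos_surj z : cnorm z = 1 -> exists2 x, 0 <= x < n%:R & z = pos x.
Proof.
move=> z1; have [|t /andP[t0 t1] zt] := @expi_surj (z / b).
  by rewrite cnormM cnormV z1 b1 invr1 mulr1.
exists (t * n%:R / (2 * pi)).
  rewrite divr_ge0 ?mulr_ge0 ?(ltW npi) ?(ltW nR) //= ltr_pdivrMr ?mulr_gt0 //.
  by rewrite mulrC ltr_pM2l.
rewrite /pos (_ : _ / n%:R = t) -?zt; first by rewrite mulrC divfK.
move: (pi : R) (lt0r_neq0 npi) => p p0.
by field; rewrite (lt0r_neq0 nR) p0.
Qed.

Lemma pos_pow x y : pos x ^+ n = pos y ^+ n -> exists k : int, x - y = k%:~R.
Proof.
have e s : pos s ^+ n = b ^+ n * expi (2 * pi * s).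
  rewrite exprMn -expiMn; congr (_ * expi _).
  by rewrite -[_ *+ _]mulr_natr divfK ?lt0r_neq0.
rewrite !e => /(mulfI (expf_neq0 n b0)) h; apply: expi_eq1.
by rewrite mulrBr expiD h -expiJ mulJ cnorm_expi expr1n.
Qed.

Lemma pos_inj x y : 0 <= x < n%:R -> 0 <= y < n%:R -> pos x = pos y -> x = y.
Proof.
move=> hx hy /(mulfI b0) h; have [|k hk] := @expi_eq1 ((x - y) / n%:R).
  rewrite (_ : _ * _ = 2 * pi * x / n%:R + - (2 * pi * y / n%:R)); last first.
    by field; exact: lt0r_neq0.
  by rewrite expiD h -expiJ mulJ cnorm_expi expr1n.
have xy : x - y = k%:~R * n%:R by rewrite -hk divfK ?lt0r_neq0.
suff k0 : k = 0 by apply/eqP; rewrite -subr_eq0 xy k0 mul0r.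
have : k%:~R < 1%:~R :> R by rewrite -(ltr_pM2r nR) -xy mul1r; lra.
have : (-1)%:~R < k%:~R :> R by rewrite -(ltr_pM2r nR) -xy mulN1r; lra.
rewrite !ltr_int; lia.
Qed.

Lemma pos_near x (e : R) : 0 < e ->
  exists2 d : R, 0 < d & forall t, 0 < t < d -> cnorm (pos (x - t) - pos x) < e.
Proof.
move=> e0.
have [d d0 hd] : exists2 d : R, 0 < d & forall t, `|t| < d -> `|sin t| < e / 2.
  have e2 : 0 < e / 2 by rewrite divr_gt0.
  have := @continuous_sin R 0; rewrite /continuous_at => /cvgrPdist_lt /(_ _ e2).
  move=> /nbhs_ballP [d /= d0 hd].
  by exists d => // t ht; have := hd t; rewrite /ball /= sin0 !sub0r !normrN; apply.
exists (d * n%:R / pi); first by rewrite divr_gt0 // mulr_gt0.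
move=> t /andP[t0]; rewrite ltr_pdivlMr // => td.
rewrite /pos -mulrBr cnormM b1 mul1r expi_sub cnormM cnorm_expi mul1r.
rewrite /cnorm RecE ImcE expr0n add0r sqrtr_sqr normrM ger0_norm //.
have -> : (2 * pi * (x - t) / n%:R - 2 * pi * x / n%:R) / 2 = - (pi * t / n%:R).
  by field; exact: lt0r_neq0.
rewrite sinN normrN mulrC -ltr_pdivlMr //; apply: hd.
have h0 : 0 <= pi * t / n%:R by rewrite divr_ge0 ?mulr_ge0 // ltW.
by rewrite ger0_norm // ltr_pdivrMr // mulrC.
Qed.

(** A difference of two positions is a factor depending on their sum times a real multiple of
    [sin (pi (s - t) / n)]. The first factors agree on both sides of the equation, and the signs of
    the sines express the order of the positions. *)
Lemma pos_side x y p q (r : R) : 0 <= x < n%:R -> 0 <= y < n%:R -> 0 <= p < n%:R ->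
  0 <= q < n%:R -> x < y -> 0 < r ->
  (pos x - pos q) * (pos y - pos p) = r%:C * ((pos y - pos q) * (pos x - pos p)) ->
  x < q < y -> x < p < y.
Proof.
move=> hx hy hp hq xy r0.
pose S t : R := sin (pi * t / n%:R).
have eS s t : pos s - pos t = b * expi (pi * (s + t) / n%:R) * (0 +i* (2 * S (s - t))).
  have e1 : (2 * pi * s / n%:R + 2 * pi * t / n%:R) / 2 = pi * (s + t) / n%:R.
    by field; exact: lt0r_neq0.
  have e2 : (2 * pi * s / n%:R - 2 * pi * t / n%:R) / 2 = pi * (s - t) / n%:R.
    by field; exact: lt0r_neq0.
  by rewrite /pos -mulrBr expi_sub e1 e2 mulrA.
have e2 s t s' t' : (pos s - pos t) * (pos s' - pos t') =
   b ^+ 2 * expi (pi * (s + t + s' + t') / n%:R) * (- (4 * (S (s - t) * S (s' - t'))))%:C.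
  have -> : pi * (s + t + s' + t') / n%:R =
      pi * (s + t) / n%:R + pi * (s' + t') / n%:R by ring.
  have -> : (- (4 * (S (s - t) * S (s' - t'))))%:C =
      (0 +i* (2 * S (s - t))) * (0 +i* (2 * S (s' - t'))).
    by apply: complex_ext; rewrite !(ReM, ImM, RecE, ImcE, ReC, ImC); ring.
  by rewrite !eS expiD; ring.
rewrite !e2 [r%:C * _]mulrCA.
have -> : x + q + y + p = y + q + x + p by ring.
have c0 : b ^+ 2 * expi (pi * (y + q + x + p) / n%:R) != 0.
  by rewrite -cnorm_gt0 cnormM cnormX b1 cnorm_expi expr1n mulr1.
move=> /(mulfI c0); rewrite -rmorphM => /complexI h.
have Sp t : 0 < t < n%:R -> 0 < S t.
  move=> /andP[t0 t1]; apply: sin_gt0_pi.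
  by rewrite divr_gt0 ?mulr_gt0 //= ltr_pdivrMr // ltr_pM2l.
have SN t : S (- t) = - S t by rewrite /S mulrN mulNr sinN.
have S0 : S 0 = 0 by rewrite /S mulr0 mul0r sin0.
move=> /andP[xq qy].
have h1 : 0 < S (q - x) by apply: Sp; lra.
have h2 : 0 < S (y - q) by apply: Sp; lra.
rewrite -(opprB q x) SN in h.
have [px|xp|px] := ltgtP p x.
- have h3 : 0 < S (x - p) by apply: Sp; lra.
  have h4 : 0 < S (y - p) by apply: Sp; lra.
  have : 0 < S (q - x) * S (y - p) by rewrite mulr_gt0.
  have : 0 < r * (S (y - q) * S (x - p)) by rewrite !mulr_gt0.
  by lra.
- have [py|yp|py] := ltgtP p y => //.
  + have h3 : 0 < S (p - x) by apply: Sp; lra.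
    have h4 : 0 < S (p - y) by apply: Sp; lra.
    rewrite -(opprB p y) -(opprB p x) !SN in h.
    have : 0 < S (q - x) * S (p - y) by rewrite mulr_gt0.
    have : 0 < r * (S (y - q) * S (p - x)) by rewrite !mulr_gt0.
    by lra.
  + have h3 : 0 < S (y - x) by apply: Sp; lra.
    rewrite py subrr S0 -(opprB y x) SN in h.
    have : 0 < r * (S (y - q) * S (y - x)) by rewrite !mulr_gt0.
    by lra.
have h3 : 0 < S (y - x) by apply: Sp; lra.
rewrite px subrr S0 in h.
have : 0 < S (q - x) * S (y - x) by rewrite mulr_gt0.
by lra.
Qed.

End Positions.

(** * Support points and the sides of a chord *)

Section Support.
Set Implicit Arguments. Unset Strict Implicit. Unset Printing Implicit Defensive.
Variable R : realType.
Notation C := R[i].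
Variable f : {poly C}.
Hypothesis f_uni : univalent_disk f.

Lemma Re_conj_dot (u x : C) : Re (u^* * x) = dot u x.
Proof. by rewrite /dot !ReImE; ring. Qed.

(** If [x] is a support point for [w], then [conj w (f.[x] - f.[y])] has nonnegative real part for
    [y] in the closed disk. The principal roots along the chord, for both support points, make up
    the function [B] of [chord_side]; its end values agree since [f.[z1] = f.[z2]]. *)
Lemma support_side (z1 z2 P Q u v : C) : cnorm z1 = 1 -> cnorm z2 = 1 -> z1 != z2 ->
  f.[z1] = f.[z2] -> u != 0 -> v != 0 -> support f u P -> support f v Q -> P != Q ->
  exists2 r : R, 0 < r & (z1 - Q) * (z2 - P) = r%:C * ((z2 - Q) * (z1 - P)).
Proof.
move=> n1 n2 z12 fz u0 v0 sP sQ PQ; have nP := sP.1; have nQ := sQ.1.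
have ne (w x : C) : w != 0 -> support f w x -> f.[x] != f.[z1].
  move=> w0 sx; have [e|xz] := eqVneq x z1.
    by rewrite e in sx; have := support_not_double f_uni w0 sx n2 z12; rewrite fz eqxx.
  exact: (support_not_double f_uni w0 sx n1 xz).
have i0 : 0 <= (0 : R) <= 1 by rewrite lexx ler01.
have i1 : 0 <= (1 : R) <= 1 by rewrite lexx ler01.
pose g (w x : C) s := sqrtc (w^* * (f.[x] - f.[chord z1 z2 s])).
have g0 w x s : w != 0 -> support f w x -> 0 <= s <= 1 -> g w x s != 0.
  move=> w0 sx hs; rewrite sqrtc_eq0 mulf_neq0 ?fmorph_eq0 // subr_eq0.
  case: (chordP n1 n2 z12 hs) => [||y hy]; rewrite -?fz; try exact: (ne w x).
  by rewrite eq_sym; apply/eqP; apply: (interior_neq_boundary f_uni) => //; exact: sx.1.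
have [L L0 hL] := poly_lip f 1.
have cg w x : support f w x -> cont01 (g w x).
  move=> sx; apply: cont01_sqrtc => [t ht|].
    rewrite Re_conj_dot dotBr subr_ge0; apply: sx.2; exact: chord_le.
  apply: cont01M; first exact: cont01_cst.
  apply: (@cont01_lip _ _ (L * cnorm (z2 - z1))) => s t hs ht.
  have -> : f.[x] - f.[chord z1 z2 s] - (f.[x] - f.[chord z1 z2 t]) =
    - (f.[chord z1 z2 s] - f.[chord z1 z2 t]) by ring.
  rewrite cnormN; apply: le_trans (hL _ _ _ _) _; try exact: chord_le.
  by rewrite chord_lip -mulrA [`|_| * _]mulrC.
have uv : sqrtc (u^* / v^*) != 0.
  by rewrite sqrtc_eq0 mulf_neq0 ?invr_eq0 ?fmorph_eq0.
apply: (chord_side f_uni (B := fun s => sqrtc (u^* / v^*) * (g v Q s / g u P s))) => //.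
- exact: ne u0 sP.
- exact: ne v0 sQ.
- apply: cont01M; first exact: cont01_cst.
  by apply: cont01M; [apply: cg | apply: cont01V; [move=> t ht; apply: g0 | apply: cg]].
- by move=> s hs; rewrite !mulf_neq0 // ?invr_eq0 g0.
- by rewrite /g !chord0 !chord1 fz.
move=> s hs; have gP := g0 u P s u0 sP hs.
rewrite exprMn expr_div_n !sqr_sqrtc.
rewrite sqrtc_eq0 mulf_eq0 negb_or in gP; case/andP: gP => gu gP.
have gv : v^* != 0 by rewrite fmorph_eq0.
by field; rewrite gP gu gv.
Qed.

End Support.

(** * The number of double points *)

Section DoubleBound.
Set Implicit Arguments. Unset Strict Implicit. Unset Printing Implicit Defensive.
Variable R : realType.
Notation C := R[i].
Variables (d : nat) (f : {poly C}).
Hypotheses (d2 : (2 <= d)%N) (f_S : Sstar_d d f).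

Let f_uni : univalent_disk f := Sstar_univalent f_S.

Lemma double_pow (z w : C) : cnorm z = 1 -> cnorm w = 1 -> z != w -> f.[z] = f.[w] ->
  z ^+ d.+1 = w ^+ d.+1.
Proof.
move=> z1 w1 zw fe; have [r r0 hr] := double_normals f_uni z1 w1 zw fe.
have dz := double_regular f_uni z1 w1 zw fe.
have nr : cnorm f^`().[w] = r * cnorm f^`().[z].
  have := congr1 (@cnorm R) hr; rewrite !cnormM z1 w1 cnormC normrN gtr0_norm //.
  by rewrite !mul1r.
have e1 := Sstar_normal_sqr d2 f_S w1; have e2 := Sstar_normal_sqr d2 f_S z1.
have c0 : (r ^+ 2 * cnorm f^`().[z] ^+ 2)%:C != 0.
  by rewrite -cnorm_gt0 cnormC gtr0_norm mulr_gt0 ?exprn_gt0 ?cnorm_gt0.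
apply: (mulIf c0); rewrite -exprMn -nr -e1 hr exprMn e2 mulrCA -rmorphXn sqrrN nr exprMn.
by rewrite -rmorphM.
Qed.

(** The right side is even in [u], so the support points for [u] and [- u] lie in one coset of the
    roots of unity of order [d + 1]. *)
Lemma support_pow (u z : C) : cnorm u = 1 -> support f u z -> z ^+ d.+1 = u ^+ 2.
Proof.
move=> u1 sz; have u0 : u != 0 by rewrite -cnorm_gt0 u1.
have [dz [r r0 hr]] := support_normal f_uni u0 sz; have z1 := sz.1.
have nr : cnorm f^`().[z] = r.
  have := congr1 (@cnorm R) hr; rewrite !cnormM z1 u1 cnormC gtr0_norm //.
  by rewrite mul1r mulr1.
have := Sstar_normal_sqr d2 f_S z1.
rewrite hr nr exprMn rmorphXn /= mulrC => /mulIf h; apply/esym/h.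
by rewrite -rmorphXn -cnorm_gt0 cnormC gtr0_norm ?exprn_gt0.
Qed.

Lemma double_bound (s : seq C) : uniq s -> (forall w, w \in s -> double_point f w) ->
  (size s <= d.-2)%N.
Proof.
move=> us hs; have [->//|s0] := eqVneq s [::].
have one0 : (1 : C) != 0 := oner_neq0 _.
(* [b] is not an end of any chord and serves as the origin of positions, so the arc cut off by a
   chord on the side away from [b] is an interval inside [(0, n)]. *)
have [b sb] := support_exists f_uni one0; have b1 := sb.1.
pose n := d.+1; have n0 : (0 < n)%N by [].
pose E := pos n b; have nE x : cnorm (E x) = 1 by apply: cnorm_pos.
have nz0 : 0 <= (0 : R) < n%:R by rewrite lexx ltr0n.
have pts (w : C) : exists p : R * R, w \in s ->
    [/\ 0 < p.1, p.1 < p.2, p.2 < n%:R, f.[E p.1] = w & f.[E p.2] = w].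
  have [ws|] := boolP (w \in s); last by exists (0, 0).
  have [z1 [z2 [/cnorm_norm1 n1 [/cnorm_norm1 n2 [/eqP z12 [fz1 fz2]]]]]] := hs w ws.
  have [x1 hx1 ez1] := pos_surj n0 b1 n1; have [x2 hx2 ez2] := pos_surj n0 b1 n2.
  have nb (z z' : C) : cnorm z' = 1 -> z != z' -> f.[z] = w -> f.[z'] = w -> z != b.
    move=> n' zz' e1 e2; apply/eqP => zb; rewrite zb in zz' e1.
    by have := support_not_double f_uni one0 sb n' zz'; rewrite e1 e2 eqxx.
  have p1 : 0 < x1.
    case/andP: hx1; rewrite le_eqVlt => /orP[/eqP x10|//] _.
    by have := nb z1 z2 n2 z12 (esym fz1) (esym fz2); rewrite ez1 -x10 pos0 eqxx.
  have p2 : 0 < x2.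
    case/andP: hx2; rewrite le_eqVlt => /orP[/eqP x20|//] _.
    have z21 : z2 != z1 by rewrite eq_sym.
    by have := nb z2 z1 n1 z21 (esym fz2) (esym fz1); rewrite ez2 -x20 pos0 eqxx.
  have [lt12|lt21|e12] := ltgtP x1 x2.
  - by exists (x1, x2) => _; case/andP: hx2 => _ ?; split => //=; rewrite /E -?ez1 -?ez2.
  - by exists (x2, x1) => _; case/andP: hx1 => _ ?; split => //=; rewrite /E -?ez1 -?ez2.
  by move: z12; rewrite ez1 ez2 e12 eqxx.
have [g hg] := choice pts.
have rng w : w \in s -> 0 <= (g w).1 < n%:R /\ 0 <= (g w).2 < n%:R.
  by move=> /hg[h1 h2 h3 _ _]; split; apply/andP; split; lra.
have E12 w : w \in s -> E (g w).1 != E (g w).2.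
  move=> ws; have [h1 h2] := rng w ws; have [_ h _ _ _] := hg w ws.
  by apply/eqP => /(pos_inj n0 b1 h1 h2) e; rewrite e ltxx in h.
have fE12 w : w \in s -> f.[E (g w).1] = f.[E (g w).2].
  by move=> /hg[_ _ _ -> ->].
have Ene w w' (x y : R) : w \in s -> w' \in s -> w != w' ->
    f.[E x] = w -> f.[E y] = w' -> x != y.
  by move=> ws ws' ww' e1 e2; apply: contraNneq ww' => xy; rewrite -e1 -e2 xy.
have len w : w \in s -> exists2 m : nat, (0 < m)%N & (g w).2 = (g w).1 + m%:R.
  move=> ws; have [_ h _ _ _] := hg w ws.
  have [k hk] := pos_pow n0 b1 (esym (double_pow (nE _) (nE _) (E12 w ws) (fE12 w ws))).
  have k0 : 0 < k by rewrite -(ltr0z R) -hk subr_gt0.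
  have [m km] : exists m : nat, k = m by exists `|k|%N; rewrite gez0_abs // ltW.
  exists m; first by rewrite -ltz_nat -km.
  by rewrite -[m%:R]/((m : int)%:~R) -km -hk addrC subrK.
(* Both ends of the chord of [w'] have the same image, so [chord_side] applies with the constant
   [B = 1]. *)
have side w w' (q q' : R) : w \in s -> w' \in s -> w != w' -> 0 <= q < n%:R -> 0 <= q' < n%:R ->
    E q != E q' -> f.[E q] = w' -> f.[E q'] = w' ->
    (g w).1 < q < (g w).2 -> (g w).1 < q' < (g w).2.
  move=> ws ws' ww' hq hq' qq' fq fq'.
  have [_ h _ f1 f2] := hg w ws; have [h1 h2] := rng w ws.
  have w'w : w' != w by rewrite eq_sym.
  have [| | | | | | |r r0 hr] := @chord_side R f f_uni (E (g w).1) (E (g w).2) (E q') (E q) (fun=> 1)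
     (nE _) (nE _) (nE _) (nE _) (E12 w ws) _ (fE12 w ws).
  - by rewrite eq_sym.
  - by rewrite fq' f1.
  - by rewrite fq f1.
  - exact: cont01_cst.
  - by move=> t _; apply: one0.
  - by [].
  - by move=> t _; rewrite fq fq' expr1n mulr1.
  exact: (pos_side n0 b1 h1 h2 hq' hq h r0 hr).
have lam w w' : w \in s -> w' \in s -> w != w' -> laminar2 (g w) (g w').
  move=> ws ws' ww'; have [_ h _ f1 f2] := hg w ws; have [_ h' _ f1' f2'] := hg w' ws'.
  have [h1 h2] := rng w' ws'.
  have n11 := Ene _ _ _ _ ws ws' ww' f1 f1'; have n12 := Ene _ _ _ _ ws ws' ww' f1 f2'.
  have n21 := Ene _ _ _ _ ws ws' ww' f2 f1'; have n22 := Ene _ _ _ _ ws ws' ww' f2 f2'.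
  have s1 := side w w' _ _ ws ws' ww' h1 h2 (E12 w' ws') f1' f2'.
  have E21 : E (g w').2 != E (g w').1 by rewrite eq_sym E12.
  have s2 := side w w' _ _ ws ws' ww' h2 h1 E21 f2' f1'.
  rewrite /laminar2.
  have [a1|a1|a1] := ltgtP (g w).1 (g w').1; last by rewrite a1 eqxx in n11.
    have [a2|a2|a2] := ltgtP (g w').1 (g w).2; last by rewrite a2 eqxx in n21.
      by have := s1; rewrite a1 a2 => /(_ isT) /andP[_ ->]; rewrite /= !orbT.
    by rewrite /= ?orbT.
  have [a2|a2|a2] := ltgtP (g w').2 (g w).1; last by rewrite a2 eqxx in n12.
    by rewrite /= ?orbT.
  have [a3|a3|a3] := ltgtP (g w').2 (g w).2; last by rewrite a3 eqxx in n22.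
    by have := s2; rewrite a2 a3 => /(_ isT) /andP[a4 _]; have := lt_trans a1 a4; rewrite ltxx.
  by rewrite /= ?orbT.
(* The coset will start at [x], just below the smallest left end [a0]: near enough that [E x] is not
   a support point, and such that the coset contains no left end. *)
have [w0 ws0 hw0] := seq_argmin (fun w => (g w).1) s0.
set a0 := (g w0).1 in hw0; have [a0p a01 a02 fa1 fa2] := hg w0 ws0; rewrite -/a0 in a0p a01 fa1.
have [d1 d10 hd1] := no_support_near_double f_uni (nE _) (nE _) (E12 w0 ws0) (fE12 w0 ws0).
have [d3 d30 hd3] := pos_near n0 b1 a0 d10.
have [d4 d40 hd4] := shift_not_int (fun w => (g w).1 - a0) s.
have [e e0 [ea e3 e4]] : exists2 e : R, 0 < e & [/\ e < a0, e < d3 & e < d4].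
  pose m := Num.min a0 (Num.min d3 d4).
  have m0 : 0 < m by rewrite !lt_min a0p d30.
  exists (m / 2); first by rewrite divr_gt0.
  have : m / 2 < m by lra.
  by rewrite {2}/m !lt_min => /and3P[-> -> ->].
pose x := a0 - e.
have xr : 0 <= x < n%:R by rewrite /x; lra.
have xs u : u != 0 -> ~ support f u (E x).
  by move=> u0; apply: hd1 => //; apply: hd3; rewrite e0.
(* With this [u], the support points for [u] and [- u] have the same [n]-th power as [E x], hence
   lie in its coset. *)
pose u := sqrtc (E x ^+ n).
have u1 : cnorm u = 1.
  apply/eqP; rewrite -(@eqrXn2 _ 2) ?cnorm_ge0 // -cnormX sqr_sqrtc cnormX nE !expr1n //.
have u0 : u != 0 by rewrite -cnorm_gt0 u1.
have nu0 : - u != 0 by rewrite oppr_eq0.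
have supp_pos v : cnorm v = 1 -> v ^+ 2 = E x ^+ n -> exists y, exists k : int,
    [/\ support f v (E y), 0 <= y < n%:R, y = x + k%:~R & k != 0].
  move=> v1 v2; have v0 : v != 0 by rewrite -cnorm_gt0 v1.
  have [P sP] := support_exists f_uni v0.
  have [y hy Py] := pos_surj n0 b1 sP.1.
  have [k hk] : exists k : int, y - x = k%:~R.
    by apply: (pos_pow n0 b1); rewrite -Py -/(E x) -v2; apply: support_pow.
  exists y, k; split=> //; [by rewrite /E -Py | by rewrite -hk addrC subrK |].
  apply: contraPneq sP => k0; rewrite Py (_ : y = x); first exact: xs.
  by apply/eqP; rewrite -subr_eq0 hk k0.
have [y1 [k1 [sy1 hy1 ek1 k10]]] := supp_pos u u1 (sqr_sqrtc _).
have [y2 [k2 [sy2 hy2 ek2 k20]]] : exists y, exists k : int,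
    [/\ support f (- u) (E y), 0 <= y < n%:R, y = x + k%:~R & k != 0].
  by apply: supp_pos; rewrite ?cnormN // sqrrN sqr_sqrtc.
have k12 : k1 != k2.
  apply/eqP => ek; have yy : y1 = y2 by rewrite ek1 ek2 ek.
  rewrite yy in sy1; have [_ [r r0 hr]] := support_normal f_uni u0 sy1.
  have [_ [r' r'0]] := support_normal f_uni nu0 sy2.
  rewrite hr mulrN -mulNr -rmorphN => /(mulIf u0)/complexI; lra.
(* [b] is a support point too, for [1], so a support point inside an interval would force position
   [0], that of [b], into it. *)
have uncov v y w : v != 0 -> support f v (E y) -> 0 <= y < n%:R -> w \in s ->
    ~~ ((g w).1 < y < (g w).2).
  move=> v0 sy hy ws; apply/negP => hyw; have [p1 p12 _ _ _] := hg w ws.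
  have [h1 h2] := rng w ws.
  have yb : b != E y.
    apply/eqP; rewrite -(pos0 n b) => /(pos_inj n0 b1 nz0 hy) y0.
    by move: hyw; rewrite -y0 => /andP[]; lra.
  have [r r0 hr] := support_side f_uni (nE _) (nE _) (E12 w ws) (fE12 w ws) one0 v0 sb sy yb.
  rewrite -(pos0 n b) in hr.
  by have := pos_side n0 b1 h1 h2 nz0 hy p12 r0 hr hyw => /andP[]; lra.
pose l := [seq ((g w).1 - x, (g w).2 - x) | w <- s].
have [| | | |s' [us' szs' hs']] := @laminar_points R l.
- rewrite map_inj_in_uniq // => w w' ws ws' [e1 _].
  apply/eqP; apply: contraT => ww'.
  have [_ _ _ h _] := hg w ws; have [_ _ _ h' _] := hg w' ws'.
  by have := Ene _ _ _ _ ws ws' ww' h h'; rewrite (addIr _ e1) eqxx.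
- move=> _ /mapP[w ws ->] /=; have [m m0 hm] := len w ws.
  by exists m => //; rewrite hm; ring.
- move=> _ k /mapP[w ws ->] /=.
  rewrite (_ : _ - x = (g w).1 - a0 + e); first by apply: hd4; rewrite ?e0.
  by rewrite /x; ring.
- move=> _ _ /mapP[w ws ->] /mapP[w' ws' ->] ne.
  have ww' : w != w' by apply: contraNneq ne => ->.
  by have := lam w w' ws ws' ww'; rewrite /laminar2 /= !ltrD2r.
have cov k : k \in s' -> exists2 w, w \in s & (g w).1 < x + k%:~R < (g w).2.
  move=> /hs'[_ /mapP[w ws ->] /= /andP[h1 h2]]; exists w => //.
  by apply/andP; split; lra.
have k1s : k1 \notin s'.
  by apply/negP => /cov[w ws]; rewrite -ek1; apply/negP; exact: (uncov u y1 w u0 sy1 hy1 ws).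
have k2s : k2 \notin s'.
  by apply/negP => /cov[w ws]; rewrite -ek2; apply/negP; exact: (uncov (- u) y2 w nu0 sy2 hy2 ws).
have k0s : 0 \notin s'.
  apply/negP => /cov[w ws] /andP[h _]; have := hw0 w ws.
  by move: h; rewrite addr0 /x; lra.
(* The offsets [0], [k1], [k2] and those in [s'] are distinct, and all give positions in a window of
   length [d + 1]. *)
have := @size_int_window R x n (0 :: k1 :: k2 :: s').
rewrite /= szs' size_map !inE !negb_or ![0 == _]eq_sym k10 k20 k0s k12 k1s k2s us'.
move=> /(_ isT); rewrite /n => hsz.
suff : ((size s).+3 <= d.+1)%N by move: d2; case: (d) => [|[|d']] //= _; rewrite !ltnS.
apply: hsz => k; rewrite !inE => /or4P[/eqP ->|/eqP ->|/eqP ->|/cov[w ws /andP[h1 h2]]].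
- by rewrite addr0.
- by rewrite -ek1.
- by rewrite -ek2.
have [h3 _ h4 _ _] := hg w ws; apply/andP; split; last exact: lt_trans h2 h4.
exact: ltW (lt_trans h3 h1).
Qed.

End DoubleBound.

(** * Taylor expansion near a cusp *)

Section Taylor.
Set Implicit Arguments. Unset Strict Implicit. Unset Printing Implicit Defensive.
Variable R : realType.
Notation C := R[i].

(** The two estimates are proved together because the difference quotient of [p X + c] at [x], [y]
    is [dq p x y * x + p.[y]]. The bounds on [z] and [M] keep the points in a fixed disk. *)
Lemma dq_taylor (p : {poly C}) : exists2 B : R, 0 <= B &
  forall (z k l : C) (M : R), cnorm z <= 2 -> cnorm k <= M -> cnorm l <= M -> M <= 1 ->
  cnorm (dq p (z + k) (z + l) - (p^`().[z] + p^`()^`().[z] / 2 * (k + l) +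
     p^`()^`()^`().[z] / 6 * (k ^+ 2 + k * l + l ^+ 2))) <= B * M ^+ 3 /\
  cnorm (p.[z + l] - (p.[z] + p^`().[z] * l + p^`()^`().[z] / 2 * l ^+ 2)) <= B * M ^+ 3.
Proof.
elim/poly_ind: p => [|p c [B B0 hB]].
  exists 0 => // z k l M _ _ _ _; rewrite !deriv0 !horner0 /dq /= polyseq0 /=.
  by rewrite !mul0r !addr0 subr0 cnorm0.
have [D D0 hD] := poly_bound (p^`()^`()) 2.
have [D' D'0 hD'] := poly_bound (p^`()^`()^`()) 2.
exists (4 * B + D + D'); first by rewrite !addr_ge0 // mulr_ge0.
move=> z k l M hz hk hl M1; have M0 : 0 <= M := le_trans (cnorm_ge0 _) hk.
have [h1 h2] := hB z k l M hz hk hl M1.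
have M3 : 0 <= M ^+ 3 by rewrite exprn_ge0.
have d1 : (p * 'X + c%:P)^`() = p^`() * 'X + p.
  by rewrite derivD derivC addr0 derivM derivX mulr1.
have d2 : (p^`() * 'X + p)^`() = p^`()^`() * 'X + p^`() *+ 2.
  by rewrite derivD derivM derivX mulr1 -addrA.
have d3 : (p^`()^`() * 'X + p^`() *+ 2)^`() = p^`()^`()^`() * 'X + p^`()^`() *+ 3.
  by rewrite derivD derivMn derivM derivX mulr1 -addrA -mulrS.
have dqE : dq (p * 'X + c%:P) (z + k) (z + l) = dq p (z + k) (z + l) * (z + k) + p.[z + l].
  have [kl|kl] := eqVneq (z + k) (z + l).
    by rewrite kl !dq_diag d1 !hornerE.
  apply: (@mulfI _ (z + k - (z + l))); first by rewrite subr_eq0.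
  rewrite mulrDr mulrA -!dqP !hornerE; ring.
rewrite dqE d1 d2 d3 !(hornerD, hornerM, hornerX, hornerMn, hornerC).
move: (hD z hz) (hD' z hz) h1 h2.
move: (p^`()^`()^`().[z]) (p^`()^`().[z]) (p^`().[z]) (p.[z]) (p.[z + l]) (dq p _ _)
  => c3 c2 c1 c0 q w b2 b3.
set E1 := w - _; set E2 := q - _ => h1 h2.
have nk : cnorm (z + k) <= 3 by apply: le_trans (cnormD _ _) _; lra.
have nl : cnorm (z + l) <= 3 by apply: le_trans (cnormD _ _) _; lra.
have n6 : cnorm (6^-1 : C) <= 1 / 3.
  by rewrite cnormV -(rmorph_nat (real_complex R)) cnormC normr_nat; lra.
have n2 : cnorm (2^-1 : C) <= 1.
  by rewrite cnormV -(rmorph_nat (real_complex R)) cnormC normr_nat; lra.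
have [k0 l0] := (cnorm_ge0 k, cnorm_ge0 l).
have M2 : M ^+ 3 = M * M * M by rewrite !exprS expr0 mulr1 mulrA.
have mon (x y : C) : cnorm x <= M -> cnorm y <= M -> cnorm (x * y) <= M * M.
  by move=> hx hy; rewrite cnormM ler_pM ?cnorm_ge0.
split.
  have -> : w * (z + k) + q - (c1 * z + c0 + (c2 * z + c1 *+ 2) / 2 * (k + l) +
      (c3 * z + c2 *+ 3) / 6 * (k ^+ 2 + k * l + l ^+ 2)) =
      E1 * (z + k) + E2 + c3 * (6^-1 * ((k * k + k * l + l * l) * k)).
    by rewrite /E1 /E2; field.
  apply: le_trans (cnormD _ _) _; have := cnormD (E1 * (z + k)) E2.
  rewrite cnormM => t1.
  have t2 : cnorm E1 * cnorm (z + k) <= B * M ^+ 3 * 3 by rewrite ler_pM ?cnorm_ge0.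
  have t3 : cnorm ((k * k + k * l + l * l) * k) <= 3 * M ^+ 3.
    rewrite M2 cnormM; have := mon _ _ hk hk; have := mon _ _ hk hl; have := mon _ _ hl hl.
    have := cnormD (k * k + k * l) (l * l); have := cnormD (k * k) (k * l) => a1 a2 a3 a4 a5.
    rewrite [leRHS](_ : _ = (3 * (M * M)) * M); last by ring.
    by rewrite ler_pM ?cnorm_ge0 //; lra.
  have t4 : cnorm (6^-1 * ((k * k + k * l + l * l) * k)) <= M ^+ 3.
    by rewrite cnormM; have := cnorm_ge0 ((k * k + k * l + l * l) * k); nra.
  have t5 : cnorm (c3 * (6^-1 * ((k * k + k * l + l * l) * k))) <= D' * M ^+ 3.
    by rewrite cnormM ler_pM ?cnorm_ge0.
  have := mulr_ge0 D0 M3; lra.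
have -> : q * (z + l) + c - (c0 * z + c + (c1 * z + c0) * l + (c2 * z + c1 *+ 2) / 2 * l ^+ 2) =
    E2 * (z + l) + c2 * (2^-1 * (l * l * l)).
  by rewrite /E2; field.
apply: le_trans (cnormD _ _) _.
have t2 : cnorm (E2 * (z + l)) <= B * M ^+ 3 * 3 by rewrite cnormM ler_pM ?cnorm_ge0.
have t3 : cnorm (l * l * l) <= M ^+ 3.
  by rewrite M2 cnormM ler_pM ?cnorm_ge0 ?mon.
have t4 : cnorm (c2 * (2^-1 * (l * l * l))) <= D * M ^+ 3.
  rewrite cnormM ler_pM ?cnorm_ge0 // cnormM.
  by have := cnorm_ge0 (l * l * l); have := cnorm_ge0 (2^-1 : C); nra.
have := mulr_ge0 D'0 M3; have := mulr_ge0 B0 M3; lra.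
Qed.

(* Two distinct points of the disk near a cusp with the same image would satisfy
   [kap + lam = - E kap ^ 2 + O(M ^ 3)], with [kap] almost imaginary. *)
Lemma cusp_inequality (e1 B1 : R) : 0 <= e1 -> 0 <= B1 -> exists2 d : R, 0 < d &
  forall kap lam E : C, cnorm E <= e1 -> - 4^-1 <= Re E ->
  Re kap <= - (cnorm kap ^+ 2 / 2) -> Re lam <= - (cnorm lam ^+ 2 / 2) ->
  forall M : R, 0 < M < d -> M <= 1 -> cnorm kap <= M -> cnorm lam <= M ->
  (cnorm kap = M \/ cnorm lam = M) ->
  cnorm (kap + lam + E * (kap ^+ 2 + kap * lam + lam ^+ 2)) <= B1 * M ^+ 3 -> False.
Proof.
move=> e10 B10; pose A := 3 * e1 + B1; pose A2 := 4 * (e1 * A) + B1 + 1.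
have A0 : 0 <= A by rewrite addr_ge0 // mulr_ge0.
have A20 : 0 < A2 by rewrite ltr_wpDl // addr_ge0 // !mulr_ge0.
exists (4^-1 / A2); first by rewrite divr_gt0 ?invr_gt0.
move=> kap lam E hE rE hk hl M /andP[M0 Md] M1 nk nl eM.
rewrite ltr_pdivlMr // in Md.
set rho := kap + lam + _ => hrho.
have [k0 l0] := (cnorm_ge0 kap, cnorm_ge0 lam).
have M3 : M ^+ 3 <= M ^+ 2 by rewrite exprSr ler_piMr // ?sqr_ge0.
have M30 : 0 <= M ^+ 3 by rewrite exprn_ge0 // ltW.
have e0 := cnorm_ge0 E.
have q1 : cnorm (kap ^+ 2 + kap * lam + lam ^+ 2) <= 3 * M ^+ 2.
  have := cnormD (kap ^+ 2 + kap * lam) (lam ^+ 2); have := cnormD (kap ^+ 2) (kap * lam).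
  rewrite !(cnormX, cnormM); nra.
have sE : kap + lam = rho - E * (kap ^+ 2 + kap * lam + lam ^+ 2) by rewrite /rho; ring.
have s1 : cnorm (kap + lam) <= A * M ^+ 2.
  rewrite sE; apply: le_trans (cnormB _ _) _; rewrite cnormM.
  have : cnorm E * cnorm (kap ^+ 2 + kap * lam + lam ^+ 2) <= e1 * (3 * M ^+ 2).
    by rewrite ler_pM ?cnorm_ge0.
  have : B1 * M ^+ 3 <= B1 * M ^+ 2 by rewrite ler_wpM2l.
  rewrite /A; lra.
have a1 : - Re kap <= A * M ^+ 2.
  have := Re_le (kap + lam); rewrite ReD ler_norml => /andP[h _].
  have : 0 <= cnorm lam ^+ 2 / 2 by rewrite divr_ge0 ?sqr_ge0.
  have : 0 <= cnorm kap ^+ 2 / 2 by rewrite divr_ge0 ?sqr_ge0.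
  lra.
have a2 : 0 <= - Re kap.
  by have : 0 <= cnorm kap ^+ 2 / 2; [rewrite divr_ge0 ?sqr_ge0 | lra].
(* One of the two numbers has modulus [M], which gives [- M ^ 2 / 2]; the expansion will give at
   least [- M ^ 2 / 4] up to [O(M ^ 3)], because [Re E >= - 1 / 4]. *)
have up : Re (kap + lam) <= - (M ^+ 2 / 2).
  rewrite ReD; have : 0 <= cnorm lam ^+ 2 / 2 by rewrite divr_ge0 ?sqr_ge0.
  have : 0 <= cnorm kap ^+ 2 / 2 by rewrite divr_ge0 ?sqr_ge0.
  by case: eM => e; rewrite e in hk hl *; lra.
have sE' : kap + lam = rho - E * kap ^+ 2 - E * (lam * (kap + lam)) by rewrite /rho; ring.
have r1 := Re_le rho; have r2 := Re_le (E * (lam * (kap + lam))).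
have r3 : cnorm (E * (lam * (kap + lam))) <= e1 * (A * M ^+ 3).
  rewrite !cnormM ler_pM ?mulr_ge0 ?cnorm_ge0 //.
  by rewrite [A * _](_ : _ = M * (A * M ^+ 2)) ?ler_pM ?cnorm_ge0 //; ring.
(* By [a1] the real part of [kap] is [O(M ^ 2)], so [kap ^ 2] equals [- (Im kap) ^ 2] up to
   [O(M ^ 3)], and only [Re E] matters at order [M ^ 2]. *)
have r4 : Re (E * kap ^+ 2) <= M ^+ 2 / 4 + 3 * (e1 * (A * M ^+ 3)).
  have := Im_le E; have := Re_le E; have := Im_le kap; have := Re_le kap.
  rewrite expr2 !(ReM, ImM) !ler_norml.
  set a := Re kap in a1 a2 *; set b := Im kap; set p := Re E in rE *; set q := Im E.
  move=> /andP[u1 u2] /andP[v1 v2] /andP[w1 w2] /andP[x1 x2].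
  have b1 : b * b <= M ^+ 2 by rewrite expr2; nra.
  have b0 : 0 <= b * b by rewrite -expr2 sqr_ge0.
  have t1 : - (p * (b * b)) <= M ^+ 2 / 4 by nra.
  have t2 : p * (a * a) <= e1 * (A * M ^+ 3).
    have : a * a <= A * M ^+ 3.
      have -> : A * M ^+ 3 = (A * M ^+ 2) * M by ring.
      by rewrite -mulrNN ler_pM //; lra.
    have : 0 <= a * a by rewrite -expr2 sqr_ge0.
    have : p <= e1 by lra.
    nra.
  have t3 : - (2 * (q * (a * b))) <= 2 * (e1 * (A * M ^+ 3)).
    have : `|q * (a * b)| <= e1 * (A * M ^+ 3).
      rewrite !normrM ler_pM ?mulr_ge0 //; first by rewrite ler_norml; lra.
      have -> : A * M ^+ 3 = (A * M ^+ 2) * M by ring.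
      rewrite ler_pM // ?ler_norml; lra.
    by rewrite ler_norml; lra.
  lra.
have lo : - (M ^+ 2 / 4) - (4 * (e1 * A) + B1) * M ^+ 3 <= Re (kap + lam).
  have -> : Re (kap + lam) = Re rho - Re (E * kap ^+ 2) - Re (E * (lam * (kap + lam))).
    by rewrite {1}sE' !(ReD, ReN).
  by move: r1 r2; rewrite !ler_norml !mulrDl; lra.
have M2 : 0 < M ^+ 2 by rewrite exprn_gt0.
have : M * A2 * M ^+ 2 < 4^-1 * M ^+ 2 by rewrite ltr_pM2r.
have -> : M * A2 * M ^+ 2 = A2 * M ^+ 3 by ring.
rewrite /A2 !mulrDl; rewrite !mulrDl in lo; lra.
Qed.

End Taylor.

(** * Perturbation *)

Section Perturb.
Set Implicit Arguments. Unset Strict Implicit. Unset Printing Implicit Defensive.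
Variable R : realType.
Notation C := R[i].
Implicit Types (p q : {poly C}) (x y z w : C) (e : R).

(** The only term without a factor [Re y] is [- Re x (Im y) ^ 2], which has the good sign. *)
Lemma Re_quad_le x y : 0 <= Re x -> Re (x * y ^+ 2) <= 3 * cnorm x * (`|Re y| * cnorm y).
Proof.
move=> rx; rewrite expr2 !(ReM, ImM).
have [hx ix] := (Re_le x, Im_le x); have [hy iy] := (Re_le y, Im_le y).
have t2 : Re x * (Re y * Re y) <= cnorm x * (`|Re y| * cnorm y).
  apply: le_trans (ler_norm _) _; rewrite !normrM.
  by rewrite ler_pM ?mulr_ge0 ?cnorm_ge0 ?ler_wpM2l.
have t3 : `|Im x * (Re y * Im y)| <= cnorm x * (`|Re y| * cnorm y).
  by rewrite !normrM ler_pM ?mulr_ge0 ?cnorm_ge0 ?ler_wpM2l.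
have : 0 <= Re x * (Im y * Im y) by rewrite mulr_ge0 // -expr2 sqr_ge0.
move: t3; rewrite ler_norml => /andP[t3 _]; lra.
Qed.

Lemma pert_near p q z (eta : R) : 0 < eta -> exists2 d : R, 0 < d &
  forall e x, `|e| < d -> cnorm (x - z) < d -> cnorm ((p + e%:C *: q).[x] - p.[z]) < eta.
Proof.
move=> eta0; have [d d0 hd] := @poly_near _ p z (eta / 2) ltac:(by rewrite divr_gt0).
have [B B0 hB] := poly_bound q (cnorm z + 1).
exists (Num.min (Num.min 1 d) (eta / 2 / (B + 1))).
  by rewrite !lt_min ltr01 d0 !divr_gt0 // ltr_wpDl.
move=> e x; rewrite !lt_min ltr_pdivlMr ?ltr_wpDl // => /andP[_ e3] /andP[/andP[x1 x2] _].
have nx : cnorm x <= cnorm z + 1.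
  by have := cnormD z (x - z); rewrite addrC subrK; lra.
have -> : (p + e%:C *: q).[x] - p.[z] = (p.[x] - p.[z]) + e%:C * q.[x].
  by rewrite hornerD hornerZ; ring.
apply: le_lt_trans (cnormD _ _) _; rewrite cnormM cnormC.
have := hd x x2; have := hB x nx; have := normr_ge0 e; nra.
Qed.

Lemma quot_near (N0 D0 : C) (eps : R) : D0 != 0 -> 0 < eps -> exists2 eta : R, 0 < eta &
  forall N D, cnorm (N - N0) < eta -> cnorm (D - D0) < eta ->
    cnorm D0 / 2 <= cnorm D /\ cnorm (N / D - N0 / D0) < eps.
Proof.
move=> D00 eps0; have nD : 0 < cnorm D0 by rewrite cnorm_gt0.
have nN := cnorm_ge0 N0.
have s0 : 0 < cnorm D0 + cnorm N0 by lra.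
pose eta := Num.min (cnorm D0 / 2) (eps * (cnorm D0 ^+ 2 / 2) / (cnorm D0 + cnorm N0)).
exists eta.
  by rewrite lt_min !divr_gt0 // mulr_gt0 // divr_gt0 // exprn_gt0.
move=> N D; rewrite !lt_min !ltr_pdivlMr // => /andP[_ n2] /andP[d1 d2].
have hD : cnorm D0 / 2 <= cnorm D.
  by have := cnormB D (D - D0); rewrite opprB addrC subrK; lra.
split=> //; have nD' : 0 < cnorm D by lra.
have -> : N / D - N0 / D0 = ((N - N0) * D0 - N0 * (D - D0)) / (D * D0).
  by field; rewrite -!cnorm_gt0 nD nD'.
rewrite cnormM cnormV cnormM ltr_pdivrMr ?mulr_gt0 //.
apply: le_lt_trans (cnormB _ _) _; rewrite !cnormM.
have h : eps * (cnorm D0 ^+ 2 / 2) <= eps * (cnorm D * cnorm D0).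
  by rewrite ler_pM2l // expr2; nra.
apply: lt_le_trans h.
have := cnorm_ge0 (N - N0); have := cnorm_ge0 (D - D0).
have [h|h] := leP (cnorm (N - N0)) (cnorm (D - D0)); nra.
Qed.

Lemma dq_near p q z w : dq p z w != 0 -> exists2 d : R, 0 < d &
  forall e x y, `|e| < d -> cnorm (x - z) < d -> cnorm (y - w) < d ->
    dq (p + e%:C *: q) x y != 0.
Proof.
move=> n0; pose M := Num.max (cnorm z) (cnorm w) + 1.
have [L L0 hL] := dq_lip p M; have [K K0 hK] := dq_lip q M.
have nzM : cnorm z <= M.
  by rewrite /M; have : cnorm z <= Num.max (cnorm z) (cnorm w); [rewrite le_max lexx | lra].
have nwM : cnorm w <= M.
  by rewrite /M; have : cnorm w <= Num.max (cnorm z) (cnorm w); [rewrite le_max lexx orbT | lra].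
have z1M : cnorm z + 1 <= M by rewrite lerD2r le_max lexx.
have w1M : cnorm w + 1 <= M by rewrite lerD2r le_max lexx orbT.
have g0 : 0 < cnorm (dq p z w) by rewrite cnorm_gt0.
pose W := 2 * L + cnorm (dq q z w) + 2 * K + 1.
have W0 : 0 < W by rewrite ltr_wpDl // !addr_ge0 ?mulr_ge0 ?cnorm_ge0.
exists (Num.min 1 (cnorm (dq p z w) / W)); first by rewrite lt_min ltr01 divr_gt0.
set d := Num.min _ _; move=> e x y he hx hy.
have d1 : d <= 1 by rewrite ge_min lexx.
have dW : d * W <= cnorm (dq p z w) by rewrite -ler_pdivlMr // ge_min lexx orbT.
have nx : cnorm x <= M by have := cnormD z (x - z); rewrite addrC subrK; lra.
have ny : cnorm y <= M by have := cnormD w (y - w); rewrite addrC subrK; lra.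
have h1 := hL x y z w nx ny nzM nwM; have h2 := hK x y z w nx ny nzM nwM.
rewrite dqD dqZ -cnorm_gt0.
have := cnormB (dq p x y + e%:C * dq q x y) ((dq p x y - dq p z w) + e%:C * dq q x y).
rewrite (_ : _ - (_ + _) = dq p z w); last by ring.
have := cnormD (dq p x y - dq p z w) (e%:C * dq q x y); rewrite cnormM cnormC.
have := cnormD (dq q z w) (dq q x y - dq q z w); rewrite [_ + (_ - _)]addrC subrK.
have e1 : `|e| <= 1 by lra.
have x0 := cnorm_ge0 (x - z); have y0 := cnorm_ge0 (y - w).
have l1 : L * (cnorm (x - z) + cnorm (y - w)) <= L * (2 * d) by rewrite ler_wpM2l //; lra.
have l2 : K * (cnorm (x - z) + cnorm (y - w)) <= K * 2 by rewrite ler_wpM2l //; lra.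
move=> a1 a2 a3; have q0 := cnorm_ge0 (dq q x y).
have l3 : `|e| * cnorm (dq q x y) <= `|e| * (cnorm (dq q z w) + K * 2).
  by rewrite ler_wpM2l //; lra.
have l4 : `|e| * (cnorm (dq q z w) + K * 2) <= d * (cnorm (dq q z w) + K * 2).
  by rewrite ler_wpM2r ?addr_ge0 ?mulr_ge0 ?cnorm_ge0 // ltW.
have d0 : 0 < d by rewrite /d lt_min ltr01 divr_gt0.
rewrite /W in dW; nra.
Qed.

(** With [kap = conj z (x - z)], the condition [|1 + kap| <= 1] is [2 Re kap + |kap| ^ 2 <= 0]. *)
Lemma disk_tangent z x : cnorm z = 1 -> cnorm x <= 1 ->
  Re (z^* * (x - z)) <= - (cnorm (z^* * (x - z)) ^+ 2 / 2).
Proof.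
move=> z1 x1; rewrite cnormM cnormJ z1 mul1r Re_conj_dot.
have : cnorm x ^+ 2 <= 1 by rewrite expr_le1 ?cnorm_ge0.
have -> : x = z + (x - z) by ring.
by rewrite cnorm_sqrD z1 expr1n [z + _]addrC addrK; lra.
Qed.

Lemma second_order p z : exists2 r : {poly C}, r.[z] = p^`()^`().[z] / 2 &
  forall x, p.[x] - p.[z] = p^`().[z] * (x - z) + (x - z) ^+ 2 * r.[x].
Proof.
have fac q : exists r : {poly C}, q = q.[z]%:P + ('X - z%:P) * r.
  have /factor_theorem[r hr] : root (q - q.[z]%:P) z.
    by rewrite /root hornerD hornerN hornerC subrr.
  by exists r; rewrite mulrC -hr addrC subrK.
have [q hq] := fac p; have [r hr] := fac q.
have p1 : p^`() = q + ('X - z%:P) * q^`().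
  by rewrite {1}hq derivD derivC add0r derivM derivXsubC mul1r.
have q1 : q^`() = r + ('X - z%:P) * r^`().
  by rewrite {1}hr derivD derivC add0r derivM derivXsubC mul1r.
exists r.
  rewrite p1 derivD derivM derivXsubC mul1r !(hornerXsubC, hornerD, hornerM) subrr mul0r addr0.
  by rewrite q1 !(hornerXsubC, hornerD, hornerM) subrr; field.
move=> x; rewrite p1 {1}hq !(hornerXsubC, hornerD, hornerM, hornerC) subrr.
by rewrite {1}hr !(hornerXsubC, hornerD, hornerM, hornerC); ring.
Qed.

(** Both values lie on one real line through [0]. Applied to derivatives, it says that the
    perturbation does not turn the tangent. *)
Lemma self_inversive_ratio n p q z : self_inversive n p -> self_inversive n q ->
  cnorm z = 1 -> p.[z] != 0 -> exists mu : R, q.[z] = mu%:C * p.[z].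
Proof.
move=> sp sq z1 pz; have z0 : z != 0 by rewrite -cnorm_gt0 z1.
have zz : (z^*)^-1 = z by rewrite unit_inv ?cnormJ // conjcK.
have hp := sp z z0; have hq := sq z z0; rewrite zz in hp hq.
have J : (q.[z] * (p.[z])^*)^* = q.[z] * (p.[z])^*.
  by rewrite rmorphM /= conjcK {1}hp {2}hq; ring.
exists (Re (q.[z] * (p.[z])^*) / cnorm p.[z] ^+ 2).
have r0 : q.[z] * (p.[z])^* = (Re (q.[z] * (p.[z])^*))%:C.
  by move: J; case: (_ * _) => a b /= [] h; congr (_ +i* _); lra.
rewrite rmorphM /= -r0 fmorphV /= -mulJ.
by field; rewrite fmorph_eq0 pz.
Qed.

Variables (d : nat) (f h : {poly C}).
Hypotheses (d2 : (2 <= d)%N) (f_S : Sstar_d d f) (h_si : self_inversive d.-1 h^`()).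
Hypothesis h_double : forall z w, cnorm z = 1 -> cnorm w = 1 -> z != w -> f.[z] = f.[w] ->
  dot (z * f^`().[z]) (h.[z] - h.[w]) = 0.

Let f_uni : univalent_disk f := Sstar_univalent f_S.
Notation F e := (f + e%:C *: h).

(* The perturbed boundary curve keeps its tangent direction at [z], and the image
   stays locally on one side of that tangent. *)
Lemma one_sided z : cnorm z = 1 -> f^`().[z] != 0 -> exists2 dl : R, 0 < dl &
  forall e x, `|e| < dl -> cnorm (x - z) < dl -> cnorm x < 1 ->
    dot (z * f^`().[z]) ((F e).[x] - (F e).[z]) < 0.
Proof.
move=> z1 dz; have conv := Sstar_convex d2 f_S z1 dz.
have [mu hmu] := self_inversive_ratio (Sstar_self_inversive d2 f_S) h_si z1 dz.
have [f2 f2z hf2] := second_order f z; have [h2 _ hh2] := second_order h z.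
pose m := cnorm f^`().[z] ^+ 2.
have n0 : 0 < cnorm f^`().[z] by rewrite cnorm_gt0.
have m0 : 0 < m by rewrite exprn_gt0.
pose c0 := (f^`().[z])^* * z * f2.[z].
have rc0 : 0 <= Re c0.
  have -> : c0 = (m / 2)%:C * (z * f^`()^`().[z] / f^`().[z]).
    by rewrite /c0 f2z rmorphM /= -mulJ fmorphV /= rmorph_nat; field.
  by rewrite ReM ReC ImC mul0r subr0 mulr_ge0 // divr_ge0 // ltW.
have [L L0 hL] := poly_lip f2 1; have [H H0 hH] := poly_bound h2 1.
pose W := 3 * cnorm c0 + 2 * (cnorm f^`().[z] * (L + H)) + 1.
have W0 : 0 < W by rewrite ltr_wpDl // addr_ge0 // !mulr_ge0 ?addr_ge0 ?cnorm_ge0.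
have mu0 : 0 < `|mu| + 1 by rewrite ltr_wpDl.
exists (Num.min (m / 2 / W) (2^-1 / (`|mu| + 1))).
  by rewrite lt_min !divr_gt0 // invr_gt0.
set dl := Num.min _ _; move=> e x he hx x1.
have dW : dl * W <= m / 2 by rewrite -ler_pdivlMr // ge_min lexx.
have dmu : dl * (`|mu| + 1) <= 2^-1 by rewrite -ler_pdivlMr // ge_min lexx orbT.
have tan := disk_tangent z1 (ltW x1).
pose k := x - z; pose kap := z^* * k.
rewrite -/k -/kap in tan.
have kE : k = z * kap by rewrite /kap mulrA mulJ z1 expr1n mul1r.
have nk : cnorm kap = cnorm k by rewrite /kap cnormM cnormJ z1 mul1r.
have k0 : 0 < cnorm k.
  by rewrite cnorm_gt0 subr_eq0; apply: contraTneq x1 => ->; rewrite z1 ltxx.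
have a0 : Re kap < 0.
  by apply: le_lt_trans tan _; rewrite oppr_lt0 divr_gt0 // exprn_gt0 // nk.
pose rem := (f^`().[z])^* * z * ((f2.[x] - f2.[z]) + e%:C * h2.[x]).
have FE : (F e).[x] - (F e).[z] = (1 + e * mu)%:C * (f^`().[z] * k) +
    k ^+ 2 * (f2.[x] + e%:C * h2.[x]).
  rewrite !hornerD !hornerZ opprD addrACA -mulrBr hf2 hh2 hmu -/k.
  by rewrite rmorphD rmorph1 rmorphM /=; ring.
(* Every term is measured against [- Re kap > 0]: the first is at most [(m / 2) Re kap], the second
   is bounded by a multiple of [dl |Re kap|] thanks to convexity, and the third by a multiple of
   [dl |k| ^ 2], where [|k| ^ 2 <= - 2 Re kap]. *)
have -> : dot (z * f^`().[z]) ((F e).[x] - (F e).[z]) =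
    m * (1 + e * mu) * Re kap + Re (c0 * kap ^+ 2) + Re (rem * kap ^+ 2).
  rewrite FE -Re_conj_dot rmorphM /=.
  have -> : z^* * (f^`().[z])^* * ((1 + e * mu)%:C * (f^`().[z] * k) +
      k ^+ 2 * (f2.[x] + e%:C * h2.[x])) =
    (m * (1 + e * mu))%:C * kap + c0 * kap ^+ 2 + rem * kap ^+ 2.
    rewrite kE /c0 /rem [(m * _)%:C]rmorphM /= -mulJ.
    have zz : z^* * z = 1 by rewrite mulrC mulJ z1 expr1n.
    transitivity ((1 + e * mu)%:C * (f^`().[z] * (f^`().[z])^*) * (z^* * z) * kap +
      (z^* * z) * ((f^`().[z])^* * z * kap ^+ 2 * (f2.[x] + e%:C * h2.[x]))); first by ring.
    by rewrite zz; ring.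
  by rewrite !ReD ReM ReC ImC mul0r subr0.
have r1 : Re (rem * kap ^+ 2) <= cnorm f^`().[z] * (L + H) * dl * cnorm k ^+ 2.
  apply: le_trans (ler_norm _) _; apply: le_trans (Re_le _) _.
  rewrite cnormM cnormX nk ler_wpM2r ?sqr_ge0 //.
  rewrite /rem !cnormM cnormJ z1 mulr1 -mulrA ler_wpM2l ?cnorm_ge0 //.
  apply: le_trans (cnormD _ _) _; rewrite cnormM cnormC mulrDl lerD //.
    apply: le_trans (hL _ _ (ltW x1) _) _; first by rewrite z1.
    by rewrite ler_wpM2l // ltW.
  by rewrite mulrC; apply: ler_pM; rewrite ?cnorm_ge0 //; [apply: hH|]; apply: ltW.
have kd : cnorm k < dl by [].
have r2 : Re (c0 * kap ^+ 2) <= 3 * cnorm c0 * (- Re kap) * dl.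
  apply: le_trans (Re_quad_le kap rc0) _; rewrite nk (ltr0_norm a0) -!mulrA.
  do 2 (rewrite ler_wpM2l ?cnorm_ge0 //).
  by rewrite ler_wpM2l ?(ltW kd) // oppr_ge0 ltW.
rewrite nk in tan.
have d0 : 0 < dl by rewrite /dl lt_min !divr_gt0 // invr_gt0.
have emu : - 2^-1 <= e * mu.
  have : `|e * mu| <= 2^-1.
    by rewrite normrM; have := normr_ge0 e; have := normr_ge0 mu; nra.
  by rewrite ler_norml => /andP[].
have r3 : m * (1 + e * mu) * Re kap <= m / 2 * Re kap.
  by rewrite ler_nM2r // ler_pM2l //; lra.
have r4 : cnorm f^`().[z] * (L + H) * dl * cnorm k ^+ 2 <=
    cnorm f^`().[z] * (L + H) * dl * (- 2 * Re kap).
  by rewrite ler_wpM2l ?mulr_ge0 ?addr_ge0 ?cnorm_ge0 ?(ltW d0) //; lra.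
have r5 : (dl * W) * (- Re kap) <= m / 2 * (- Re kap) by rewrite ler_wpM2r //; lra.
have : 0 < dl * (- Re kap) by rewrite mulr_gt0 // oppr_gt0.
rewrite /W in r5; lra.
Qed.

Lemma local_double z w : cnorm z = 1 -> cnorm w = 1 -> z != w -> f.[z] = f.[w] ->
  exists2 dl : R, 0 < dl & forall e x y, `|e| < dl -> cnorm (x - z) < dl ->
    cnorm (y - w) < dl -> cnorm x < 1 -> cnorm y < 1 -> (F e).[x] != (F e).[y].
Proof.
move=> z1 w1 zw fzw; have dz := double_regular f_uni z1 w1 zw fzw.
have wz : w != z by rewrite eq_sym.
have dw := double_regular f_uni w1 z1 wz (esym fzw).
have [r r0 hr] := double_normals f_uni z1 w1 zw fzw.
have [d1 d10 h1] := one_sided z1 dz; have [d3 d30 h3] := one_sided w1 dw.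
exists (Num.min d1 d3); first by rewrite lt_min d10.
move=> e x y; rewrite !lt_min => /andP[e1 e3] /andP[hx _] /andP[_ hy] nx ny.
have := h1 e x e1 hx nx; have := h3 e y e3 hy ny.
rewrite hr dotZl mulNr oppr_lt0 pmulr_rgt0 // => k1 k2.
apply/eqP => Fxy; rewrite Fxy in k2.
have : dot (z * f^`().[z]) ((F e).[z] - (F e).[w]) = 0.
  rewrite !hornerD !hornerZ fzw opprD addrACA subrr add0r -mulrBr dotZr.
  by rewrite h_double // mulr0.
rewrite !dotBr in k1 k2 *; lra.
Qed.

End Perturb.

(** * Cusps under perturbation, and univalence of the perturbed polynomial *)

Section Cusp.
Set Implicit Arguments. Unset Strict Implicit. Unset Printing Implicit Defensive.
Variable R : realType.
Notation C := R[i].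
Implicit Types (x y z w : C) (e : R).
Variables (d : nat) (f h : {poly C}).
Hypotheses (d2 : (2 <= d)%N) (f_S : Sstar_d d f) (h_si : self_inversive d.-1 h^`()).

Let f_uni : univalent_disk f := Sstar_univalent f_S.
Notation F e := (f + e%:C *: h).

Lemma pert_deriv (p q : {poly C}) e : (p + e%:C *: q)^`() = p^`() + e%:C *: q^`().
Proof. by rewrite derivD derivZ. Qed.

Lemma pert_self_inversive e : self_inversive d.-1 (F e)^`().
Proof.
rewrite pert_deriv; apply: self_inversiveD; first exact: Sstar_self_inversive.
exact: self_inversiveZ.
Qed.

(* The simple root of [f'] persists; it stays on the circle since the reflection
   [1 / conj r] of a root [r] is a nearby root too. *)
Lemma pert_cusp z (eta : R) : cnorm z = 1 -> f^`().[z] = 0 -> 0 < eta ->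
  exists2 dl : R, 0 < dl & forall e, `|e| < dl ->
    exists r, [/\ cnorm r = 1, (F e)^`().[r] = 0 & cnorm (r - z) < eta].
Proof.
move=> z1 dz eta0; have d2z := deriv2_bd f_uni z1 dz.
have z0 : z != 0 by rewrite -cnorm_gt0 z1.
have n0 : 0 < cnorm f^`()^`().[z] / 2 by rewrite divr_gt0 // cnorm_gt0.
have [dl1 dl10 hd1] := pert_near f^`()^`() h^`()^`() z n0.
have [dl2 dl20 hd2] := @dq_near _ f^`() h^`() z z ltac:(by rewrite dq_diag).
pose S : R := (maxn (size f^`()) (size h^`()))%:R.
pose Q := S * cnorm h^`().[z] / (cnorm f^`()^`().[z] / 2) + 1.
have Q0 : 0 < Q by rewrite ltr_wpDl // divr_ge0 ?(ltW n0) // mulr_ge0 ?ler0n ?cnorm_ge0.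
pose et := Num.min (Num.min eta 2^-1) (dl2 / 2).
have et0 : 0 < et by rewrite !lt_min eta0 invr_gt0 ltr0n divr_gt0.
exists (Num.min (Num.min dl1 dl2) (et / Q)); first by rewrite !lt_min dl10 dl20 divr_gt0.
move=> e; rewrite !lt_min ltr_pdivlMr // => /andP[/andP[e1 e2] e3].
have D2 : cnorm f^`()^`().[z] / 2 <= cnorm (F e)^`()^`().[z].
  have := hd1 e z e1 ltac:(by rewrite subrr cnorm0); rewrite -!pert_deriv.
  set X := _^`().[z]; set Y := _.[z] => hh.
  by have := cnormB X (X - Y); rewrite opprB addrC subrK; lra.
have D0 : (F e)^`()^`().[z] != 0 by rewrite -cnorm_gt0; lra.
have [r rr hr] := newton_root D0.
have rF : (F e)^`().[r] = 0 by apply/rootP.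
have szF : (size (F e)^`())%:R <= S.
  rewrite ler_nat pert_deriv; apply: leq_trans (size_polyD _ _) _.
  by rewrite geq_max leq_maxl /= leq_max size_scale_leq orbT.
have rz : cnorm (r - z) < et.
  apply: le_lt_trans e3; rewrite cnormBC.
  have nF : cnorm (F e)^`().[z] = `|e| * cnorm h^`().[z].
    by rewrite pert_deriv hornerD hornerZ dz add0r cnormM cnormC.
  rewrite -(ler_pM2r n0); apply: le_trans (_ : `|e| * (S * cnorm h^`().[z]) <= _).
    apply: le_trans (_ : cnorm (z - r) * cnorm (F e)^`()^`().[z] <= _).
      by rewrite ler_wpM2l ?cnorm_ge0.
    apply: le_trans hr _; rewrite nF mulrCA ler_wpM2l // ler_wpM2r ?cnorm_ge0 //.
  rewrite -mulrA ler_wpM2l // /Q mulrDl mul1r divfK ?lt0r_neq0 //; lra.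
move: rz; rewrite !lt_min => /andP[/andP[rz1 rz2] rz3].
have r2 : 2^-1 <= cnorm r.
  by have := cnormB r (r - z); rewrite opprB addrC subrK z1; lra.
have r0 : r != 0 by rewrite -cnorm_gt0; lra.
exists r; split => //.
have rF' := self_inversive_root (pert_self_inversive e) r0 rF.
have rz' : cnorm ((r^*)^-1 - z) < dl2.
  have -> : (r^*)^-1 - z = z * (z - r)^* / r^*.
    rewrite rmorphB /= mulrBr mulJ z1 expr1n.
    by field; rewrite fmorph_eq0.
  rewrite !cnormM cnormV !cnormJ z1 mul1r cnormBC ltr_pdivrMr; last by lra.
  by nra.
(* The difference quotient of the perturbed derivative does not vanish near [(z, z)], so the two
   nearby roots coincide. *)
have := hd2 e r (r^*)^-1 e2 ltac:(lra) rz'.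
rewrite -pert_deriv; have := dqP (F e)^`() r (r^*)^-1.
rewrite rF rF' subrr => /esym/eqP; rewrite mulf_eq0 => /orP[|->//].
rewrite subr_eq0 => /eqP rE _; apply/eqP.
have : r * r^* = 1 by rewrite {1}rE mulVf // fmorph_eq0.
rewrite mulJ => /complexI/eqP; rewrite sqrf_eq1 => /orP[//|/eqP h1]; lra.
Qed.

(** The expansion is made about the perturbed cusp [r], in the coordinates [conj r (x - r)] and
    [conj r (y - r)]. As the derivative vanishes at [r], dividing the difference quotient by
    [r c2 / 2] leads to [cusp_inequality] with [E = r c3 / (3 c2)]. This is close to [E0], and
    [Re E0 >= 0] by [Sstar_cusp]. *)
Lemma local_cusp z : cnorm z = 1 -> f^`().[z] = 0 -> exists2 dl : R, 0 < dl &
  forall e x y, `|e| < dl -> cnorm (x - z) < dl -> cnorm (y - z) < dl ->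
    cnorm x < 1 -> cnorm y < 1 -> (F e).[x] = (F e).[y] -> x = y.
Proof.
move=> z1 dz; have d2z := deriv2_bd f_uni z1 dz.
have [K [fK Kz hK]] := Sstar_cusp d2 f_S z1 dz.
have fK1 : f^`()^`().[z] = K.[z].
  by rewrite fK derivM derivXsubC mul1r !(hornerXsubC, hornerD, hornerM) subrr mul0r addr0.
have fK2 : f^`()^`()^`().[z] = 2 * K^`().[z].
  rewrite fK derivM derivXsubC mul1r derivD derivM derivXsubC mul1r.
  by rewrite !(hornerXsubC, hornerD, hornerM) subrr mul0r; ring.
pose E0 := z * f^`()^`()^`().[z] / (3 * f^`()^`().[z]).
have rE0 : 0 <= Re E0.
  have -> : E0 = (2 / 3)%:C * (z * K^`().[z] / K.[z]).
    by rewrite /E0 fK1 fK2 rmorphM /= fmorphV /= !rmorph_nat; field.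
  by rewrite ReM ReC ImC mul0r subr0 mulr_ge0 // divr_ge0.
have D00 : 3 * f^`()^`().[z] != 0 by rewrite mulf_neq0 // pnatr_eq0.
have q4 : 0 < 4^-1 :> R by rewrite invr_gt0.
have [eta eta0 heta] := quot_near (z * f^`()^`()^`().[z]) D00 q4.
have eta3 : 0 < eta / 3 by rewrite divr_gt0.
have [dl1 dl10 hd1] := pert_near f^`()^`() h^`()^`() z eta3.
have [dl2 dl20 hd2] := pert_near ('X * f^`()^`()^`()) ('X * h^`()^`()^`()) z eta0.
have [Bf Bf0 hBf] := dq_taylor f; have [Bh Bh0 hBh] := dq_taylor h.
pose m := cnorm f^`()^`().[z] / 4.
have m0 : 0 < m by rewrite divr_gt0 // cnorm_gt0.
have e10 : 0 <= cnorm E0 + 1 by rewrite addr_ge0 ?cnorm_ge0.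
have B10 : 0 <= (Bf + Bh) / m by rewrite divr_ge0 ?addr_ge0 // ltW.
have [dc dc0 hdc] := cusp_inequality e10 B10.
(* [|x - r| <= |x - z| + |r - z|] is below [2 dm], which has to stay below both [dc] and [1]. *)
pose dm := Num.min (Num.min dl1 dl2) (Num.min (Num.min dc 1) 1 / 4).
have dm0 : 0 < dm by rewrite !lt_min dl10 dl20 divr_gt0 // !lt_min dc0 ltr01.
have [dl3 dl30 hd3] := pert_cusp z1 dz dm0.
exists (Num.min dl3 dm); first by rewrite lt_min dl30.
move=> e x y; rewrite ![_ < Num.min dl3 dm]lt_min => /andP[e3 em] /andP[_ xz] /andP[_ yz] nx ny Fxy.
have [r [r1 Fr rz]] := hd3 e e3.
apply/eqP; apply: contraT => xy.
have mle : [/\ dm <= dl1, dm <= dl2, 4 * dm <= dc & 4 * dm <= 1].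
  have : dm <= Num.min dl1 dl2 by rewrite ge_min lexx.
  have : dm <= Num.min (Num.min dc 1) 1 / 4 by rewrite ge_min lexx orbT.
  rewrite le_min => u /andP[-> ->].
  have u1 : Num.min (Num.min dc 1) 1 <= 1 by rewrite ge_min lexx orbT.
  have u2 : Num.min (Num.min dc 1) 1 <= dc by rewrite !ge_min lexx.
  by split=> //; move: u u1 u2; clear -R d f h d2 f_S h_si f_uni; lra.
case: mle => m1 m2 m3 m4.
have ed1 : `|e| < dl1 := lt_le_trans em m1.
have ed2 : `|e| < dl2 := lt_le_trans em m2.
have rd1 : cnorm (r - z) < dl1 := lt_le_trans rz m1.
have rd2 : cnorm (r - z) < dl2 := lt_le_trans rz m2.
have k1 := hd1 e r ed1 rd1; have k2 := hd2 e r ed2 rd2.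
have FE1 : (F e)^`()^`() = f^`()^`() + e%:C *: h^`()^`() by rewrite !pert_deriv.
have FE2 : (F e)^`()^`()^`() = f^`()^`()^`() + e%:C *: h^`()^`()^`() by rewrite !pert_deriv.
pose c2 := (F e)^`()^`().[r]; pose c3 := (F e)^`()^`()^`().[r].
have c3E : ('X * f^`()^`()^`() + e%:C *: ('X * h^`()^`()^`())).[r] = r * c3.
  by rewrite /c3 FE2 !(hornerD, hornerZ, hornerM, hornerX); ring.
rewrite -FE1 -/c2 in k1; rewrite c3E hornerM hornerX in k2.
have k1' : cnorm (3 * c2 - 3 * f^`()^`().[z]) < eta.
  rewrite -mulrBr cnormM -(rmorph_nat (real_complex R)) cnormC normr_nat.
  by move: k1; rewrite ltr_pdivlMr // mulrC.
have [D3 Eq] := heta _ _ k2 k1'.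
have n3 (u : C) : cnorm (3 * u) = 3 * cnorm u.
  by rewrite cnormM -(rmorph_nat (real_complex R)) cnormC normr_nat.
rewrite !n3 in D3; rewrite -/E0 in Eq.
pose E := r * c3 / (3 * c2).
have c2m : m <= cnorm c2 / 2 by rewrite /m; move: D3; clear -R d f h d2 f_S h_si f_uni; lra.
have c20 : c2 != 0 by rewrite -cnorm_gt0; move: c2m m0; clear -R d f h d2 f_S h_si f_uni; lra.
have nE : cnorm E <= cnorm E0 + 1.
  by have := cnormD E0 (E - E0); rewrite addrC subrK; move: Eq; clear -R d f h d2 f_S h_si f_uni; lra.
have rE : - 4^-1 <= Re E.
  by have := Re_le (E - E0); rewrite ReD ReN ler_norml; move: rE0 Eq; clear -R d f h d2 f_S h_si f_uni; lra.
have nr := disk_tangent r1 (ltW nx); have nr' := disk_tangent r1 (ltW ny).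
pose kap := r^* * (x - r); pose lam := r^* * (y - r).
have xE : x = r + r * kap by rewrite /kap mulrA mulJ r1 expr1n mul1r addrC subrK.
have yE : y = r + r * lam by rewrite /lam mulrA mulJ r1 expr1n mul1r addrC subrK.
pose M := Num.max (cnorm kap) (cnorm lam).
have kM : cnorm kap <= M by rewrite le_max lexx.
have lM : cnorm lam <= M by rewrite le_max lexx orbT.
have M0 : 0 < M.
  rewrite lt_neqAle (le_trans (cnorm_ge0 _) kM) andbT; apply: contra_neq xy => Mz.
  have /eqP : cnorm kap = 0 by apply/eqP; rewrite eq_le cnorm_ge0 andbT Mz.
  have /eqP : cnorm lam = 0 by apply/eqP; rewrite eq_le cnorm_ge0 andbT Mz.
  by rewrite !cnorm_eq0 xE yE => /eqP -> /eqP ->.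
have MM : cnorm kap = M \/ cnorm lam = M.
  by rewrite /M; case: leP => _; [right | left].
have Md : M < dc /\ M <= 1.
  have kx : cnorm kap < 4 * dm.
    rewrite /kap cnormM cnormJ r1 mul1r; have := cnormB (x - z) (r - z).
    by rewrite (_ : x - z - (r - z) = x - r); [move: xz rz dm0; clear -R d f h d2 f_S h_si f_uni; lra | ring].
  have ly : cnorm lam < 4 * dm.
    rewrite /lam cnormM cnormJ r1 mul1r; have := cnormB (y - z) (r - z).
    by rewrite (_ : y - z - (r - z) = y - r); [move: yz rz dm0; clear -R d f h d2 f_S h_si f_uni; lra | ring].
  by case: MM => <-; split; move: kx ly m3 m4; clear -R d f h d2 f_S h_si f_uni; lra.
case: Md => Mdc Md1.
have nrk : cnorm (r * kap) <= M by rewrite cnormM r1 mul1r.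
have nrl : cnorm (r * lam) <= M by rewrite cnormM r1 mul1r.
have r2 : cnorm r <= 2 by rewrite r1 ler1n.
have [tf _] := hBf r (r * kap) (r * lam) M r2 nrk nrl Md1.
have [th _] := hBh r (r * kap) (r * lam) M r2 nrk nrl Md1.
have dqF : dq (F e) (r + r * kap) (r + r * lam) = 0.
  have := dqP (F e) x y; rewrite Fxy subrr => /esym/eqP.
  by rewrite mulf_eq0 subr_eq0 (negbTE xy) /= -xE -yE => /eqP.
case: (hdc kap lam E nE rE nr nr' M _ Md1 kM lM MM _); first by rewrite M0.
have e1 : `|e| <= 1 by move: em dm0 m4; clear -R d f h d2 f_S h_si f_uni; lra.
rewrite [leRHS]mulrAC ler_pdivlMr //.
apply: le_trans (_ : cnorm (c2 / 2 * r * (kap + lam + E * (kap ^+ 2 + kap * lam + lam ^+ 2))) <= _).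
  rewrite !cnormM r1 mulr1 mulrC ler_wpM2r ?cnorm_ge0 //.
  rewrite cnormV -(rmorph_nat (real_complex R)) cnormC normr_nat; lra.
have -> : c2 / 2 * r * (kap + lam + E * (kap ^+ 2 + kap * lam + lam ^+ 2)) =
   (F e)^`().[r] + c2 / 2 * (r * kap + r * lam) +
   c3 / 6 * ((r * kap) ^+ 2 + r * kap * (r * lam) + (r * lam) ^+ 2) -
   dq (F e) (r + r * kap) (r + r * lam).
  by rewrite Fr dqF /E; field.
move: tf th; rewrite dqD dqZ /c2 /c3 FE2 FE1 pert_deriv !hornerD !hornerZ.
set a1 := dq f _ _; set a2 := dq h _ _.
set A := a1 - _; set B := a2 - _ => tf th.
rewrite (_ : _ - _ = - (A + e%:C * B)); last by rewrite /A /B; field.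
rewrite cnormN; apply: le_trans (cnormD _ _) _; rewrite cnormM cnormC mulrDl lerD //.
by apply: le_trans th; rewrite ler_piMl ?cnorm_ge0.
Qed.

Hypothesis h_double : forall z w, cnorm z = 1 -> cnorm w = 1 -> z != w -> f.[z] = f.[w] ->
  dot (z * f^`().[z]) (h.[z] - h.[w]) = 0.

(** By compactness a local argument at each pair of points of the closed disk suffices. A nonzero
    difference quotient of [f] persists; a pair where it vanishes is a cusp on the circle or a
    double point of the boundary curve. *)
Lemma perturb_univalent : exists2 e0 : R, 0 < e0 &
  forall e, `|e| < e0 -> univalent_disk (F e).
Proof.
suff [dl dl0 hd] : exists2 dl : R, 0 < dl & forall e x y, `|e| < dl ->
    cnorm x <= 1 -> cnorm y <= 1 -> cnorm x < 1 -> cnorm y < 1 -> (F e).[x] = (F e).[y] -> x = y.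
  exists dl => // e he x y; rewrite !cnorm_lt1 => nx ny.
  by apply: (hd e) => //; apply: ltW.
apply: cover_bidisk => z w nz nw.
have [dq0|dq0] := eqVneq (dq f z w) 0; last first.
  have [dl dl0 hd] := dq_near h dq0.
  exists dl => // e x y he hx hy _ _ _ _ Fxy; have := hd e x y he hx hy.
  have := dqP (F e) x y; rewrite Fxy subrr => /esym/eqP; rewrite mulf_eq0 subr_eq0.
  by case/orP => [/eqP//|->].
have [zw|zw] := eqVneq z w.
  rewrite -zw dq_diag in dq0; have z1 : cnorm z = 1.
    apply/eqP; rewrite eq_le nz leNgt /=; apply/negP => /(deriv_in f_uni).
    by rewrite dq0 eqxx.
  have [dl dl0 hd] := local_cusp z1 dq0.
  by exists dl => // e x y he hx; rewrite -zw => hy _ _; apply: hd.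
have fzw : f.[z] = f.[w] by apply/eqP; rewrite -subr_eq0 dqP dq0 mulr0.
have [z1 w1] : cnorm z = 1 /\ cnorm w = 1.
  move: nz nw; rewrite !le_eqVlt => /orP[/eqP z1|z1] /orP[/eqP w1|w1] //.
  - by case: (interior_neq_boundary f_uni w1 z1).
  - by case: (interior_neq_boundary f_uni z1 w1).
  by case/eqP: zw; apply: (univ f_uni).
have [dl dl0 hd] := local_double d2 f_S h_si h_double z1 w1 zw fzw.
exists dl => // e x y he hx hy _ _ nx ny Fxy.
by have := hd e x y he hx hy nx ny; rewrite Fxy eqxx.
Qed.

End Cusp.

(** * Self-inversive directions subject to linear conditions *)

Section Direction.
Set Implicit Arguments. Unset Strict Implicit. Unset Printing Implicit Defensive.
Variable R : realType.
Notation C := R[i].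

(** The derivative has two exponents adding up to [d - 1], with conjugate coefficients. The factors
    [1 +i* 1] and [1 -i* 1] treat all indices alike: real coordinates [x], [y] at two mirror indices
    are determined by [x (1 +i* 1) + y (1 -i* 1)], and a middle index, whose exponents coincide,
    contributes [2 x], so the [d - 2] polynomials are independent over the reals. *)
Definition basis_poly (d i : nat) : {poly C} :=
  ((1 +i* 1) / i.+2%:R) *: 'X^(i.+2) + ((1 -i* 1) / (d - i).-1%:R) *: 'X^((d - i).-1).

Lemma basis_poly_deriv d i : (i < d.-2)%N ->
  (basis_poly d i)^`() = (1 +i* 1) *: 'X^(i.+1) + (1 -i* 1) *: 'X^((d - i).-2).
Proof.
move=> id; have e : ((d - i).-1 = (d - i).-2.+1)%N by lia.
have cz (c : C) m (p : {poly C}) : (c / m.+1%:R) *: (p *+ m.+1) = c *: p.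
  by rewrite -[p *+ _]scaler_nat scalerA divfK // pnatr_eq0.
by rewrite derivD !derivZ !derivXn e !cz.
Qed.

Lemma basis_poly_self_inversive d i : (i < d.-2)%N ->
  self_inversive d.-1 (basis_poly d i)^`().
Proof.
move=> id z z0; rewrite basis_poly_deriv //.
have e : d.-1 = (i.+1 + (d - i).-2)%N by lia.
rewrite !hornerD !hornerZ !hornerXn e rmorphD !rmorphM !rmorphXn /= fmorphV /= conjcK.
rewrite opprK exprD !exprVn.
by field; rewrite !expf_neq0.
Qed.

Lemma exists_direction (d N : nat) (a u v : 'I_N -> C) : (N < d.-2)%N ->
  exists h : {poly C}, [/\ h != 0, (size h <= d)%N, h`_0 = 0 /\ h`_1 = 0,
    self_inversive d.-1 h^`() & forall j, dot (a j) (h.[u j] - h.[v j]) = 0].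
Proof.
move=> Nd; pose A : 'M[R]_(d.-2, N) :=
  \matrix_(i, j) dot (a j) ((basis_poly d i).[u j] - (basis_poly d i).[v j]).
have kA : kermx A != 0.
  rewrite kermx_eq0 /row_free; apply/negP => /eqP rA.
  by have := rank_leq_col A; rewrite rA leqNgt Nd.
have /rowV0Pn[x /sub_kermxP xA x0] := kA.
pose h : {poly C} := \sum_(i < d.-2) (x 0 i)%:C *: basis_poly d i.
have hd : h^`() = \sum_(i < d.-2) (x 0 i)%:C *: (basis_poly d i)^`().
  by rewrite /h raddf_sum; apply: eq_bigr => i _; exact: derivZ.
have coef (j : 'I_(d.-2)) : (h^`())`_j.+1 =
    (x 0 j)%:C * (1 +i* 1) + (x 0 (rev_ord j))%:C * (1 -i* 1).
  have -> : (h^`())`_j.+1 = \sum_(i < d.-2) ((x 0 i)%:C * ((1 +i* 1) * (i == j)%:R) +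
     (x 0 i)%:C * ((1 -i* 1) * (i == rev_ord j)%:R)).
    rewrite hd coef_sum; apply: eq_bigr => i _.
    rewrite coefZ basis_poly_deriv // coefD !coefZ !coefXn mulrDr eqSS.
    congr (_ + _); first by rewrite eq_sym.
    congr (_ * (_ * (nat_of_bool _)%:R)); apply/eqP/eqP => [e|->]; last by rewrite /=; have := ltn_ord j; lia.
    by apply: val_inj => /=; have := ltn_ord j; have := ltn_ord i; lia.
  have del (c : C) (k : 'I_(d.-2)) : \sum_i (x 0 i)%:C * (c * (i == k)%:R) = (x 0 k)%:C * c.
    by rewrite (bigD1 k) //= eqxx mulr1 big1 ?addr0 // => i /negbTE ->; rewrite !mulr0.
  by rewrite big_split /= !del.
exists h; split.
- apply: contraNneq x0 => h0; apply/eqP/rowP => j; rewrite mxE.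
  have := coef j; rewrite h0 deriv0 coef0 => /esym e.
  have e1 := congr1 (@complex.Re R) e; have e2 := congr1 (@complex.Im R) e.
  move: e1 e2; rewrite !(ReD, ImD, ReM, ImM, RecE, ImcE, ReC, ImC) /=.
  rewrite !(mulr1, mul0r, mulrN, subr0, addr0, mulr1) => e1 e2; lra.
- apply: (big_ind (fun p : {poly C} => (size p <= d)%N)); first by rewrite size_poly0.
    by move=> p q sp sq; apply: leq_trans (size_polyD _ _) _; rewrite geq_max sp.
  move=> i _; apply: leq_trans (size_scale_leq _ _) _.
  apply: leq_trans (size_polyD _ _) _; rewrite geq_max; have id := ltn_ord i.
  by apply/andP; split; apply: leq_trans (size_scale_leq _ _) _; rewrite size_polyXn; lia.
- have c m : (m < 2)%N -> h`_m = 0.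
    move=> m2; rewrite coef_sum big1 // => i _; have id := ltn_ord i.
    rewrite coefZ coefD !coefZ !coefXn.
    have -> : (m == i.+2) = false by apply/eqP; lia.
    have -> : (m == (d - i).-1) = false by apply/eqP; lia.
    by rewrite !mulr0 addr0 mulr0.
  by split; apply: c.
- rewrite hd; apply: (big_ind (self_inversive d.-1)).
  + by move=> z _; rewrite !horner0 rmorph0 mulr0.
  + exact: self_inversiveD.
  by move=> i _; apply: self_inversiveZ; apply: basis_poly_self_inversive.
move=> j; have := congr1 (fun M : 'rV[R]_N => M 0 j) xA; rewrite !mxE => <-.
have dotS (F : 'I_(d.-2) -> C) : dot (a j) (\sum_i F i) = \sum_i dot (a j) (F i).
  apply: (big_morph (dot (a j))); first by move=> *; apply: dotDr.
  by rewrite /dot /= !mulr0 addr0.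
rewrite !horner_sum -sumrB dotS; apply: eq_bigr => i _.
by rewrite mxE !hornerZ -mulrBr dotZr.
Qed.

End Direction.

(** * Extreme points have the maximal number of double points *)

Section Extreme.
Set Implicit Arguments. Unset Strict Implicit. Unset Printing Implicit Defensive.
Variable R : realType.
Notation C := R[i].
Variables (d : nat) (f : {poly C}).
Hypotheses (d2 : (2 <= d)%N) (f_S : Sstar_d d f).

Let f_uni : univalent_disk f := Sstar_univalent f_S.

(** Lists of double points have bounded length by [double_bound], so there is a longest one, and it
    misses no double point. *)
Lemma double_points_finite : exists s : seq C, [/\ uniq s, (size s <= d.-2)%N &
  forall w, w \in s <-> double_point f w].
Proof.
pose P n := `[< exists s : seq C, [/\ uniq s, size s = n & forall w, w \in s -> double_point f w] >].
have P0 : exists n, P n by exists 0%N; apply/asboolP; exists [::].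
have Pb n : P n -> (n <= d.-2)%N.
  by move=> /asboolP[s [us <- hs]]; apply: (double_bound d2 f_S us hs).
have [n /asboolP[s [us szs hs]] nmax] := ex_maxnP P0 Pb.
exists s; split=> //; first by rewrite szs; apply: Pb; apply/asboolP; exists s.
move=> w; split; first exact: hs.
move=> dw; apply: contraT => ws; have : P n.+1.
  apply/asboolP; exists (w :: s); split; rewrite /= ?ws ?szs //.
  by move=> x; rewrite inE => /orP[/eqP ->|/hs].
by move/nmax; rewrite ltnn.
Qed.

Lemma not_extreme (s : seq C) : (size s < d.-2)%N ->
  (forall w, double_point f w -> w \in s) -> ~ extreme_point (Sstar_d d) f.
Proof.
move=> szs hs [_ ext].
have pts (w : C) : exists p : C * C, double_point f w ->
    [/\ cnorm p.1 = 1, cnorm p.2 = 1, p.1 != p.2, f.[p.1] = w & f.[p.2] = w].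
  have [[z1 [z2 [/cnorm_norm1 n1 [/cnorm_norm1 n2 [/eqP z12 [e1 e2]]]]]]|nd] :=
    pselect (double_point f w); last by exists (0, 0).
  by exists (z1, z2).
have [g hg] := choice pts.
pose W (j : 'I_(size s)) := g (nth 0 s j).
have [h [h0 szh [h00 h01] hsi hdot]] := exists_direction
  (fun j => (W j).1 * f^`().[(W j).1]) (fun j => (W j).1) (fun j => (W j).2) szs.
(* The linear conditions were imposed for one ordered pair per double point. By [no_triple] any
   other pair is the same up to order, and an exchange multiplies the normal by a negative
   number. *)
have hdbl z w : cnorm z = 1 -> cnorm w = 1 -> z != w -> f.[z] = f.[w] ->
    dot (z * f^`().[z]) (h.[z] - h.[w]) = 0.
  move=> z1 w1 zw fzw; have dp : double_point f f.[z].
    by exists z, w; do ![split]; rewrite ?cnorm_norm1 //; apply/eqP.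
  have zs := hs _ dp; have js : (index f.[z] s < size s)%N by rewrite index_mem.
  have := hdot (Ordinal js); rewrite /W /= nth_index // => hd.
  have [n1 n2 p12 e1 e2] := hg _ dp; set p := g f.[z] in n1 n2 p12 e1 e2 hd.
  have same x y y' : cnorm x = 1 -> cnorm y = 1 -> cnorm y' = 1 -> y != y' ->
      f.[x] = f.[y] -> f.[y] = f.[y'] -> x = y \/ x = y'.
    move=> x1 y1 y1' yy' fx fy; have [->|xy] := eqVneq x y; first by left.
    have [->|xy'] := eqVneq x y'; first by right.
    by case: (no_triple f_uni x1 y1 y1' xy yy' xy' fx fy).
  have ez := same z p.1 p.2 z1 n1 n2 p12 (esym e1) (etrans e1 (esym e2)).
  have ew := same w p.1 p.2 w1 n1 n2 p12 (etrans (esym fzw) (esym e1)) (etrans e1 (esym e2)).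
  case: ez ew => ez [] ew.
  - by move: zw; rewrite ez ew eqxx.
  - by rewrite ez ew.
  - have [r r0] := double_normals f_uni n1 n2 p12 (etrans e1 (esym e2)).
    by rewrite ez ew => ->; rewrite dotZl -opprB dotNr hd oppr0 mulr0.
  by move: zw; rewrite ez ew eqxx.
have [e0 e00 he] := perturb_univalent d2 f_S hsi hdbl.
have S e : `|e| < e0 -> Sstar_d d (f + e%:C *: h).
  move=> ee; case: (f_S) => -[szf [f0 [f1 _]]] fd; split; last first.
    by rewrite coefD coefZ (nth_default _ szh) mulr0 addr0.
  split; last by rewrite !coefD !coefZ h00 h01 !mulr0 !addr0; do !split => //; apply: he.
  apply: leq_trans (size_polyD _ _) _; rewrite geq_max szf /=.
  by apply: leq_trans (size_scale_leq _ _) _; apply: leqW.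
have a1 : `|e0 / 2| < e0 by rewrite ger0_norm; lra.
have a2 : `|- (e0 / 2)| < e0 by rewrite normrN.
have := ext _ _ (S _ a1) (S _ a2).
have -> : f + (e0 / 2)%:C *: h + (f + (- (e0 / 2))%:C *: h) = 2%:R *: f.
  rewrite rmorphN scaleNr addrACA subrr addr0 scaler_nat mulr2n //.
rewrite scalerA mulVf ?pnatr_eq0 // scale1r => /(_ erefl) /addrI /eqP.
rewrite -subr_eq0 -scalerBl scaler_eq0 (negbTE h0) orbF -rmorphB.
by rewrite -cnorm_eq0 cnormC normr_eq0 => /eqP; lra.
Qed.

End Extreme.

Theorem theorem2p5 (R : realType) (d : nat) (hd : (2 <= d)%N) (f : {poly R[i]}) :
  extreme_point (Sstar_d d) f -> Suffridge d f.
Proof.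
move=> ext; have fS := ext.1.
have [s [us szs hs]] := double_points_finite hd fS.
split; first exact: fS.1.
split; first exact: Sstar_cusps hd fS.
exists s; split=> //; split=> //; apply/eqP; rewrite eqn_leq szs leqNgt.
by apply/negP => lt_s; apply: (not_extreme hd fS lt_s _ ext) => w /hs.
Qed.
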